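(* Let $\Sigma=\{0,1\}^{\mathbb Z}$ with the left shift $f((x_n)_{n\in\mathbb Z})=(x_{n+1})_{n\in\mathbb Z}$ and the metric $d(x,y)=2^{-N(x,y)}$, where $N(x,y)=\max\{N\ge 0: x_n=y_n \text{ for all } |n|<N\}$. Fix $\alpha>0$ and let $C^{\alpha}(\Sigma,SL(2,\mathbb R))$ be the space of $\alpha$-H\''older continuous maps $A:\Sigma\to SL(2,\mathbb R)$ with the norm \[\|A\|_{\alpha}=\sup_{x\in\Sigma}\|A(x)\|+\sup_{x\neq y}\frac{\|A(x)-A(y)\|}{d(x,y)^{\alpha}}.\] For $\sigma>1$ let $A_\sigma(x)=\mathrm{diag}(\sigma^{-1},\sigma)$ if $x_0=0$ and $A_\sigma(x)=\mathrm{diag}(\sigma,\sigma^{-1})$ if $x_0=1$. For $p\in(1/2,1)$ let $\mu_p$ be the Bernoulli product measure $\nu_p^{\mathbb Z}$ on $\Sigma$, where $\nu_p(\{0\})=1-p$, $\nu_p(\{1\})=p$. Let $p\in(1/2,1)$ and $\sigma>1$ satisfy $\sigma^{4p-2}\ge 2^{\alpha}$. Then for every open neighborhood $\mathcal U\subset C^{\alpha}(\Sigma,SL(2,\mathbb R))$ of $A_\sigma$ and every $\kappa\in(0,(2p-1)\log\sigma]$ there is a locally constant cocycle $L\in\mathcal U$ with $\lambda_+(L,\mu_p)=\kappa$. In particular, $A_\sigma$ is a discontinuity point of the map $A\mapsto\lambda_+(A,\mu_p)$ on $C^{\alpha}(\Sigma,SL(2,\mathbb R))$.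
   Context: $\|\cdot\|$ denotes the Euclidean norm on $\mathbb R^2$ and the associated operator norm. For a cocycle $A:\Sigma\to SL(2,\mathbb R)$ over $f$, $A^n(x)=A(f^{n-1}(x))\cdots A(x)$, and the upper Lyapunov exponent with respect to an $f$-invariant probability measure $\mu$ is $\lambda_+(A,\mu)=\inf_{n\ge1}\frac1n\int_\Sigma\log\|A^n\|\,d\mu$. A cocycle is locally constant if it is constant on cylinders of some fixed length. Note $\lambda_+(A_\sigma,\mu_p)=(2p-1)\log\sigma$. *)

(* Defs.v *)
From HB Require Import structures.
From mathcomp Require Import all_boot all_order all_algebra.
From mathcomp Require Import all_classical all_reals all_analysis.
Set Implicit Arguments. Unset Strict Implicit. Unset Printing Implicit Defensive.
Import Order.TTheory GRing.Theory Num.Theory.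
Import numFieldNormedType.Exports.
Local Open Scope classical_set_scope.
Local Open Scope ring_scope.

Definition seqZ := int -> bool.

Definition cylinder (S : seq int) (w : int -> bool) : set seqZ :=
  [set x | forall i, i \in S -> x i = w i].

Definition cylinders : set (set seqZ) :=
  [set C | exists S w, C = cylinder S w].

Definition Sigma := g_sigma_algebraType cylinders.

Definition shift (x : Sigma) : Sigma := fun n => x (n + 1).

(** mu is the Bernoulli product measure nu_p^Z, nu_p{1} = p, nu_p{0} = 1-p:
    the (unique) probability measure with these cylinder values. *)
Definition is_bernoulli (R : realType) (p : R) (mu : probability Sigma R) :=
  forall (S : seq int) (w : int -> bool), uniq S ->
    mu (cylinder S w) = (\prod_(i <- S) (if w i then p else 1 - p))%:E.

(** Metric d(x,y) = 2^{-N(x,y)}, N(x,y) = max{N >= 0 : x_n = y_n for |n| < N}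
    (d(x,x) = 0). *)
Definition dist (R : realType) (x y : Sigma) : R :=
  inf [set (2^-1 : R) ^+ N | N in [set N : nat |
         forall n : int, (absz n < N)%N -> x n = y n]].

Definition vnorm (R : realType) (v : 'cV[R]_2) : R :=
  Num.sqrt (\sum_(i < 2) v i ord0 ^+ 2).

Definition opnorm (R : realType) (M : 'M[R]_2) : R :=
  sup [set vnorm (M *m v) | v in [set v : 'cV[R]_2 | vnorm v = 1]].

Definition is_holder (R : realType) (alpha : R) (A : Sigma -> 'M[R]_2) :=
  exists C : R, forall x y : Sigma, x <> y ->
    opnorm (A x - A y) <= C * (dist R x y) `^ alpha.

Definition holder_norm (R : realType) (alpha : R) (A : Sigma -> 'M[R]_2) : R :=
  sup (range (fun x => opnorm (A x))) +
  sup [set opnorm (A xy.1 - A xy.2) / (dist R xy.1 xy.2) `^ alpha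
        | xy in [set xy : Sigma * Sigma | xy.1 <> xy.2]].

Definition CaSL (R : realType) (alpha : R) : set (Sigma -> 'M[R]_2) :=
  [set A | is_holder alpha A /\ forall x, \det (A x) = 1].

Definition open_CaSL (R : realType) (alpha : R) (U : set (Sigma -> 'M[R]_2)) :=
  U `<=` CaSL alpha /\
  forall A, U A -> exists2 e : R, 0 < e &
    forall B, CaSL alpha B -> holder_norm alpha (fun x => B x - A x) < e -> U B.

Fixpoint cocycle (R : realType) (A : Sigma -> 'M[R]_2) (n : nat) (x : Sigma)
  : 'M[R]_2 :=
  match n with
  | 0 => 1%:M
  | n.+1 => A (iter n shift x) *m cocycle A n x
  end.

Definition lyap (R : realType) (mu : probability Sigma R) (A : Sigma -> 'M[R]_2) : R :=
  inf [set (n.+1%:R)^-1 *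
           fine (\int[mu]_x (ln (opnorm (cocycle A n.+1 x)))%:E)
      | n in [set: nat]].

Definition locally_constant (R : realType) (A : Sigma -> 'M[R]_2) :=
  exists k : nat, forall x y : Sigma,
    (forall n : int, (absz n <= k)%N -> x n = y n) -> A x = A y.

Definition diag2 (R : realType) (a b : R) : 'M[R]_2 :=
  \matrix_(i < 2, j < 2) (if i == j then (if i == ord0 then a else b) else 0).

Definition A_sigma (R : realType) (s : R) (x : Sigma) : 'M[R]_2 :=
  if x 0 then diag2 s s^-1 else diag2 s^-1 s.

(* Main.v *)
Require Import Defs.
From HB Require Import structures.
From mathcomp Require Import all_boot all_order all_algebra.
From mathcomp Require Import all_classical all_reals all_analysis.
From mathcomp Require Import measurable_realfun.
From mathcomp Require Import zify ring lra.
Set Implicit Arguments. Unset Strict Implicit. Unset Printing Implicit Defensive.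
Import Order.TTheory GRing.Theory Num.Theory.
Local Open Scope classical_set_scope.
Local Open Scope ring_scope.

(**
Fix g slightly larger than s and write y = 2^alpha, so that y < g^(4p-2). Since rare
patterns of length l can be detected at a cost y^l in the Hölder norm, a perturbation of
the diagonal cocycle by a shear of size e0 << y^-rho at the beginning of every run of rho
zeros is small. Along the zeros, which are expanding for slopes, the shear grows by g^2
per step; after T zeros it has become so large that a shear by its inverse, again small
since g^2 > y, exchanges the two axes. When the run stops earlier, the slope decays at
the average rate g^-(4p-2), and it is erased after n steps by a shear of size less than
y^-n. Up to exceptional words of tiny probability, the perturbed cocycle is therefore
conjugate, by triangular matrices of bounded size, to a monomial cocycle whose
axes are swapped after each run of T zeros. The logarithm of the growth of an axis is, up
to a bounded corrector, a martingale, so it is o(N) and the exponent is as small as wanted.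

Scaling these shears by x in [0, 1] joins a positive cocycle of exponent at least
(2p - 1) ln g > kappa to one of exponent less than kappa. Shears of a much smaller size
eta, at isolated runs of one or two zeros, map every vector to many transversal images;
this makes the exponent depend continuously on x, and the intermediate value theorem gives
the exponent kappa.
*)

(** * Norms of two by two matrices *)

Section Norms.
Variable R : realType.
Implicit Types (M N : 'M[R]_2) (v w : 'cV[R]_2).

Lemma sum2E (F : 'I_2 -> R) : \sum_i F i = F 0 + F 1.
Proof.
by rewrite big_ord_recl big_ord1; congr (_ + F _); apply: val_inj.
Qed.

Lemma ord2E (i : 'I_2) : i = 0 \/ i = 1.
Proof.
by case: i => [[|[|//]] Hi]; [left|right]; apply: val_inj.
Qed.

Lemma mul2mxE M v i : (M *m v) i 0 = M i 0 * v 0 0 + M i 1 * v 1 0.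
Proof. by rewrite mxE sum2E. Qed.

Lemma mul2E M N i j : (M *m N) i j = M i 0 * N 0 j + M i 1 * N 1 j.
Proof. by rewrite mxE sum2E. Qed.

Lemma cV2P v w : v 0 0 = w 0 0 -> v 1 0 = w 1 0 -> v = w.
Proof.
by move=> h0 h1; apply/matrixP => i j; rewrite (ord1 j); case: (ord2E i) => ->.
Qed.

Lemma mx2P M N : M 0 0 = N 0 0 -> M 0 1 = N 0 1 -> M 1 0 = N 1 0 ->
  M 1 1 = N 1 1 -> M = N.
Proof.
move=> h00 h01 h10 h11; apply/matrixP => i j.
by case: (ord2E i) => ->; case: (ord2E j) => ->.
Qed.

Definition mx2 (a b c d : R) : 'M[R]_2 :=
  \matrix_(i < 2, j < 2)
     if i == 0 then (if j == 0 then a else b) else (if j == 0 then c else d).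

Definition cv2 (a b : R) : 'cV[R]_2 := \col_(i < 2) if i == 0 then a else b.

Lemma mx2E a b c d : ((mx2 a b c d 0 0 = a) * (mx2 a b c d 0 1 = b) *
  (mx2 a b c d 1 0 = c) * (mx2 a b c d 1 1 = d))%type.
Proof. by rewrite !mxE. Qed.

Lemma cv2E a b : ((cv2 a b 0 0 = a) * (cv2 a b 1 0 = b))%type.
Proof. by rewrite !mxE. Qed.

Lemma mulmx2 a b c d a' b' c' d' :
  mx2 a b c d *m mx2 a' b' c' d' =
  mx2 (a * a' + b * c') (a * b' + b * d') (c * a' + d * c') (c * b' + d * d').
Proof. by apply: mx2P; rewrite mul2E !mx2E. Qed.

Lemma det2E M : \det M = M 0 0 * M 1 1 - M 0 1 * M 1 0.
Proof.
rewrite (expand_det_row _ 0) sum2E /cofactor !det_mx11 !mxE /=.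
have -> : lift (0 : 'I_2) (0 : 'I_1) = 1 by apply: val_inj.
have -> : lift (1 : 'I_2) (0 : 'I_1) = 0 by apply: val_inj.
by rewrite addn0 expr0 mul1r add0n expr1 mulN1r mulrN.
Qed.

Lemma vnormE v : vnorm v = Num.sqrt (v 0 0 ^+ 2 + v 1 0 ^+ 2).
Proof.
by rewrite /vnorm big_ord_recl big_ord1; congr (Num.sqrt (_ + v _ _ ^+ 2)); apply: val_inj.
Qed.

Lemma vnorm_ge0 v : 0 <= vnorm v.
Proof. by rewrite vnormE sqrtr_ge0. Qed.

Lemma sqr_vnorm v : vnorm v ^+ 2 = v 0 0 ^+ 2 + v 1 0 ^+ 2.
Proof. by rewrite vnormE sqr_sqrtr // addr_ge0 // sqr_ge0. Qed.

Lemma vnorm_le v c : 0 <= c -> v 0 0 ^+ 2 + v 1 0 ^+ 2 <= c ^+ 2 -> vnorm v <= c.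
Proof. by move=> c0 h; rewrite -(@ler_pXn2r _ 2) ?nnegrE ?vnorm_ge0 // sqr_vnorm. Qed.

Lemma vnorm_ge v c : 0 <= c -> c ^+ 2 <= v 0 0 ^+ 2 + v 1 0 ^+ 2 -> c <= vnorm v.
Proof. by move=> c0 h; rewrite -(@ler_pXn2r _ 2) ?nnegrE ?vnorm_ge0 // sqr_vnorm. Qed.

Lemma vnormZ a v : vnorm (a *: v) = `|a| * vnorm v.
Proof.
by rewrite !vnormE !mxE !exprMn -mulrDr sqrtrM ?sqr_ge0 // sqrtr_sqr.
Qed.

Lemma vnorm_eq0 v : vnorm v = 0 -> v = 0.
Proof.
move=> h; have := sqr_vnorm v; rewrite h expr0n /= => /esym/eqP.
rewrite paddr_eq0 ?sqr_ge0 // !sqrf_eq0 => /andP[/eqP h0 /eqP h1].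
by apply: cV2P; rewrite mxE.
Qed.

Lemma vnorm0 : vnorm (0 : 'cV[R]_2) = 0.
Proof. by rewrite vnormE !mxE expr0n addr0 sqrtr0. Qed.

Lemma vnorm_gt0 v : v != 0 -> 0 < vnorm v.
Proof.
move=> v0; rewrite lt_neqAle vnorm_ge0 andbT eq_sym.
by apply: contra v0 => /eqP/vnorm_eq0 ->.
Qed.

Lemma dot_le v w : v 0 0 * w 0 0 + v 1 0 * w 1 0 <= vnorm v * vnorm w.
Proof.
apply: le_trans (ler_norm _) _.
rewrite -(@ler_pXn2r _ 2) ?nnegrE ?mulr_ge0 ?vnorm_ge0 ?normr_ge0 //.
rewrite exprMn !sqr_vnorm real_normK ?num_real //.
have := sqr_ge0 (v 0 0 * w 1 0 - v 1 0 * w 0 0); nra.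
Qed.

Lemma cross_le v w : `|v 0 0 * w 1 0 - v 1 0 * w 0 0| <= vnorm v * vnorm w.
Proof.
rewrite -(@ler_pXn2r _ 2) ?nnegrE ?mulr_ge0 ?vnorm_ge0 ?normr_ge0 //.
rewrite exprMn !sqr_vnorm real_normK ?num_real //.
have := sqr_ge0 (v 0 0 * w 0 0 + v 1 0 * w 1 0); nra.
Qed.

Lemma vnormD v w : vnorm (v + w) <= vnorm v + vnorm w.
Proof.
apply: vnorm_le; first by rewrite addr_ge0 ?vnorm_ge0.
rewrite !mxE; have := dot_le v w; have := sqr_vnorm v; have := sqr_vnorm w; nra.
Qed.

Definition mx1norm M := `|M 0 0| + `|M 0 1| + `|M 1 0| + `|M 1 1|.

Lemma vnorm_coord v : `|v 0 0| <= vnorm v /\ `|v 1 0| <= vnorm v.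
Proof.
by split; apply: vnorm_ge => //; rewrite ?real_normK ?num_real //;
   rewrite ?lerDl ?lerDr sqr_ge0.
Qed.

Lemma vnorm_le_coord v : vnorm v <= `|v 0 0| + `|v 1 0|.
Proof.
apply: vnorm_le; first by rewrite addr_ge0.
rewrite -(real_normK (num_real (v 0 0))) -(real_normK (num_real (v 1 0))).
have := mulr_ge0 (normr_ge0 (v 0 0)) (normr_ge0 (v 1 0)); nra.
Qed.

Lemma vnorm_mul_le M v : vnorm (M *m v) <= mx1norm M * vnorm v.
Proof.
apply: le_trans (vnorm_le_coord _) _; rewrite !mul2mxE.
have [h0 h1] := vnorm_coord v.
have hD a b c d : `|a * b + c * d : R| <= `|a| * `|b| + `|c| * `|d|.
  by rewrite -!normrM ler_normD.
have := hD (M 0 0) (v 0 0) (M 0 1) (v 1 0).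
have := hD (M 1 0) (v 0 0) (M 1 1) (v 1 0).
have := ler_wpM2l (normr_ge0 (M 0 0)) h0.
have := ler_wpM2l (normr_ge0 (M 1 0)) h0.
have := ler_wpM2l (normr_ge0 (M 0 1)) h1.
have := ler_wpM2l (normr_ge0 (M 1 1)) h1.
rewrite /mx1norm; lra.
Qed.

Let unit_image M := [set vnorm (M *m v) | v in [set v : 'cV[R]_2 | vnorm v = 1]].

Lemma vnorm_cv2_10 : vnorm (cv2 1 0) = 1.
Proof. by rewrite vnormE !cv2E expr1n expr0n addr0 sqrtr1. Qed.

Lemma vnorm_cv2_01 : vnorm (cv2 0 1) = 1.
Proof. by rewrite vnormE !cv2E expr1n expr0n add0r sqrtr1. Qed.

Lemma unit_image_nonempty M : unit_image M !=set0.
Proof. by exists (vnorm (M *m cv2 1 0)), (cv2 1 0) => //=; exact: vnorm_cv2_10. Qed.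

Lemma unit_image_ub M : has_ubound (unit_image M).
Proof.
exists (mx1norm M) => _ [v /= hv <-].
by have := vnorm_mul_le M v; rewrite hv mulr1.
Qed.

Lemma le_opnorm1 M v : vnorm v = 1 -> vnorm (M *m v) <= opnorm M.
Proof. by move=> hv; apply: ub_le_sup; [exact: unit_image_ub|exists v]. Qed.

Lemma opnorm_ge0 M : 0 <= opnorm M.
Proof. exact: le_trans (vnorm_ge0 _) (le_opnorm1 _ vnorm_cv2_10). Qed.

Lemma le_opnorm M v : vnorm (M *m v) <= opnorm M * vnorm v.
Proof.
have [->|v0] := eqVneq v 0; first by rewrite mulmx0 vnorm0 mulr0.
have nv := vnorm_gt0 v0.
have := @le_opnorm1 M ((vnorm v)^-1 *: v).
rewrite vnormZ ger0_norm ?invr_ge0 ?vnorm_ge0 // mulVf ?gt_eqF // => /(_ erefl).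
rewrite -scalemxAr vnormZ ger0_norm ?invr_ge0 ?vnorm_ge0 // mulrC.
by rewrite ler_pdivrMr.
Qed.

Lemma opnorm_le M c : (forall v, vnorm (M *m v) <= c * vnorm v) -> opnorm M <= c.
Proof.
move=> h; apply: ge_sup; first exact: unit_image_nonempty.
by move=> _ [v /= hv <-]; have := h v; rewrite hv mulr1.
Qed.

Lemma opnorm_le_mx1norm M : opnorm M <= mx1norm M.
Proof. exact: opnorm_le (vnorm_mul_le M). Qed.

Lemma opnormM M N : opnorm (M *m N) <= opnorm M * opnorm N.
Proof.
apply: opnorm_le => v; rewrite -mulmxA -mulrA.
apply: le_trans (le_opnorm _ _) _.
by rewrite ler_wpM2l ?opnorm_ge0 // le_opnorm.
Qed.

Lemma opnormD M N : opnorm (M + N) <= opnorm M + opnorm N.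
Proof.
apply: opnorm_le => v; rewrite mulmxDl mulrDl.
by apply: le_trans (vnormD _ _) _; rewrite lerD // le_opnorm.
Qed.

Lemma opnorm1 : opnorm (1%:M : 'M[R]_2) <= 1.
Proof. by apply: opnorm_le => v; rewrite mul1mx mul1r. Qed.

Lemma opnorm_ge00 M : `|M 0 0| <= opnorm M.
Proof.
apply: le_trans (le_opnorm1 M vnorm_cv2_10).
by have [+ _] := vnorm_coord (M *m cv2 1 0); rewrite mul2mxE !cv2E mulr1 mulr0 addr0.
Qed.

Lemma opnorm_ge1 M : \det M = 1 -> 1 <= opnorm M.
Proof.
move=> dM; have := cross_le (M *m cv2 1 0) (M *m cv2 0 1).
rewrite !mul2mxE !cv2E !mulr1 !mulr0 !addr0 !add0r.
have -> : M 0 0 * M 1 1 - M 1 0 * M 0 1 = \det M by rewrite det2E; ring.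
rewrite dM normr1 => h1.
have := le_opnorm1 M vnorm_cv2_10; have := le_opnorm1 M vnorm_cv2_01.
have := vnorm_ge0 (M *m cv2 1 0); have := vnorm_ge0 (M *m cv2 0 1).
have := opnorm_ge0 M; nra.
Qed.

Definition cross v w := v 0 0 * w 1 0 - v 1 0 * w 0 0.

(* Cramer's rule expresses any vector through v and w, so M cannot contract
   two transversal vectors at once. *)
Lemma opnorm_cross M v w :
  opnorm M * `|cross v w| <= vnorm w * vnorm (M *m v) + vnorm v * vnorm (M *m w).
Proof.
have [->|c0] := eqVneq (cross v w) 0.
  by rewrite normr0 mulr0 addr_ge0 // mulr_ge0 // vnorm_ge0.
rewrite -ler_pdivlMr ?normr_gt0 //; apply: opnorm_le => x.
rewrite mulrAC ler_pdivlMr ?normr_gt0 //.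
rewrite mulrC -vnormZ scalemxAr.
have -> : cross v w *: x = cross x w *: v + cross v x *: w.
  by apply: cV2P; rewrite !mxE /cross; ring.
rewrite mulmxDr -!scalemxAr.
apply: le_trans (vnormD _ _) _; rewrite !vnormZ.
have := ler_wpM2r (vnorm_ge0 (M *m v)) (cross_le x w).
have := ler_wpM2r (vnorm_ge0 (M *m w)) (cross_le v x).
rewrite /cross; lra.
Qed.

End Norms.

(** * Words and expectations *)

Definition scons (b : bool) (s : nat -> bool) : nat -> bool :=
  fun n => if n is n'.+1 then s n' else b.

Definition shiftn (i : nat) (s : nat -> bool) : nat -> bool := fun n => s (i + n)%N.

Definition put (k : nat) (w u : nat -> bool) : nat -> bool :=
  fun i => if (i < k)%N then w i else u (i - k)%N.

Definition dep (T : Type) (m : nat) (F : (nat -> bool) -> T) :=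
  forall s s', (forall i, (i < m)%N -> s i = s' i) -> F s = F s'.

Lemma shiftnD i j s : shiftn i (shiftn j s) = shiftn (j + i) s.
Proof. by apply/funext => n; rewrite /shiftn addnA. Qed.

Lemma scons_shiftn s : scons (s 0%N) (shiftn 1 s) = s.
Proof. by apply/funext => -[|n]. Qed.

Lemma put0 w u : put 0 w u = u.
Proof. by apply/funext => n; rewrite /put ltn0 subn0. Qed.

Lemma putS k b w u : put k.+1 (scons b w) u = scons b (put k w u).
Proof. by apply/funext => -[|n]. Qed.

Lemma shiftn_put k w u : shiftn k (put k w u) = u.
Proof. by apply/funext => n; rewrite /shiftn /put ltnNge leq_addr addKn. Qed.

Lemma put_put j k s w u : put j s (put k w u) = put (j + k) (put j s w) u.
Proof.
apply/funext => n; rewrite /put; case: (ltnP n j) => jn; case: (ltnP n (j + k)) => kn //.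
- lia.
- by rewrite ltn_subLR // kn.
- by rewrite ltn_subLR // ltnNge kn /= subnDA.
Qed.

Lemma shiftn_putD j k s u :
  shiftn k (put (j + k) s u) = put j (shiftn k s) u.
Proof.
apply/funext => n; rewrite /put /shiftn (addnC j) ltn_add2l; case: ifP => // _.
by rewrite subnDl.
Qed.

Lemma put_congr j s s' u : (forall t, (t < j)%N -> s t = s' t) -> put j s u = put j s' u.
Proof. by move=> h; apply/funext => t; rewrite /put; case: ltnP => // /h. Qed.

Lemma dep_shift (T : Type) m i (F : (nat -> bool) -> T) :
  dep m F -> dep (i + m) (fun s => F (shiftn i s)).
Proof. by move=> dF s s' h; apply: dF => j jm; apply: h; rewrite ltn_add2l. Qed.

Section Expectation.
Variables (R : realType) (p : R).
Hypotheses (p0 : 0 <= p) (p1 : p <= 1).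
Implicit Types F G : (nat -> bool) -> R.

(* Expectation over m independent letters; the word is completed by the filler true. *)
Fixpoint Ew (m : nat) (F : (nat -> bool) -> R) : R :=
  if m is m'.+1 then
    p * Ew m' (fun s => F (scons true s)) + (1 - p) * Ew m' (fun s => F (scons false s))
  else F (fun=> true).

Lemma eq_Ew m F G : F =1 G -> Ew m F = Ew m G.
Proof. by move=> /funext ->. Qed.

Lemma Ew_cst m c : Ew m (fun=> c) = c.
Proof. by elim: m => [//|m /= ->]; ring. Qed.

Lemma le_Ew m F G : (forall s, F s <= G s) -> Ew m F <= Ew m G.
Proof.
elim: m F G => [|m IH] F G h /=; first exact: h.
by apply: lerD; apply: ler_wpM2l; rewrite ?subr_ge0 //; apply: IH => s.
Qed.

Lemma EwD m F G : Ew m (fun s => F s + G s) = Ew m F + Ew m G.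
Proof. by elim: m F G => [//|m IH] F G /=; rewrite !IH; ring. Qed.

Lemma EwZ m c F : Ew m (fun s => c * F s) = c * Ew m F.
Proof. by elim: m F => [//|m IH] F /=; rewrite !IH; ring. Qed.

Lemma EwN m F : Ew m (fun s => - F s) = - Ew m F.
Proof. by elim: m F => [//|m IH] F /=; rewrite !IH; ring. Qed.

Lemma Ew_sum m (I : Type) (r : seq I) (P : pred I) (F : I -> (nat -> bool) -> R) :
  Ew m (fun s => \sum_(i <- r | P i) F i s) = \sum_(i <- r | P i) Ew m (F i).
Proof. by elim: m F => [//|m IH] F /=; rewrite !IH !mulr_sumr -big_split. Qed.

Lemma Ew_put k l F : Ew (k + l) F = Ew k (fun w => Ew l (fun u => F (put k w u))).
Proof.
elim: k F => [|k IH] F /=; first by apply: eq_Ew => u; rewrite put0.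
by rewrite !IH; congr (_ * _ + _ * _); apply: eq_Ew => w; apply: eq_Ew => u;
  rewrite putS.
Qed.

Lemma Ew_dep m m' F : dep m F -> (m <= m')%N -> Ew m' F = Ew m F.
Proof.
move=> dF mm'; rewrite -(subnKC mm') Ew_put; apply: eq_Ew => w.
rewrite -(Ew_cst (m' - m) (F w)); apply: eq_Ew => u; apply: dF => i im.
by rewrite /put im.
Qed.

Lemma Ew_shift m i F : Ew (i + m) (fun s => F (shiftn i s)) = Ew m F.
Proof.
rewrite Ew_put -[RHS](Ew_cst i); apply: eq_Ew => w; apply: eq_Ew => u.
by rewrite shiftn_put.
Qed.

Lemma Ew_prod m (f : nat -> bool -> R) :
  Ew m (fun s => \prod_(i < m) f i (s i)) =
  \prod_(i < m) (p * f i true + (1 - p) * f i false).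
Proof.
elim: m f => [|m IH] f /=; first by rewrite !big_ord0.
have step b : Ew m (fun s => \prod_(i < m.+1) f i (scons b s i)) =
    f 0%N b * \prod_(i < m) (p * f i.+1 true + (1 - p) * f i.+1 false).
  rewrite -(IH (fun i => f i.+1)) -EwZ; apply: eq_Ew => s.
  by rewrite big_ord_recl.
by rewrite !step [RHS]big_ord_recl /=; ring.
Qed.

End Expectation.

(* Cocycles depending on the letters -J .. J are read, through hat (- J), as functions of
   the first 2J + 1 letters of a one-sided word. *)
Definition hat (z : int) (x : Sigma) : nat -> bool := fun n => x (n%:Z + z).

Lemma hat_shift z n (x : Sigma) : hat z (iter n Defs.shift x) = shiftn n (hat z x).
Proof.
apply/funext => i; rewrite /hat /shiftn.
have -> (y : int) : (iter n Defs.shift x : int -> bool) y = x (y + n%:Z).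
  by elim: n y => [|n IH] y /=; [rewrite addr0|rewrite /Defs.shift IH; congr x; lia].
by congr x; lia.
Qed.

Section Integral.
Variables (R : realType) (p : R) (mu : probability Sigma R).
Hypothesis (hmu : is_bernoulli p mu).
Implicit Types F : (nat -> bool) -> R.

Lemma measurable_cylinder S w : measurable (cylinder S w : set Sigma).
Proof. by apply: sub_sigma_algebra; exists S, w. Qed.

Lemma measurable_letter z : measurable_fun [set: Sigma] (fun x : Sigma => x z).
Proof.
apply: (measurable_fun_bool true); rewrite setTI.
rewrite (_ : _ @^-1` _ = cylinder [:: z] (fun=> true)); first exact: measurable_cylinder.
apply/seteqP; split => x /=; first by move=> xz i; rewrite inE => /eqP ->.
by apply; rewrite inE.
Qed.

Lemma measurable_window m z F : dep m F ->
  measurable_fun [set: Sigma] (fun x => F (hat z x)).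
Proof.
elim: m z F => [|m IH] z F dF.
  rewrite (_ : (fun x => _) = cst (F (fun=> true))); first exact: measurable_cst.
  by apply/funext => x; apply: dF.
rewrite (_ : (fun x => _) = fun x : Sigma =>
  if x z then F (scons true (hat (z + 1) x)) else F (scons false (hat (z + 1) x))).
  have dF' b : dep m (fun s => F (scons b s)).
    by move=> s s' h; apply: dF => -[//|i] im; apply: h.
  apply: measurable_fun_ifT; first exact: measurable_letter.
  - exact: (IH (z + 1) (fun s => F (scons true s))).
  - exact: (IH (z + 1) (fun s => F (scons false s))).
apply/funext => x; rewrite -[X in F X = _]scons_shiftn.
have -> : shiftn 1 (hat z x) = hat (z + 1) x.
  by apply/funext => n; rewrite /shiftn /hat; congr x; lia.
by rewrite {1}/hat add0r; case: (x z).
Qed.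

Let prefix z j (w : nat -> bool) : set Sigma := [set x | forall i, (i < j)%N -> hat z x i = w i].

Lemma prefixE z j w : prefix z j w =
  cylinder [seq i%:Z + z | i <- iota 0 j] (fun t => w `|t - z|%N).
Proof.
apply/seteqP; split => x h.
  move=> i /mapP[k]; rewrite mem_iota add0n => /andP[_ kj] ->.
  by rewrite addrK absz_nat; apply: h.
move=> i ij; rewrite /hat h ?addrK ?absz_nat //.
by apply/mapP; exists i => //; rewrite mem_iota.
Qed.

Lemma mu_prefix z j w :
  mu (prefix z j w) = (\prod_(i < j) (if w i then p else 1 - p))%:E.
Proof.
rewrite prefixE hmu; last by rewrite map_inj_uniq ?iota_uniq // => i k; lia.
rewrite big_map; congr EFin; rewrite -[in RHS](big_mkord xpredT (fun i => if w i then p else 1 - p)) /index_iota subn0.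
by apply: eq_bigr => i _; rewrite addrK absz_nat.
Qed.

Lemma integral_prefix z j k w F : dep (j + k) F ->
  (\int[mu]_(x in prefix z j w) (F (hat z x))%:E =
   ((\prod_(i < j) (if w i then p else 1 - p)) * Ew p k (fun u => F (put j w u)))%:E)%E.
Proof.
elim: k j w => [|k IH] j w dF.
  rewrite addn0 in dF.
  rewrite (eq_integral (cst (F (put j w (fun=> true)))%:E)); last first.
    move=> x; rewrite inE => hx; congr EFin; apply: dF => i ij.
    by rewrite /put ij hx.
  rewrite integral_cst; last by rewrite prefixE; exact: measurable_cylinder.
  by apply: (etrans (congr1 (fun t => (_ * t)%E) (mu_prefix z j w))); rewrite -EFinM mulrC.
pose w' b := put j w (fun=> b).
have -> : prefix z j w = prefix z j.+1 (w' true) `|` prefix z j.+1 (w' false).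
  apply/seteqP; split => x.
    move=> h; case E : (hat z x j); [left|right] => i; rewrite ltnS leq_eqVlt => /orP[/eqP->|ij];
    by rewrite /w' /put ?ltnn ?E ?ij ?h.
  by case=> h i ij; rewrite h ?ltnS 1?ltnW // /w' /put ij.
have mp b : measurable (prefix z j.+1 (w' b)) by rewrite prefixE; exact: measurable_cylinder.
rewrite integral_setU //; last 2 first.
- apply: (measurable_funS (E := setT)) => //; apply/measurable_EFinP.
  exact: measurable_window dF.
- rewrite disj_set2E; apply/eqP/seteqP; split => // x [h1 h2].
  by have := h1 j (ltnSn j); rewrite (h2 j (ltnSn j)) /w' /put ltnn.
rewrite !IH ?addSnnS // -EFinD; congr EFin.
have prodE b : \prod_(i < j.+1) (if w' b i then p else 1 - p) =
    \prod_(i < j) (if w i then p else 1 - p) * (if b then p else 1 - p).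
  rewrite big_ord_recr /=; congr (_ * _); last by rewrite /w' /put ltnn.
  by apply: eq_bigr => i _; rewrite /w' /put ltn_ord.
have putE b u : put j.+1 (w' b) u = put j w (scons b u).
  apply/funext => i; rewrite /w' /put ltnS leq_eqVlt; case: ltnP => ij; first by rewrite orbT.
  rewrite orbF; case: eqP => [->|ne]; first by rewrite subnn.
  by have -> : (i - j = (i - j.+1).+1)%N by lia.
rewrite !prodE /= -!mulrA -mulrDr; congr (_ * (_ * _ + _ * _));
  by apply: eq_Ew => u; rewrite putE.
Qed.

Lemma integral_window z m F : dep m F ->
  (\int[mu]_x (F (hat z x))%:E = (Ew p m F)%:E)%E.
Proof.
move=> dF; have := @integral_prefix z 0 m (fun=> true) F dF.
rewrite big_ord0 mul1r.
have -> : prefix z 0 (fun=> true) = setT by apply/seteqP; split.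
by move=> ->; congr EFin; apply: eq_Ew => u; rewrite put0.
Qed.

End Integral.

(** * Cocycles over one-sided words *)

Fixpoint coc (R : realType) (L : (nat -> bool) -> 'M[R]_2) (n : nat) (s : nat -> bool) :
  'M[R]_2 := if n is n'.+1 then L (shiftn n' s) *m coc L n' s else 1%:M.

Lemma cocD (R : realType) (L : (nat -> bool) -> 'M[R]_2) n k s :
  coc L (n + k) s = coc L n (shiftn k s) *m coc L k s.
Proof.
elim: n => [|n IH] /=; first by rewrite mul1mx.
by rewrite IH mulmxA shiftnD (addnC k).
Qed.

Definition agree k (w s : nat -> bool) : bool := [forall t : 'I_k, s t == w t].

Lemma agreeP k w s : reflect (forall t, (t < k)%N -> s t = w t) (agree k w s).
Proof.
apply: (iffP forallP) => [h t tk|h t]; first by apply/eqP; exact: (h (Ordinal tk)).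
by apply/eqP; exact: h.
Qed.

Lemma sum_ge_but_one (R : realType) M (x : 'I_M -> R) g d : 0 <= d ->
  (forall i, g - d <= x i) -> (forall i j, i != j -> x i < g -> g <= x j) ->
  M%:R * g - d <= \sum_i x i.
Proof.
move=> d0 hd hb; case: (pickP (fun i => x i < g)) => [i0 hi0|hno].
  rewrite (bigD1 i0) //=.
  have M1 : M%:R * g = g + \sum_(i < M | i != i0) g.
    by rewrite -(@bigD1 _ _ _ _ i0 xpredT (fun=> g)) // sumr_const card_ord mulr_natl.
  rewrite M1 addrAC lerD //; apply: ler_sum => i ii0.
  by apply: (hb i0 i) => //; rewrite eq_sym.
have : \sum_(i < M) g <= \sum_i x i.
  by apply: ler_sum => i _; rewrite leNgt hno.
rewrite sumr_const card_ord mulr_natl => h; apply: le_trans h.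
by rewrite gerBl.
Qed.

Section Cocycle.
Variables (R : realType) (p : R).
Hypotheses (p0 : 0 <= p) (p1 : p <= 1).
Variables (W : nat) (L : (nat -> bool) -> 'M[R]_2) (Lam : R).
Hypotheses (depL : dep W.+1 L) (detL : forall s, \det (L s) = 1)
  (Lam1 : 1 <= Lam) (leL : forall s, opnorm (L s) <= Lam)
  (geL : forall s v, vnorm v <= Lam * vnorm (L s *m v)).
Implicit Types (v : 'cV[R]_2) (s w u : nat -> bool).

Notation coc := (coc L).
Notation Ew := (Ew p).

Lemma dep_coc n : dep (n + W) (coc n).
Proof.
elim: n => [//|n IH] s s' h /=; congr (_ *m _).
  by apply: depL => i iW; rewrite /shiftn; apply: h; lia.
by apply: IH => i iW; apply: h; lia.
Qed.

Lemma det_coc n s : \det (coc n s) = 1.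
Proof. by elim: n => [|n IH] /=; rewrite ?det1 // det_mulmx IH detL mulr1. Qed.

Lemma Lam_gt0 : 0 < Lam. Proof. exact: lt_le_trans Lam1. Qed.

Lemma lnLam_ge0 : 0 <= ln Lam. Proof. exact: ln_ge0. Qed.

Lemma opnorm_coc n s : opnorm (coc n s) <= Lam ^+ n.
Proof.
elim: n => [|n IH] /=; first by rewrite expr0 opnorm1.
by rewrite exprS; apply: le_trans (opnormM _ _) _; rewrite ler_pM ?opnorm_ge0.
Qed.

Lemma vnorm_coc n s v : vnorm v <= Lam ^+ n * vnorm (coc n s *m v).
Proof.
elim: n => [|n IH] /=; first by rewrite expr0 mul1r mul1mx.
apply: le_trans IH _; rewrite exprSr -mulrA ler_wpM2l ?exprn_ge0 ?(ltW Lam_gt0) //.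
by rewrite -mulmxA; exact: geL.
Qed.

Lemma coc_neq0 n s v : v != 0 -> coc n s *m v != 0.
Proof.
move=> v0; apply: contraTneq (vnorm_gt0 v0) => h.
by have := vnorm_coc n s v; rewrite h vnorm0 mulr0 -leNgt.
Qed.

Lemma ln_vnorm_ge n s v : v != 0 -> ln (vnorm v) - n%:R * ln Lam <= ln (vnorm (coc n s *m v)).
Proof.
move=> v0; have h := vnorm_coc n s v.
rewrite lerBlDl mulr_natl -lnXn ?Lam_gt0 //.
rewrite -lnM ?posrE ?exprn_gt0 ?Lam_gt0 ?vnorm_gt0 ?coc_neq0 //.
by rewrite ler_ln ?posrE ?mulr_gt0 ?exprn_gt0 ?Lam_gt0 ?vnorm_gt0 ?coc_neq0.
Qed.

Definition lnop n s := ln (opnorm (coc n s)).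

Lemma opnorm_coc_ge1 n s : 1 <= opnorm (coc n s).
Proof. exact/opnorm_ge1/det_coc. Qed.

Lemma opnorm_coc_gt0 n s : 0 < opnorm (coc n s).
Proof. exact: lt_le_trans (opnorm_coc_ge1 n s). Qed.

Lemma lnop_ge0 n s : 0 <= lnop n s.
Proof. exact/ln_ge0/opnorm_coc_ge1. Qed.

Lemma lnop_le n s : lnop n s <= n%:R * ln Lam.
Proof.
rewrite mulr_natl -lnXn ?Lam_gt0 // ler_ln ?posrE ?opnorm_coc_gt0 ?exprn_gt0 ?Lam_gt0 //.
exact: opnorm_coc.
Qed.

Lemma lnopD n k s : lnop (n + k) s <= lnop n (shiftn k s) + lnop k s.
Proof.
rewrite /lnop -lnM ?posrE ?opnorm_coc_gt0 // ler_ln ?posrE ?mulr_gt0 ?opnorm_coc_gt0 //.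
by rewrite cocD opnormM.
Qed.

Lemma ln_vnorm_le_lnop n s v : v != 0 ->
  ln (vnorm (coc n s *m v)) <= lnop n s + ln (vnorm v).
Proof.
move=> v0; rewrite -lnM ?posrE ?opnorm_coc_gt0 ?vnorm_gt0 //.
by rewrite ler_ln ?posrE ?mulr_gt0 ?opnorm_coc_gt0 ?vnorm_gt0 ?coc_neq0 // le_opnorm.
Qed.

Definition avg n := Ew (n + W) (lnop n).

Definition lam := inf [set (n.+1%:R)^-1 * avg n.+1 | n in [set: nat]].

Lemma dep_lnop n : dep (n + W) (lnop n).
Proof. by move=> s s' h; rewrite /lnop (dep_coc h). Qed.

Lemma avg_ge0 n : 0 <= avg n.
Proof. by rewrite -(Ew_cst p (n + W) 0); apply: le_Ew => // s; exact: lnop_ge0. Qed.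

Lemma avg_le n : avg n <= n%:R * ln Lam.
Proof. by rewrite -(Ew_cst p (n + W) (_ * _)); apply: le_Ew => // s; exact: lnop_le. Qed.

Lemma avgD n k : avg (n + k) <= avg n + avg k.
Proof.
have -> : avg k = Ew (k + (n + W)) (lnop k).
  by rewrite (Ew_dep p (@dep_lnop k)) // leq_add2l leq_addl.
have -> : avg n = Ew (k + (n + W)) (fun s => lnop n (shiftn k s)) by rewrite Ew_shift.
rewrite -EwD /avg addnA (addnC k); apply: le_Ew => // s; exact: lnopD.
Qed.

Lemma avg_muln l n : avg (l * n) <= l%:R * avg n.
Proof.
elim: l => [|l IH].
  by rewrite mul0n mul0r; apply: le_trans (avg_le 0) _; rewrite mul0r.
by rewrite mulSn -natr1 mulrDl mul1r addrC; apply: le_trans (avgD _ _) _; rewrite lerD2l.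
Qed.

Let avgs_lb : has_lbound [set (n.+1%:R)^-1 * avg n.+1 | n in [set: nat]].
Proof. by exists 0 => _ [n _ <-]; rewrite mulr_ge0 ?invr_ge0 ?avg_ge0. Qed.

Lemma lam_avg n : n%:R * lam <= avg n.
Proof.
case: n => [|n]; first by rewrite mul0r avg_ge0.
rewrite mulrC -ler_pdivlMr // mulrC; apply: ge_inf => //; by exists n.
Qed.

Lemma lam_ge0 : 0 <= lam.
Proof.
apply: lb_le_inf; first by exists (1^-1 * avg 1), 0%N.
by move=> _ [n _ <-]; rewrite mulr_ge0 ?invr_ge0 ?avg_ge0.
Qed.

Lemma lam_le_lnLam : lam <= ln Lam.
Proof. by have := lam_avg 1; have := avg_le 1; rewrite !mul1r => h1 h2; apply: le_trans h1. Qed.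

Lemma lam_ltP c : lam < c -> exists n, avg n.+1 < n.+1%:R * c.
Proof.
move=> h; have [|x [n _ <-] hx] := inf_lt _ h; first by exists (1^-1 * avg 1), 0%N.
by exists n; rewrite -ltr_pdivrMl.
Qed.

Lemma lam_geP c : (forall n, n.+1%:R * c <= avg n.+1) -> c <= lam.
Proof.
move=> h; apply: lb_le_inf; first by exists (1^-1 * avg 1), 0%N.
by move=> _ [n _ <-]; rewrite ler_pdivlMl.
Qed.

(* The past W letters s are fixed and the future is averaged. *)
Definition growth n s v := Ew n (fun u => ln (vnorm (coc n (put W s u) *m v))).

Lemma growthD m k s v : growth (m + k) s v =
  Ew m (fun w => growth k (shiftn m (put W s w)) (coc m (put W s w) *m v)).
Proof.
rewrite /growth Ew_put; apply: eq_Ew => w; apply: eq_Ew => u.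
have E : coc m (put (W + m) (put W s w) u) = coc m (put W s w).
  by apply: dep_coc => i im; rewrite [LHS]/put (addnC W) im.
by rewrite put_put (addnC m k) cocD -mulmxA shiftn_putD E.
Qed.

Lemma growth_ge n s v : v != 0 -> ln (vnorm v) - n%:R * ln Lam <= growth n s v.
Proof.
by move=> v0; rewrite -(Ew_cst p n (_ - _)); apply: le_Ew => // u; exact: ln_vnorm_ge.
Qed.

Lemma growth_muln m c : (forall s v, v != 0 -> c + ln (vnorm v) <= growth m s v) ->
  forall j s v, v != 0 -> j%:R * c + ln (vnorm v) <= growth (j * m) s v.
Proof.
move=> h; elim=> [|j IH] s v v0.
  by rewrite mul0n mul0r add0r /growth /= mul1mx.
rewrite mulSn growthD -natr1 mulrDl mul1r -addrA.
apply: le_trans (_ : j%:R * c + growth m s v <= _); first by rewrite lerD2l h.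
rewrite -(Ew_cst p m (j%:R * c)) -EwD; apply: le_Ew => // w.
by apply: IH; exact: coc_neq0.
Qed.

Lemma lam_growth m c : (0 < m)%N ->
  (forall s v, v != 0 -> m%:R * c + ln (vnorm v) <= growth m s v) -> c <= lam.
Proof.
move=> m0 h; apply: lam_geP => n; have mR : 0 < m%:R :> R by rewrite ltr0n.
rewrite -(ler_pM2l mR); apply: le_trans (avg_muln _ _).
have -> : avg (m * n.+1) = Ew W (fun w => Ew (m * n.+1) (fun u => lnop (m * n.+1) (put W w u))).
  by rewrite -Ew_put addnC.
rewrite -(Ew_cst p W (_ * _)); apply: le_Ew => // w.
have v0 : cv2 1 0 != 0 :> 'cV[R]_2.
  by apply/eqP => /(congr1 (@vnorm R))/eqP; rewrite vnorm_cv2_10 vnorm0 oner_eq0.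
apply: le_trans (_ : growth (m * n.+1) w (cv2 1 0) <= _).
  have := growth_muln h n.+1 w v0; rewrite vnorm_cv2_10 ln1 addr0 mulnC.
  by rewrite mulrCA.
apply: le_Ew => // u; apply: le_trans (ln_vnorm_le_lnop _ _ v0) _.
by rewrite vnorm_cv2_10 ln1 addr0.
Qed.

(* Whatever the past s, M equally likely words of total probability at least P0, all of
   them ending with W ones, send v to pairwise transversal vectors. *)
Definition spread (M : nat) := exists k (c2 P0 : R),
  [/\ 0 < c2, c2 <= 1, 0 < P0 &
   forall s v, v != 0 -> exists (w : 'I_M -> nat -> bool) (pi : R),
   [/\ P0 <= M%:R * pi,
       forall i, Ew k (fun u => (agree k (w i) u)%:R) = pi,
       forall i j, i != j -> ~ agree k (w i) (w j),
       forall i t, (t < W)%N -> shiftn k (put W s (w i)) t = true &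
       forall i j, i != j -> c2 * vnorm v ^+ 2 <=
         `|cross (coc k (put W s (w i)) *m v) (coc k (put W s (w j)) *m v)| ]].

Lemma lnop_put N s : (W <= N)%N ->
  (N%:R - W%:R) * lam - W%:R * ln Lam <= Ew N (fun u => lnop N (put W s u)).
Proof.
move=> WN; rewrite -natrB //; have := lam_avg (N - W).
rewrite /avg subnK // => h; apply: le_trans (lerB h (lexx _)) _.
rewrite -(Ew_cst p N (W%:R * _)) -EwN -EwD; apply: le_Ew => // u.
rewrite lerBlDr -[X in lnop X (put _ _ _)](subnK WN) /lnop.
set X := coc _ u; set Y := coc W (put W s u).
have XYE : coc (N - W + W) (put W s u) = X *m Y by rewrite cocD shiftn_put.
have XY : 0 < opnorm (X *m Y) by rewrite -XYE opnorm_coc_gt0.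
have Y0 : opnorm X <= opnorm (X *m Y) * Lam ^+ W.
  apply: opnorm_le => v.
  have hv : v = Y *m (invmx Y *m v).
    by rewrite mulmxA mulmxV ?mul1mx // unitmxE det_coc unitr1.
  rewrite {1}hv mulmxA; apply: le_trans (le_opnorm _ _) _.
  by rewrite -mulrA ler_wpM2l ?opnorm_ge0 //; rewrite {2}hv; exact: vnorm_coc.
rewrite XYE mulr_natl -lnXn ?Lam_gt0 // -lnM ?posrE ?exprn_gt0 ?Lam_gt0 //.
by rewrite ler_ln ?posrE ?mulr_gt0 ?exprn_gt0 ?Lam_gt0 ?opnorm_coc_gt0.
Qed.

Lemma Ew_words M k (w : 'I_M -> nat -> bool) pi H : dep k H ->
  (forall u, 0 <= H u) ->
  (forall i, Ew k (fun u => (agree k (w i) u)%:R) = pi) ->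
  (forall i j, i != j -> ~ agree k (w i) (w j)) ->
  pi * \sum_i H (w i) <= Ew k H.
Proof.
move=> dH H0 hpi hne.
have -> : pi * \sum_i H (w i) = Ew k (fun u => \sum_i H (w i) * (agree k (w i) u)%:R).
  rewrite Ew_sum mulr_sumr; apply: eq_bigr => i _.
  by rewrite EwZ hpi mulrC.
apply: le_Ew => // u; case: (pickP (fun i => agree k (w i) u)) => [i0 hi0|hno].
  rewrite (bigD1 i0) //= big1 ?addr0 ?hi0 ?mulr1.
    by rewrite (dH u (w i0)) //; exact/agreeP.
  move=> i ii0; case: (boolP (agree k (w i) u)) => hi; last by rewrite mulr0.
  case: (hne _ _ ii0); apply/agreeP => t tk.
  by move/agreeP: hi => <- //; move/agreeP: hi0 => <-.
by rewrite big1 // => i _; rewrite hno mulr0.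
Qed.

(* Given the future product X, at most one of the M equally likely images of v
   is contracted by X, so a vector loses at most a fraction 1/M of the growth. *)
Lemma growth_spread M : (0 < M)%N -> spread M -> exists K, forall n s v, v != 0 ->
  n%:R * (lam - 2 * ln Lam / M%:R) - K + ln (vnorm v) <= growth n s v.
Proof.
move=> M0 [k [c2 [P0 [c20 c21 P00 hsp]]]].
have MR : 0 < M%:R :> R by rewrite ltr0n.
set c0 := ln Lam; have c00 : 0 <= c0 := lnLam_ge0.
set lam' := lam - 2 * c0 / M%:R.
have e0 : 0 <= 2 * c0 / M%:R by rewrite divr_ge0 ?mulr_ge0 // ltW.
have e1 : 2 * c0 / M%:R <= 2 * c0.
  by rewrite ler_pdivrMr // ler_peMr ?mulr_ge0 // ler1n.
have l0 := lam_ge0; have l1 : lam <= c0 := lam_le_lnLam.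
set c4 := c2 / (2 * Lam ^+ k).
have Lk : 1 <= Lam ^+ k by rewrite exprn_ege1.
have c40 : 0 < c4 by rewrite divr_gt0 // mulr_gt0 // exprn_gt0 // Lam_gt0.
have c41 : c4 <= 1 by rewrite ler_pdivrMr ?mul1r; nra.
have lc4 : ln c4 <= 0 by rewrite ln_le0.
set C3 := lam * (k + W)%:R + W%:R * c0 - ln c4.
have C30 : 0 <= C3 by rewrite /C3; have := mulr_ge0 l0 (ler0n R (k + W));
  have := mulr_ge0 (ler0n R W) c00; lra.
pose D := 2 * c0 * k%:R / P0 + 2 * c0 * k%:R.
have kR := ler0n R k.
have D0 : 0 <= 2 * c0 * k%:R by rewrite !mulr_ge0.
have D1 : 0 <= 2 * c0 * k%:R / P0 by rewrite divr_ge0 // ltW.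
pose K := D + C3 + 2 * c0 * (k + W)%:R.
have D2 : 0 <= 2 * c0 * (k + W)%:R by rewrite !mulr_ge0 ?ler0n.
exists K; elim/ltn_ind => n IH s v v0.
have vp := vnorm_gt0 v0.
case: (ltnP n (k + W)) => [nk|nk].
  apply: le_trans (growth_ge _ _ v0); rewrite addrC lerD2l -/c0 lerBlDr.
  have nR : (n%:R : R) <= (k + W)%:R by rewrite ler_nat ltnW.
  have n0 := ler0n R n.
  have : n%:R * lam' <= n%:R * c0 by rewrite ler_wpM2l // /lam'; lra.
  have : n%:R * (2 * c0) <= 2 * c0 * (k + W)%:R by rewrite mulrC ler_wpM2l ?mulr_ge0.
  rewrite /K /D; lra.
have kn : (k <= n)%N by apply: leq_trans nk; exact: leq_addr.
have [k0|k0] := posnP k.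
  (* k = 0 contradicts the separation of two words unless M = 1, in which case
     the bound is implied by the trivial one *)
  have [w [pi [hP hpi hne _ hc]]] := hsp s v v0.
  have M1 : M = 1%N.
    case: M M0 {hsp MR lam' e0 e1 hP hpi hc IH} w hne => [//|[//|M]] _ w hne.
    case: (hne 0 (inord 1)); first by rewrite -val_eqE /= inordK.
    by apply/agreeP => t; rewrite k0.
  apply: le_trans (growth_ge _ _ v0); rewrite addrC lerD2l -/c0.
  rewrite /lam' M1 divr1; have := ler0n R n.
  have : 0 <= K by rewrite /K /D; lra.
  nra.
rewrite -(subnKC kn) growthD subnKC //.
set m := (n - k)%N; have mn : (m < n)%N by rewrite ltn_subrL k0 (leq_trans k0 kn).
pose H w := growth m (shiftn k (put W s w)) (coc k (put W s w) *m v).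
set m0 := m%:R * lam' - K - k%:R * c0 + ln (vnorm v).
have hm0 w : m0 <= H w.
  apply: le_trans (IH m mn _ _ (coc_neq0 _ _ v0)).
  have := ln_vnorm_ge k (put W s w) v0; rewrite /m0 -/c0 -/lam'; lra.
have dH : dep k H.
  move=> w w' h; rewrite /H.
  have hp t : (t < k + W)%N -> put W s w t = put W s w' t.
    by move=> tk; rewrite /put; case: ltnP => // Wt; apply: h; rewrite ltn_subLR // addnC.
  have E : coc k (put W s w) = coc k (put W s w') by exact: (dep_coc hp).
  rewrite E /growth; apply: eq_Ew => u; rewrite (@put_congr W _ (shiftn k (put W s w'))) //.
  by move=> t tW; rewrite /shiftn hp // ltn_add2l.
have [w [pi [hP hpi hne hone hc]]] := hsp s v v0.
have dH' : dep k (fun u => H u - m0) by move=> x y h; rewrite (dH _ _ h).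
have H0 u : 0 <= H u - m0 by rewrite subr_ge0.
have := Ew_words dH' H0 hpi hne.
rewrite EwD Ew_cst sumrB sumr_const card_ord -mulr_natl => hE.
pose ones : nat -> bool := fun=> true.
pose b i := coc k (put W s (w i)) *m v.
have HE i : H (w i) = Ew m (fun u => ln (vnorm (coc m (put W ones u) *m b i))).
  rewrite /H /growth; apply: eq_Ew => u.
  by rewrite (@put_congr W _ ones) // => t tW; exact: hone.
have hsum : M%:R * ((m%:R - W%:R) * lam - W%:R * c0 + ln c4 + ln (vnorm v)) - 2 * n%:R * c0
    <= \sum_i H (w i).
  rewrite (eq_bigr _ (fun i _ => HE i)) -Ew_sum.
  have Wm : (W <= m)%N by rewrite leq_subRL.
  have hl := lnop_put ones Wm.
  apply: le_trans (_ : M%:R * (Ew m (fun u => lnop m (put W ones u)) + (ln c4 + ln (vnorm v)))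
     - 2 * n%:R * c0 <= _).
    by rewrite lerD2r ler_pM2l // -addrA lerD2r.
  rewrite -(Ew_cst p m (ln c4 + ln (vnorm v))) -EwD -EwZ -(Ew_cst p m (2 * _ * _)) -EwN -EwD.
  apply: le_Ew => // u; set X := coc m _.
  have X0 : 0 < opnorm X by exact: opnorm_coc_gt0.
  apply: sum_ge_but_one.
  - by rewrite !mulr_ge0.
  - move=> i; have h1 := ln_vnorm_ge m (put W ones u) (coc_neq0 k (put W s (w i)) v0).
    have h2 := ln_vnorm_ge k (put W s (w i)) v0.
    have h3 := lnop_le m (put W ones u).
    have nE : n%:R = k%:R + m%:R :> R by rewrite -natrD /m subnKC.
    have h4 : 0 <= k%:R * c0 by rewrite mulr_ge0.
    rewrite -/(b i) -/X -/c0 in h1 h2 h3 *; rewrite nE; lra.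
  - move=> i j ij hi; rewrite leNgt; apply/negP => hj.
    have key t : ln (vnorm (X *m b t)) < lnop m (put W ones u) + (ln c4 + ln (vnorm v)) ->
        vnorm (X *m b t) < c4 * (opnorm X * vnorm v).
      rewrite /lnop -/X => ht; have Xb : 0 < vnorm (X *m b t).
        by rewrite vnorm_gt0 // !coc_neq0.
      have Xv : 0 < opnorm X * vnorm v by rewrite mulr_gt0.
      have lnE : ln (c4 * (opnorm X * vnorm v)) = ln c4 + (ln (opnorm X) + ln (vnorm v)).
        by rewrite lnM ?posrE // lnM ?posrE.
      rewrite ltNge; apply/negP => hge.
      have : ln (c4 * (opnorm X * vnorm v)) <= ln (vnorm (X *m b t)).
        by rewrite ler_ln // posrE // mulr_gt0.
      by rewrite leNgt lnE addrCA ht.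
    have := key _ hi; have := key _ hj.
    have := opnorm_cross X (b i) (b j); have := hc _ _ ij; rewrite -/(b i) -/(b j).
    have bt t : vnorm (b t) <= Lam ^+ k * vnorm v.
      apply: le_trans (le_opnorm _ _) _; rewrite ler_wpM2r ?vnorm_ge0 //.
      exact: opnorm_coc.
    have := bt i; have := bt j.
    move: (vnorm_ge0 (b i)) (vnorm_ge0 (b j)) (vnorm_ge0 (X *m b i)) (vnorm_ge0 (X *m b j)).
    have c4E : c4 * (2 * Lam ^+ k) = c2.
      by rewrite /c4 mulfVK // gt_eqF // mulr_gt0 // exprn_gt0 // Lam_gt0.
    move: (vnorm (X *m b i)) (vnorm (X *m b j)) (vnorm (b i)) (vnorm (b j)).
    move=> xi xj bi bj bi0 bj0 xi0 xj0 hbj hbi hcr hop hxj hxi.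
    set q := opnorm X * vnorm v in hxi hxj.
    have h1 : opnorm X * (c2 * vnorm v ^+ 2) <= bj * xi + bi * xj.
      by apply: le_trans hop; rewrite ler_wpM2l // ltW.
    have L0 : 0 < Lam ^+ k * vnorm v by rewrite mulr_gt0 // (lt_le_trans _ Lk).
    have h2 : bj * xi <= Lam ^+ k * vnorm v * xi by rewrite ler_wpM2r.
    have h3 : bi * xj <= Lam ^+ k * vnorm v * xj by rewrite ler_wpM2r.
    have h4 : Lam ^+ k * vnorm v * xi < Lam ^+ k * vnorm v * (c4 * q) by rewrite ltr_pM2l.
    have h5 : Lam ^+ k * vnorm v * xj < Lam ^+ k * vnorm v * (c4 * q) by rewrite ltr_pM2l.
    have h6 : opnorm X * (c2 * vnorm v ^+ 2) = 2 * (Lam ^+ k * vnorm v * (c4 * q)).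
      by rewrite -c4E /q; ring.
    lra.
have nE : m%:R = n%:R - k%:R :> R by rewrite /m natrB.
set A := n%:R * lam' - C3 + ln (vnorm v).
have hsum' : M%:R * A <= \sum_i H (w i).
  apply: le_trans hsum; rewrite /A /lam' /C3 nE natrD.
  have -> : 2 * n%:R * c0 = M%:R * (n%:R * (2 * c0 / M%:R)).
    by field; rewrite gt_eqF.
  lra.
have pi0 : 0 < pi by rewrite -(pmulr_rgt0 _ MR); exact: lt_le_trans hP.
have hE' : M%:R * pi * (A - m0) <= Ew k H - m0.
  apply: le_trans hE; rewrite -mulrA mulrCA ler_pM2l //; lra.
rewrite -[X in _ <= X]/(Ew k H).
have AE : A - m0 = k%:R * (lam' + c0) + (K - C3) by rewrite /A /m0 nE; ring.
have d1 : k%:R * (lam' + c0) <= 2 * c0 * k%:R.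
  by rewrite mulrC ler_wpM2r // /lam'; lra.
have d2 : - (2 * c0 * k%:R) <= k%:R * (lam' + c0).
  by rewrite -mulNr mulrC ler_wpM2l // /lam'; lra.
have goal' : k%:R * (lam' + c0) <= M%:R * pi * (A - m0).
  have Am0 : 2 * c0 * k%:R / P0 <= A - m0 by rewrite AE /K /D; lra.
  apply: le_trans d1 _; apply: le_trans (_ : P0 * (A - m0) <= _).
    by rewrite -ler_pdivrMl // mulrC.
  by rewrite ler_wpM2r //; exact: le_trans Am0.
rewrite /m0 nE in goal' hE'; rewrite -/lam'; lra.
Qed.

End Cocycle.

(** * Continuity of the exponent along a family *)

Section Family.
Variables (R : realType) (p : R).
Hypotheses (p0 : 0 <= p) (p1 : p <= 1).
Variables (W : nat) (L : R -> (nat -> bool) -> 'M[R]_2) (Lam C : R).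
Let I01 := fun x : R => 0 <= x <= 1.
Hypotheses (depL : forall x, dep W.+1 (L x)) (detL : forall x s, \det (L x s) = 1)
  (Lam1 : 1 <= Lam) (leL : forall x s, I01 x -> opnorm (L x s) <= Lam)
  (geL : forall x s v, I01 x -> vnorm v <= Lam * vnorm (L x s *m v))
  (C0 : 0 <= C)
  (lipL : forall x y s, I01 x -> I01 y -> opnorm (L x s - L y s) <= C * `|x - y|)
  (spreadL : forall x M, I01 x -> (0 < M)%N -> spread p W (L x) M).
Implicit Types (v : 'cV[R]_2) (s : nat -> bool).

Lemma coc_lip n x y s : I01 x -> I01 y ->
  opnorm (coc (L x) n s - coc (L y) n s) <= n%:R * C * Lam ^+ n * `|x - y|.
Proof.
move=> hx hy; have L0 : 0 <= Lam by exact: le_trans Lam1.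
elim: n => [|n IH] /=.
  rewrite subrr !mul0r; apply: opnorm_le => v.
  by rewrite mul0mx vnorm0 mul0r.
set X := coc (L x) n s in IH *; set Y := coc (L y) n s in IH *.
set A := L x _; set B := L y _.
have -> : A *m X - B *m Y = (A - B) *m X + B *m (X - Y).
  by rewrite mulmxBl mulmxBr addrA subrK.
apply: le_trans (opnormD _ _) _.
have h1 : opnorm ((A - B) *m X) <= C * `|x - y| * Lam ^+ n.
  apply: le_trans (opnormM _ _) _; apply: ler_pM; rewrite ?opnorm_ge0 ?lipL //.
  by apply: opnorm_coc => // t; exact: leL.
have h2 : opnorm (B *m (X - Y)) <= Lam * (n%:R * C * Lam ^+ n * `|x - y|).
  by apply: le_trans (opnormM _ _) _; apply: ler_pM; rewrite ?opnorm_ge0 ?leL.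
apply: le_trans (lerD h1 h2) _.
have h3 : C * `|x - y| * Lam ^+ n <= C * `|x - y| * Lam ^+ n.+1.
  rewrite ler_wpM2l ?mulr_ge0 // exprS ler_peMl // exprn_ge0 //.
apply: le_trans (lerD h3 (lexx _)) _.
by rewrite exprS -natr1 le_eqVlt; apply/orP; left; apply/eqP; ring.
Qed.

Let D n := n%:R * C * Lam ^+ n * Lam ^+ n.

Lemma ln_add_le (a b e : R) : 0 < a -> 0 < b -> 0 <= e -> b <= a * (1 + e) ->
  ln b <= ln a + e.
Proof.
move=> a0 b0 e0 h; have e1 : 0 < 1 + e by rewrite ltr_pwDl.
apply: le_trans (_ : ln (a * (1 + e)) <= _).
  by rewrite ler_ln ?posrE // mulr_gt0.
by rewrite lnM ?posrE // lerD2l; apply: le_ln1Dx; apply: lt_le_trans e0; rewrite ltrN10.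
Qed.

Lemma D_ge0 n : 0 <= D n.
Proof. by rewrite /D !mulr_ge0 // exprn_ge0 //; exact: le_trans Lam1. Qed.

Lemma ln_vnorm_lip n x y s v : I01 x -> I01 y -> v != 0 ->
  ln (vnorm (coc (L y) n s *m v)) <= ln (vnorm (coc (L x) n s *m v)) + D n * `|x - y|.
Proof.
move=> hx hy v0; have Lp : 0 < Lam by exact: lt_le_trans Lam1.
have gx t w : vnorm w <= Lam * vnorm (L x t *m w) by exact: geL.
have gy t w : vnorm w <= Lam * vnorm (L y t *m w) by exact: geL.
have nx := vnorm_gt0 (coc_neq0 Lam1 gx n s v0).
have ny := vnorm_gt0 (coc_neq0 Lam1 gy n s v0).
apply: ln_add_le => //; first by rewrite mulr_ge0 ?D_ge0.
set X := coc (L x) n s in nx *; set Y := coc (L y) n s in ny *.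
have -> : Y *m v = X *m v + (Y - X) *m v by rewrite mulmxBl addrC subrK.
apply: le_trans (vnormD _ _) _; rewrite mulrDr mulr1 lerD2l.
apply: le_trans (le_opnorm _ _) _.
have h1 := vnorm_coc Lam1 gx n s v; rewrite -/X in h1.
have h2 := coc_lip n s hy hx; rewrite -/X -/Y in h2.
apply: le_trans (ler_pM (opnorm_ge0 _) (vnorm_ge0 _) h2 h1) _.
by rewrite /D distrC le_eqVlt; apply/orP; left; apply/eqP; ring.
Qed.

Lemma lnop_lip n x y s : I01 x -> I01 y ->
  lnop (L y) n s <= lnop (L x) n s + D n * `|x - y|.
Proof.
move=> hx hy; have Lp : 0 < Lam by exact: lt_le_trans Lam1.
have o z : 0 < opnorm (coc (L z) n s) by exact: opnorm_coc_gt0.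
apply: ln_add_le => //; first by rewrite mulr_ge0 ?D_ge0.
set X := coc (L x) n s; set Y := coc (L y) n s.
have YE : Y = X + (Y - X) by rewrite addrC subrK.
rewrite [in leLHS]YE.
apply: le_trans (opnormD _ _) _; rewrite mulrDr mulr1 lerD2l.
have h2 := coc_lip n s hy hx; rewrite -/X -/Y in h2; apply: le_trans h2 _.
rewrite distrC; set d := `|x - y|.
have X1 : 1 <= opnorm X by apply: opnorm_ge1; exact: det_coc.
have Ln : 1 <= Lam ^+ n by rewrite exprn_ege1.
have Ln0 : 0 <= Lam ^+ n by exact: le_trans Ln.
have e0 : 0 <= n%:R * C * Lam ^+ n * d.
  by apply: mulr_ge0; rewrite ?normr_ge0 // mulr_ge0 // mulr_ge0 // ler0n.
apply: le_trans (_ : D n * d <= _).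
  by rewrite /D [leRHS]mulrAC ler_peMr.
by rewrite ler_peMl // mulr_ge0 ?D_ge0 // normr_ge0.
Qed.

Let lamL x := lam p W (L x).

Lemma lam_usc x kappa : I01 x -> lamL x < kappa ->
  exists2 r, 0 < r & forall y, I01 y -> `|x - y| < r -> lamL y < kappa.
Proof.
move=> hx /lam_ltP [n hn].
set g := n.+1%:R * kappa - avg p W (L x) n.+1.
have g0 : 0 < g by rewrite subr_gt0.
have D1 : 0 < D n.+1 + 1 by rewrite ltr_wpDl ?D_ge0.
exists (g / (D n.+1 + 1)) => [|y hy hr]; first by rewrite divr_gt0.
have hd : D n.+1 * `|x - y| < g.
  move: hr; rewrite ltr_pdivlMr // mulrDr mulr1 mulrC => hr.
  by apply: le_lt_trans hr; rewrite lerDl.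
have ha : avg p W (L y) n.+1 <= avg p W (L x) n.+1 + D n.+1 * `|x - y|.
  rewrite /avg -(Ew_cst p (n.+1 + W) (D n.+1 * _)) -EwD; apply: le_Ew => // s.
  exact: lnop_lip.
have hl := lam_avg p0 p1 W (detL y) n.+1.
have nR : 0 < n.+1%:R :> R by rewrite ltr0n.
by rewrite -(ltr_pM2l nR); apply: le_lt_trans hl _; apply: le_lt_trans ha _; rewrite -ltrBrDl.
Qed.

Lemma lam_lsc x kappa : I01 x -> kappa < lamL x ->
  exists2 r, 0 < r & forall y, I01 y -> `|x - y| < r -> kappa <= lamL y.
Proof.
move=> hx hk.
have ar (g l q k d a u t : R) : 0 <= u -> l - q - k + a <= g -> l = t + 4 * u -> q <= u -> d <= u ->
  k <= u -> t + a <= g - d by lra.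
set e := (lamL x - kappa) / 4.
have e0 : 0 < e by rewrite divr_gt0 // subr_gt0.
have c0 := ln_ge0 Lam1.
have q0 : 0 <= 2 * ln Lam / e by apply: divr_ge0; [exact: mulr_ge0|exact: ltW].
have [M hM] : exists M, 2 * ln Lam / e < M%:R.
  by exists (Num.bound (2 * ln Lam / e)); exact: archi_boundP.
have M0 : (0 < M)%N.
  by rewrite -(ltr0n R); exact: le_lt_trans hM.
have MR : 0 < M%:R :> R by rewrite ltr0n.
have hM' : 2 * ln Lam / M%:R <= e.
  by rewrite ler_pdivrMr // [leRHS]mulrC -ler_pdivrMr // ltW.
have gx t w : vnorm w <= Lam * vnorm (L x t *m w) by exact: geL.
have [K hK] := growth_spread p0 p1 (depL x) (detL x) Lam1 (fun s => leL s hx) gx M0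
  (spreadL hx M0).
have [n hn] : exists n, `|K| / e < n.+1%:R.
  exists (Num.bound (`|K| / e)); apply: lt_trans (archi_boundP _) _.
    by apply: divr_ge0; [exact: normr_ge0|exact: ltW].
  by rewrite ltr_nat.
have nR : 0 < n.+1%:R :> R by rewrite ltr0n.
have hn' : K <= n.+1%:R * e.
  by apply: le_trans (ler_norm _) _; rewrite -ler_pdivrMr // ltW.
have D1 : 0 < D n.+1 + 1 by rewrite ltr_wpDl ?D_ge0.
exists (e / (D n.+1 + 1)) => [|y hy hr]; first by rewrite divr_gt0.
have hd : D n.+1 * `|x - y| <= n.+1%:R * e.
  move: hr; rewrite ltr_pdivlMr // mulrDr mulr1 mulrC => hr.
  apply: le_trans (_ : e <= _); last by rewrite ler_peMl ?(ltW e0) // ler1n.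
  by apply: ltW; apply: le_lt_trans hr; rewrite lerDl.
have gy t w : vnorm w <= Lam * vnorm (L y t *m w) by exact: geL.
apply: (lam_growth p0 p1 (depL y) (detL y) Lam1 (fun s => leL s hy) gy (ltn0Sn n)) => s v v0.
apply: le_trans (_ : growth p W (L x) n.+1 s v - D n.+1 * `|x - y| <= _).
  have h1 := hK n.+1 s v v0; rewrite -/(lamL x) mulrBr in h1.
  have h2 : n.+1%:R * (2 * ln Lam / M%:R) <= n.+1%:R * e by rewrite ler_pM2l.
  have h3 : n.+1%:R * lamL x = n.+1%:R * kappa + 4 * (n.+1%:R * e).
    by rewrite /e; field.
  by apply: ar h1 h3 h2 hd hn'; rewrite mulr_ge0 // ltW.
rewrite -(Ew_cst p n.+1 (D n.+1 * _)) -EwN -EwD; apply: le_Ew => // u.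
by rewrite lerBlDr distrC; exact: ln_vnorm_lip.
Qed.

Lemma lam_ivt kappa : kappa < lamL 0 -> lamL 1 < kappa ->
  exists2 x, I01 x & lamL x = kappa.
Proof.
have ar (a b r : R) : 0 < r -> b <= a + r / 2 -> b - a < r by lra.
move=> h0 h1; have i0 : I01 0 by rewrite /I01 lexx ler01.
pose E := [set x : R | I01 x /\ kappa <= lamL x].
have E0 : E 0 by split => //; exact: ltW.
have Eub : has_ubound E by exists 1 => x [/andP[]].
have hs : has_sup E by split => //; exists 0.
set x := sup E; have hx : I01 x.
  apply/andP; split; first exact: ub_le_sup.
  by apply: ge_sup; [exists 0|move=> y [/andP[]]].
exists x => //; case: (ltgtP (lamL x) kappa) => // hk.
  have [r r0 hr] := lam_usc hx hk.
  have [y [hy hyk] yx] := sup_adherent r0 hs.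
  have Ey : E y := conj hy hyk.
  have yle : y <= x := ub_le_sup Eub Ey.
  have xyr : `|x - y| < r by rewrite ger0_norm ?subr_ge0 // ltrBlDl -ltrBlDr.
  by have := hr y hy xyr; rewrite ltNge hyk.
have [r r0 hr] := lam_lsc hx hk.
have x1 : x < 1.
  rewrite lt_neqAle; case/andP: hx => _ ->; rewrite andbT.
  by apply/eqP => xe; move: hk; rewrite xe => /(lt_trans h1); rewrite ltxx.
set y := Num.min 1 (x + r / 2).
have xy : x < y by rewrite lt_min x1 ltrDl divr_gt0.
have hy : I01 y.
  by rewrite /I01 ge_min lexx andbT; case/andP: hx => hx0 _; rewrite (le_trans hx0) // ltW.
have yr : `|x - y| < r.
  rewrite distrC ger0_norm ?subr_ge0 ?(ltW xy) //.
  by apply: ar => //; rewrite ge_min lexx orbT.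
have Ey : E y := conj hy (hr y hy yr).
by have yx : y <= x := ub_le_sup Eub Ey; rewrite leNgt xy in yx.
Qed.

End Family.

(** * The chain of swaps *)

Section Chain.
Variables (R : realType) (p : R).
Hypotheses (p0 : 0 < p) (p1 : p < 1) (p2 : 1 <= 2 * p).
Variables (T : nat) (lg lt : R).
Hypotheses (lg0 : 0 <= lg) (lt0 : 0 <= lt).

Notation Ew := (Ew p).

(* (Y, e, r): Y is the logarithm of the growth of the followed axis, e = 1 or -1
   tells whether that axis is horizontal or vertical, r counts the zeros read
   since the last one; the axes are swapped when r = T. *)
Definition chain := (R * R * nat)%type.

Definition step (b : bool) (st : chain) : chain :=
  let: (Y, e, r) := st in
  let: Y1 := if r == T then Y + e * lt else Y in
  let: e1 := if r == T then - e else e in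
  (Y1 + e1 * (if b then lg else - lg), e1, if b then 0%N else r.+1).

Fixpoint steps (N : nat) (st : chain) (s : nat -> bool) : chain :=
  if N is N'.+1 then steps N' (step (s 0%N) st) (shiftn 1 s) else st.

Lemma stepsD m n st s : steps (m + n) st s = steps n (steps m st s) (shiftn m s).
Proof.
by elim: m st s => [//|m IH] st s; rewrite addSn /= IH shiftnD.
Qed.

Lemma stepsS n st s : steps n.+1 st s = step (s n) (steps n st s).
Proof. by rewrite -addn1 stepsD /= /shiftn addn0. Qed.

Lemma dep_steps n st : dep n (steps n st).
Proof.
elim: n st => [//|n IH] st s s' h /=.
by rewrite h //; apply: IH => i im; apply: h.
Qed.

Definition Yof (st : chain) : R := st.1.1.
Definition eof (st : chain) : R := st.1.2.
Definition rof (st : chain) : nat := st.2.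

Let h := (2 * p - 1) * lg.
(* pot is the corrector that turns Y + e * pot r into a martingale (phi_harmonic). *)
Let Ginf := (lt + h / p / (1 - p) ^+ T) / 2.
Definition pot (r : nat) := Ginf - (if (r <= T)%N then h / p / (1 - p) ^+ r else 0).
Definition potmax := lt + h / p / (1 - p) ^+ T.
Let phi (st : chain) := Yof st + eof st * pot (rof st).

Let q0 : 1 - p != 0. Proof. by rewrite subr_eq0 gt_eqF. Qed.
Let h0 : 0 <= h. Proof. by rewrite mulr_ge0 // subr_ge0. Qed.
Let hpow r : 0 <= h / p / (1 - p) ^+ r.
Proof. by rewrite !divr_ge0 ?exprn_ge0 ?subr_ge0 // ltW. Qed.

Lemma phi_harmonic st : p * phi (step true st) + (1 - p) * phi (step false st) = phi st.
Proof.
case: st => [[Y e] r]; rewrite /phi /step /Yof /eof /rof /=.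
have p0' : p != 0 by rewrite gt_eqF.
have qT n : (1 - p) ^+ n != 0 by rewrite expf_neq0.
rewrite /pot leq0n expr0 /Ginf /h.
case: (ltngtP r T) => [rT|rT|->].
- by rewrite exprS; field; rewrite p0' q0 !qT.
- by rewrite ?ltnn; field; rewrite ?p0' ?q0 ?qT.
- by rewrite ?ltnn; field; rewrite ?p0' ?q0 ?qT.
Qed.

Lemma Ew_phi N st : Ew N (fun s => phi (steps N st s)) = phi st.
Proof.
elim: N st => [//|N IH] st /=.
by rewrite -[RHS]phi_harmonic -!IH; congr (_ * _ + _ * _); apply: eq_Ew.
Qed.

Lemma pot_le r : `|pot r| <= potmax.
Proof.
have ar (a b c : R) : 0 <= a -> 0 <= b -> 0 <= c -> c <= b ->
    - (a + b) <= (a + b) / 2 - c <= a + b.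
  by move=> *; apply/andP; split; lra.
rewrite /pot /potmax /Ginf ler_norml; case: leqP => rT; apply: ar => //.
rewrite ler_wpM2l ?divr_ge0 ?(ltW p0) // lef_pV2 ?posrE ?exprn_gt0 ?subr_gt0 //.
by apply: ler_wiXn2l => //; rewrite ?subr_ge0 ?(ltW p1) // lerBlDr lerDl ltW.
Qed.

Lemma potmax_ge0 : 0 <= potmax.
Proof. by apply: le_trans (pot_le 0). Qed.

Lemma norm_eof N st s : `|eof st| = 1 -> `|eof (steps N st s)| = 1.
Proof.
elim: N st s => [//|N IH] st s he /=; apply: IH; case: st he => [[Y e] r] /=.
by rewrite /eof /=; case: ifP => // _; rewrite normrN.
Qed.

Lemma step_Yof b st : `|eof st| = 1 -> `|Yof (step b st) - Yof st| <= lg + lt.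
Proof.
case: st => [[Y e] r]; rewrite /eof /Yof /= => he.
have lgE : `|if b then lg else - lg| = lg by case: b; rewrite ?normrN ger0_norm.
set x := if b then _ else _ in lgE *; case: ifP => _.
  have -> : Y + e * lt + - e * x - Y = - e * x + e * lt by ring.
  apply: le_trans (ler_normD _ _) _.
  by rewrite !normrM normrN he lgE !mul1r (ger0_norm lt0).
have -> : Y + e * x - Y = e * x by ring.
by rewrite normrM he lgE mul1r lerDl.
Qed.

Lemma steps_Yof N st s : `|eof st| = 1 -> `|Yof (steps N st s) - Yof st| <= N%:R * (lg + lt).
Proof.
move=> he; elim: N => [|N IH]; first by rewrite /= subrr normr0 mul0r.
rewrite stepsS -natr1 mulrDl mul1r.
apply: le_trans (lerD IH (step_Yof (s N) (norm_eof N s he))).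
by apply: le_trans (ler_normD _ _); rewrite [in leRHS]addrC addrA subrK.
Qed.

Lemma Ew_Yof N st : `|eof st| = 1 ->
  `|Ew N (fun s => Yof (steps N st s)) - Yof st| <= 2 * potmax.
Proof.
move=> he; have hb st' : `|eof st'| = 1 -> `|eof st' * pot (rof st')| <= potmax.
  by move=> he'; rewrite normrM he' mul1r pot_le.
have hE : Ew N (fun s => Yof (steps N st s)) =
    phi st - Ew N (fun s => eof (steps N st s) * pot (rof (steps N st s))).
  by rewrite -(Ew_phi N) -EwN -EwD; apply: eq_Ew => s; rewrite /phi addrK.
have h1 : `|Ew N (fun s => eof (steps N st s) * pot (rof (steps N st s)))| <= potmax.
  rewrite ler_norml; apply/andP; split.
    rewrite -(Ew_cst p N (- potmax)); apply: (le_Ew (ltW p0) (ltW p1)) => s.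
    by have := hb _ (norm_eof N s he); rewrite ler_norml => /andP[].
  rewrite -[leRHS](Ew_cst p N); apply: (le_Ew (ltW p0) (ltW p1)) => s.
  by have := hb _ (norm_eof N s he); rewrite ler_norml => /andP[].
have h2 := hb _ he; rewrite hE /phi.
have -> : Yof st + eof st * pot (rof st) -
  Ew N (fun s => eof (steps N st s) * pot (rof (steps N st s))) - Yof st =
  eof st * pot (rof st) - Ew N (fun s => eof (steps N st s) * pot (rof (steps N st s))) by ring.
by apply: le_trans (ler_normB _ _) _; rewrite mulr_natl; exact: lerD.
Qed.

Lemma Ew_Yof_sqr k B st : `|eof st| = 1 ->
  Ew (k * B) (fun s => Yof (steps (k * B) st s) ^+ 2) <=
  Yof st ^+ 2 + 4 * potmax * k%:R * `|Yof st| + k%:R * (B%:R * (lg + lt)) ^+ 2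
  + 4 * potmax * (B%:R * (lg + lt)) * k%:R ^+ 2.
Proof.
have ar (y G k' Ym E1 d : R) : 0 <= G -> 0 <= k' -> 0 <= Ym -> `|d| <= 2 * G ->
  E1 <= y ^+ 2 + 2 * y * d + Ym ^+ 2 + (4 * G * k' * (`|y| + Ym) + (k' * Ym ^+ 2 + 4 * G * Ym * k' ^+ 2)) ->
  E1 <= y ^+ 2 + 4 * G * (k' + 1) * `|y| + (k' + 1) * Ym ^+ 2 + 4 * G * Ym * (k' + 1) ^+ 2.
  move=> G0 k0 Y0 hd hE; apply: le_trans hE _.
  have h1 : y * d <= `|y| * (2 * G).
    by apply: le_trans (ler_norm _) _; rewrite normrM ler_wpM2l.
  have h2 : 0 <= G * Ym by rewrite mulr_ge0.
  have h3 : 0 <= G * Ym * k' by rewrite mulr_ge0.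
  nra.
have ar2 (y y' m x x' b c : R) : (y' - y) ^+ 2 <= m -> x <= x' ->
    y' ^+ 2 + x + b + c <= y ^+ 2 + 2 * y * (y' - y) + m + (x' + (b + c)).
  by move=> *; lra.
set Ym := B%:R * (lg + lt); have Ym0 : 0 <= Ym by rewrite mulr_ge0 // addr_ge0.
have G0 := potmax_ge0.
elim: k st => [|k IH] st he.
  rewrite mul0n /= mul0r mulr0 !mul0r expr0n /= mulr0 !addr0 //.
rewrite mulSn Ew_put -[k.+1%:R]natr1.
apply: (@ar _ _ _ _ _ (Ew B (fun s => Yof (steps B st s)) - Yof st)) => //.
  exact: Ew_Yof.
have -> : Yof st ^+ 2 + 2 * Yof st * (Ew B (fun s => Yof (steps B st s)) - Yof st) + Ym ^+ 2 +
   (4 * potmax * k%:R * (`|Yof st| + Ym) + (k%:R * Ym ^+ 2 + 4 * potmax * Ym * k%:R ^+ 2)) =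
  Ew B (fun s => Yof st ^+ 2 + 2 * Yof st * (Yof (steps B st s) - Yof st) + Ym ^+ 2 +
   (4 * potmax * k%:R * (`|Yof st| + Ym) + (k%:R * Ym ^+ 2 + 4 * potmax * Ym * k%:R ^+ 2))).
  by rewrite !EwD !Ew_cst EwZ EwD Ew_cst.
apply: (le_Ew (ltW p0) (ltW p1)) => w.
have hw := steps_Yof B w he; rewrite -/Ym in hw.
have -> : Ew (k * B) (fun u => Yof (steps (B + k * B) st (put B w u)) ^+ 2) =
   Ew (k * B) (fun u => Yof (steps (k * B) (steps B st w) u) ^+ 2).
  apply: eq_Ew => u; rewrite stepsD shiftn_put.
  by rewrite (@dep_steps B st (put B w u) w) // => i iB; rewrite /put iB.
apply: le_trans (IH _ (norm_eof B w he)) _.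
set y := Yof st; set y' := Yof _; rewrite -/y -/y' in hw.
have h1 : `|y'| <= `|y| + Ym.
  have -> : y' = y + (y' - y) by rewrite addrC subrK.
  by apply: le_trans (ler_normD _ _) _; rewrite lerD2l.
have h2 : (y' - y) ^+ 2 <= Ym ^+ 2.
  by rewrite -real_normK ?num_real // ler_pXn2r ?nnegrE.
have h3 : 4 * potmax * k%:R * `|y'| <= 4 * potmax * k%:R * (`|y| + Ym).
  by rewrite ler_wpM2l // !mulr_ge0.
exact: ar2 h2 h3.
Qed.

Lemma Ew_norm_Yof k B e r kappa : `|e| = 1 -> 0 < kappa -> (0 < k)%N -> (0 < B)%N ->
  128 * (lg + lt) ^+ 2 <= kappa ^+ 2 * k%:R ->
  512 * potmax * (lg + lt) <= kappa ^+ 2 * B%:R ->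
  Ew (k * B) (fun s => `|Yof (steps (k * B) (0, e, r) s)|) <= (k * B)%:R * kappa / 8.
Proof.
move=> he kp k0 B0 hk hB.
have := @Ew_Yof_sqr k B (0, e, r) he.
rewrite /Yof /= normr0 expr0n /= mulr0 !add0r => hE.
set N := (k * B)%:R : R; have kR : 0 < k%:R :> R by rewrite ltr0n.
have BR : 0 < B%:R :> R by rewrite ltr0n.
have N0 : 0 < N by rewrite /N natrM mulr_gt0.
have hE' : Ew (k * B) (fun s => Yof (steps (k * B) (0, e, r) s) ^+ 2) <= N ^+ 2 * (kappa ^+ 2 / 64).
  apply: le_trans hE _; rewrite /N natrM.
  have h1 : k%:R * (B%:R * (lg + lt)) ^+ 2 * 128 <= k%:R * B%:R ^+ 2 * (kappa ^+ 2 * k%:R).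
    have -> : k%:R * (B%:R * (lg + lt)) ^+ 2 * 128 = k%:R * B%:R ^+ 2 * (128 * (lg + lt) ^+ 2) by ring.
    by rewrite ler_pM2l // mulr_gt0 ?exprn_gt0.
  have h2 : 4 * potmax * (B%:R * (lg + lt)) * k%:R ^+ 2 * 128 <=
     k%:R ^+ 2 * B%:R * (kappa ^+ 2 * B%:R).
    have -> : 4 * potmax * (B%:R * (lg + lt)) * k%:R ^+ 2 * 128 =
      k%:R ^+ 2 * B%:R * (512 * potmax * (lg + lt)) by ring.
    by rewrite ler_pM2l // mulr_gt0 ?exprn_gt0.
  have -> : (k%:R * B%:R) ^+ 2 * (kappa ^+ 2 / 64) =
    (k%:R * B%:R ^+ 2 * (kappa ^+ 2 * k%:R)) / 128 + (k%:R ^+ 2 * B%:R * (kappa ^+ 2 * B%:R)) / 128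
    by field.
  by apply: lerD; rewrite ler_pdivlMr.
set M := kappa * N / 8; have M0 : 0 < M by rewrite divr_gt0 // mulr_gt0.
apply: le_trans (_ : Ew (k * B) (fun s => (2 * M)^-1 * Yof (steps (k * B) (0, e, r) s) ^+ 2 + M / 2) <= _).
  apply: (le_Ew (ltW p0) (ltW p1)) => s; rewrite -/(Yof _).
  set y := Yof _.
  rewrite -(@ler_pM2l _ (2 * M)) ?mulr_gt0 // mulrDr mulVKf; last by rewrite gt_eqF ?mulr_gt0.
  have := sqr_ge0 (`|y| - M); rewrite -(real_normK (num_real y)); lra.
rewrite EwD EwZ Ew_cst.
have h1 : (2 * M)^-1 * Ew (k * B) (fun s => Yof (steps (k * B) (0, e, r) s) ^+ 2) <= N * kappa / 16.
  rewrite ler_pdivrMl ?mulr_gt0 //; apply: le_trans hE' _.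
  by rewrite /M le_eqVlt; apply/orP; left; apply/eqP; field.
apply: le_trans (lerD h1 (lexx _)) _.
by rewrite /M le_eqVlt; apply/orP; left; apply/eqP; field.
Qed.

End Chain.

(** * The perturbed cocycle *)

Definition block (b : bool) (l a : nat) (s : nat -> bool) : bool :=
  [forall i : 'I_l, s (a + i)%N == b].

Lemma blockP b l a s : reflect (forall j, (a <= j < a + l)%N -> s j = b) (block b l a s).
Proof.
apply: (iffP forallP) => [h j jl|h i]; last first.
  by apply/eqP; apply: h; rewrite leq_addr ltn_add2l ltn_ord.
have il : (j - a < l)%N by lia.
by have /eqP := h (Ordinal il); rewrite /= subnKC //; lia.
Qed.

Lemma block_shift b l a i s : block b l a (shiftn i s) = block b l (i + a) s.
Proof. by apply: eq_forallb => j; rewrite /shiftn addnA. Qed.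

Lemma dep_block b l a : dep (a + l) (block b l a).
Proof.
by move=> s s' h; apply: eq_forallb => j; rewrite h // ltn_add2l.
Qed.

Definition start (l a : nat) (s : nat -> bool) : bool := s a.-1 && block false l a s.

Lemma startP l a s : reflect (s a.-1 = true /\ forall j, (a <= j < a + l)%N -> s j = false)
  (start l a s).
Proof. by apply: (iffP andP) => -[h1 h2]; split=> //; apply/blockP. Qed.

Lemma start_shift l a i s : (0 < a)%N -> start l a (shiftn i s) = start l (i + a) s.
Proof. by move=> a0; rewrite /start block_shift /shiftn -!subn1 addnBA. Qed.

Lemma dep_start l a : dep (a + l).+1 (start l a).
Proof.
move=> s s' h; rewrite /start h; last by lia.
by rewrite (@dep_block false l a s s') // => i il; apply: h; rewrite ltnW.
Qed.

Lemma startW l l' a s : (l <= l')%N -> start l' a s -> start l a s.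
Proof.
by move=> ll /startP[h1 h2]; apply/startP; split=> // j jl; apply: h2; lia.
Qed.

(* T.+1 is a filler larger than T, for words without any 1 before c. *)
Fixpoint run (T c : nat) (s : nat -> bool) : nat :=
  if c is c'.+1 then (if s c' then 0%N else (run T c' s).+1) else T.+1.

Lemma runP T c s r : (r <= T)%N -> (run T c s == r) = (r < c)%N && start r (c - r) s.
Proof.
elim: c r => [|c IH] r rT /=; first by rewrite gtn_eqF.
case: ifP => sc.
  case: r rT => [|r] rT; first by rewrite ltn0Sn subn0 /start /= sc; apply/esym/blockP => j; lia.
  apply/esym/negP => /andP[rc /startP[_ h]].
  have hc : (c.+1 - r.+1 <= c < c.+1 - r.+1 + r.+1)%N by lia.
  by have := h c hc; rewrite sc.
case: r rT => [|r] rT.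
  by rewrite subn0 /start /= sc.
rewrite eqSS (IH _ (ltnW rT)) ltnS subSS; case: ltnP => rc //=.
apply/idP/idP => /startP[h1 h2]; apply/startP; split=> // j jr; last by apply: h2; lia.
by have [jc|jc] := ltnP j c; [apply: h2; lia|have -> : j = c by lia].
Qed.

Section Construct.
Variables (R : realType) (g e0 eta cut : R) (rho T n m : nat).
Hypotheses (g1 : 1 < g) (e00 : 0 < e0) (rho3 : (3 <= rho)%N) (rhoT : (rho <= T)%N) (Tn : (T < n)%N).

Definition q2 (b : bool) : R := if b then g^-1 ^+ 2 else g ^+ 2.
(* The factor by which the diagonal cocycle multiplies slopes from time a to time c. *)
Definition weight (a c : nat) (s : nat -> bool) : R := \prod_(a <= j < c) q2 (s j).
(* The slope at time c of the moving frame due to the run of zeros starting at a: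
   it is e0 at time a, and changes sign when the axes are swapped at time a + T. *)
Definition run_term (a c : nat) (s : nat -> bool) : R :=
  if start rho a s then (if start T a s && (a + T < c)%N then -1 else 1) * e0 * weight a c s else 0.
(* A slope is erased n steps after its creation, provided that it has become small;
   it typically has, slopes being multiplied by g ^- (4p - 2) per step on average. *)
Definition res (c : nat) (s : nat -> bool) : R :=
  if weight (c - n) c s <= cut then run_term (c - n) c s else 0.
(* The slope reached after T zeros: a shear by its inverse then completes a swap of the axes. *)
Definition swap_ratio : R := e0 * (g ^+ 2) ^+ T.
(* The shears by eta at isolated runs of z = 1 or 2 zeros are only there to spread the
   images of every vector; each value of z takes care of one coordinate. *)
Definition lone (z c : nat) (s : nat -> bool) : bool :=
  [&& block true m (c - m) s, block false z c s & block true m (c + z) s].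
Definition lower_shear (x : R) (c : nat) (s : nat -> bool) : R :=
  x * ((start rho c s)%:R * e0 - res c s) + eta * (lone 2 c s)%:R.
Definition upper_shear (x : R) (c : nat) (s : nat -> bool) : R :=
  - (x / swap_ratio) * (start T (c - T) s)%:R + eta * (lone 1 c s)%:R.
Definition dg (b : bool) : R := if b then g else g^-1.
(* diag(a, 1/a) times a lower and an upper shear; x = 0 leaves only the shears by eta,
   and x = 1 gives the swapping cocycle. *)
Definition perturbed (x : R) (c : nat) (s : nat -> bool) : 'M[R]_2 :=
  let a := dg (s c) in let l := lower_shear x c s in let u := upper_shear x c s in
  mx2 a (a * u) (l / a) ((1 + l * u) / a).

Definition low_mx (t : R) : 'M[R]_2 := mx2 1 0 t 1.
Definition frame_coef (c : nat) (s : nat -> bool) : R := \sum_(c - n <= a < c) run_term a c s.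
(* The words for which the conjugacy perturbed_frame may fail. *)
Definition bad_word (c : nat) (s : nat -> bool) : bool :=
  [|| start rho (c - n) s && (cut < weight (c - n) c s),
      start T (c - T) s && has (fun a => start rho a s) (index_iota (c - n) (c - T)),
      lone 1 c s | lone 2 c s].

Lemma g_gt0 : 0 < g. Proof. exact: lt_trans g1. Qed.

Lemma dg_gt0 b : 0 < dg b.
Proof. by case: b; rewrite /= ?invr_gt0 g_gt0. Qed.

Lemma q2E b : q2 b = (dg b)^-1 ^+ 2.
Proof. by case: b; rewrite //= invrK. Qed.

Lemma q2_gt0 b : 0 < q2 b.
Proof. by rewrite q2E exprn_gt0 // invr_gt0 dg_gt0. Qed.

Lemma q2_le b : q2 b <= g ^+ 2.
Proof.
case: b => //=; rewrite exprVn.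
have g2 : 1 <= g ^+ 2 by rewrite exprn_ege1 // ltW.
by apply: (le_trans _ g2); rewrite invf_le1 ?exprn_gt0 ?g_gt0.
Qed.

Lemma weight_gt0 a c s : 0 < weight a c s.
Proof. by apply: prodr_gt0 => j _; exact: q2_gt0. Qed.

Lemma weight_le a c s : weight a c s <= (g ^+ 2) ^+ (c - a).
Proof.
rewrite /weight -prodr_const_nat; apply: ler_prod => j _.
by rewrite q2_le ltW ?q2_gt0.
Qed.

Lemma weightS a c s : (a <= c)%N -> weight a c.+1 s = q2 (s c) * weight a c s.
Proof. by move=> ac; rewrite /weight big_nat_recr //= mulrC. Qed.

Lemma swap_ratio_gt0 : 0 < swap_ratio.
Proof. by rewrite mulr_gt0 // !exprn_gt0 // g_gt0. Qed.

Lemma run_term_full a s : start T a s -> run_term a (a + T) s = swap_ratio.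
Proof.
move=> h; rewrite /run_term (startW rhoT h) ltnn andbF mul1r /swap_ratio; congr (_ * _).
rewrite /weight (eq_big_nat _ _ (F2 := fun=> g ^+ 2)).
  by rewrite prodr_const_nat addKn.
by move=> j jT; case/startP: h => _ ->.
Qed.

Lemma run_termS a c s : (a <= c)%N ->
  run_term a c.+1 s = q2 (s c) *
    (run_term a c s - (if (a + T == c)%N && start T a s then 2 * swap_ratio else 0)).
Proof.
move=> ac; case: (boolP ((a + T == c)%N && start T a s)) => [/andP[/eqP <- h]|hn].
  rewrite run_term_full // /run_term (startW rhoT h) h /= ltnSn weightS ?leq_addr //.
  have := run_term_full h; rewrite /run_term (startW rhoT h) ltnn andbF mul1r => <-; ring.
rewrite subr0 /run_term; case: ifP => _; last by rewrite mulr0.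
rewrite weightS //; suff -> : start T a s && (a + T < c.+1)%N = start T a s && (a + T < c)%N by ring.
by rewrite ltnS leq_eqVlt; move: hn; case: (start T a s); case: (_ == c).
Qed.

Lemma frame_coefS c s : (n < c)%N -> frame_coef c.+1 s = q2 (s c) *
  (frame_coef c s + (start rho c s)%:R * e0 - run_term (c - n) c s
   - (if start T (c - T) s then 2 * swap_ratio else 0)).
Proof.
move=> nc; rewrite /frame_coef subSn 1?ltnW // big_nat_recr ?leq_subr //=; last by lia.
have -> : run_term c c.+1 s = q2 (s c) * ((start rho c s)%:R * e0).
  rewrite /run_term; have -> : (c + T < c.+1)%N = false by lia.
  rewrite andbF weightS // /weight big_geq //; case: ifP => _ /=; ring.
rewrite [in RHS]big_ltn ?ltn_subrL; last by lia.
rewrite (eq_big_nat _ _ (F2 := fun a => q2 (s c) * (run_term a c s -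
  (if (a + T == c)%N && start T a s then 2 * swap_ratio else 0)))); last first.
  by move=> a ac; apply: run_termS; lia.
rewrite -mulr_sumr sumrB.
have -> : \sum_((c - n).+1 <= a < c) (if (a + T == c)%N && start T a s then 2 * swap_ratio else 0) =
  (if start T (c - T) s then 2 * swap_ratio else 0).
  rewrite (bigD1_seq (c - T)%N) ?iota_uniq //=; last by rewrite mem_index_iota; lia.
  rewrite subnK ?eqxx /=; last by lia.
  rewrite big1_seq ?addr0 // => a /andP[aT]; rewrite mem_index_iota => ac.
  by case: eqP => //; lia.
by set Z := \sum_(_ <= _ < _) _; set X := (if _ then _ else _); set M := _%:R; ring.
Qed.

Lemma frame_coef_full c s : (n < c)%N -> start T (c - T) s ->
  ~~ has (fun a => start rho a s) (index_iota (c - n) (c - T)) -> frame_coef c s = swap_ratio.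
Proof.
move=> nc h /hasPn hno; rewrite /frame_coef.
rewrite (bigD1_seq (c - T)%N) ?iota_uniq //=; last by rewrite mem_index_iota; lia.
have := run_term_full h; rewrite subnK; last by lia.
move=> ->; rewrite big1_seq ?addr0 // => a /andP[aT]; rewrite mem_index_iota => ac.
rewrite /run_term; case: ifP => // ha; case: (ltnP a (c - T)) => [aT'|aT'].
  by have := hno a; rewrite mem_index_iota ha; case/andP: ac => -> _; rewrite aT' => /(_ isT).
have hr : (c - T <= a.-1 < c - T + T)%N by lia.
by case/startP: ha => ha _; case/startP: h => _ /(_ _ hr); rewrite ha.
Qed.

Definition swap_mx : 'M[R]_2 := mx2 0 (- swap_ratio^-1) swap_ratio 0.
Definition diag_letter (b : bool) : 'M[R]_2 := mx2 (dg b) 0 0 (dg b)^-1.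

Lemma perturbed_frame c s : (n < c)%N -> ~~ bad_word c s ->
  perturbed 1 c s *m low_mx (frame_coef c s) =
  low_mx (frame_coef c.+1 s) *m (diag_letter (s c) *m (if start T (c - T) s then swap_mx else 1%:M)).
Proof.
move=> nc; rewrite /bad_word !negb_or => /and4P[h1 h2 h3 h4].
have a0 := dg_gt0 (s c); set a := dg (s c) in a0 *; have a0' : a != 0 by rewrite gt_eqF.
have t0 : swap_ratio != 0 by rewrite gt_eqF // swap_ratio_gt0.
rewrite frame_coefS // q2E -/a /perturbed -/a.
case: (boolP (start T (c - T) s)) h2 => [hf|hf] /= h2.
  have hs : start rho c s = false.
    have hr : (c - T <= c.-1 < c - T + T)%N by move: nc Tn rho3 rhoT; clear; lia.
    by apply/negP => /startP[hc _]; case/startP: hf => _ /(_ _ hr); rewrite hc.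
  have ht : run_term (c - n) c s = 0.
    have hr : (c - n <= c - n < c - T)%N by rewrite leqnn ltn_sub2l // (ltn_trans Tn).
    rewrite /run_term; case: ifP => // hm; move/hasPn: h2 => /(_ (c - n)%N).
    by rewrite hm mem_index_iota => /(_ hr).
  have -> : lower_shear 1 c s = 0.
    by rewrite /lower_shear hs (negbTE h4) /res ht if_same /=; ring.
  have -> : upper_shear 1 c s = - swap_ratio^-1.
    by rewrite /upper_shear hf (negbTE h3) /=; field.
  rewrite (frame_coef_full nc hf h2) hs ht /low_mx /swap_mx /diag_letter -/a !mulmx2 /=.
  by congr mx2; field; rewrite ?a0' ?t0.
rewrite mulmx1.
have -> : upper_shear 1 c s = 0 by rewrite /upper_shear (negbTE hf) (negbTE h3) /=; ring.
have -> : lower_shear 1 c s = (start rho c s)%:R * e0 - run_term (c - n) c s.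
  rewrite /lower_shear (negbTE h4) mulr0 addr0 mul1r; congr (_ - _); rewrite /res.
  case: ifPn => //; rewrite -ltNge => hw; rewrite /run_term.
  by move: h1; rewrite hw andbT => /negbTE ->.
by rewrite /low_mx /diag_letter -/a !mulmx2; congr mx2; field; rewrite ?a0' ?t0.
Qed.

End Construct.

Section Monomial.
Variables (R : realType) (g e0 eta cut : R) (rho T n m J : nat).
Hypotheses (g1 : 1 < g) (e00 : 0 < e0) (rho3 : (3 <= rho)%N) (rhoT : (rho <= T)%N) (Tn : (T < n)%N)
  (nJ : (n < J)%N) (mJ : (m + 2 <= J)%N).

Notation wt := (weight g).
Notation term := (run_term g e0 rho T).
Notation frame := (frame_coef g e0 rho T n).
Notation tau := (swap_ratio g e0 T).
Notation bad := (bad_word g cut rho T n m).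
Notation Lp := (perturbed g e0 eta cut rho T n m).

Lemma weight_shift a c i s : wt a c (shiftn i s) = wt (i + a) (i + c) s.
Proof.
rewrite /weight -[(i + a)%N]addnC big_addn addnC addnK.
by apply: eq_bigr => j _; rewrite /shiftn addnC.
Qed.

Lemma run_term_shift a c i s : (0 < a)%N -> term a c (shiftn i s) = term (i + a) (i + c) s.
Proof.
by move=> a0; rewrite /run_term !start_shift // weight_shift -addnA ltn_add2l.
Qed.

Lemma lone_shift z c i s : (m <= c)%N ->
  lone m z c (shiftn i s) = lone m z (i + c) s.
Proof. by move=> mc; rewrite /lone !block_shift addnBA // addnA. Qed.

Lemma perturbed_shift x i c s : (n < c)%N -> (m <= c)%N -> Lp x c (shiftn i s) = Lp x (i + c) s.
Proof.
move=> nc mc; rewrite /perturbed /lower_shear /upper_shear /res !lone_shift // !start_shift; try lia.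
rewrite weight_shift run_term_shift ?subn_gt0 // !addnBA ?(ltnW nc) //.
by apply: leq_trans (ltnW nc); exact: ltnW.
Qed.

Lemma bad_word_shift i c s : (n < c)%N -> (m <= c)%N -> bad c (shiftn i s) = bad (i + c) s.
Proof.
move=> nc mc; have Tc : (T < c)%N by exact: ltn_trans nc.
rewrite /bad_word !lone_shift // !start_shift ?subn_gt0 //.
rewrite weight_shift !addnBA ?(ltnW nc) ?(ltnW Tc) //.
congr [|| _, _ && _, _ | _].
rewrite -(@addnBA i c n) ?(ltnW nc) // -(@addnBA i c T) ?(ltnW Tc) //.
rewrite /index_iota iotaDl subnDl has_map; apply: eq_in_has => a.
rewrite mem_iota => /andP[ha _] /=; rewrite start_shift //.
by apply: leq_trans ha; rewrite subn_gt0.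
Qed.

Lemma dep_weight a c : dep c (wt a c).
Proof.
move=> s s' h; rewrite /weight !big_nat; apply: eq_bigr => j /andP[_ jc].
by rewrite h.
Qed.

Lemma dep_lone z c : (z <= 2)%N -> (m <= c)%N -> dep (c + m + 2) (lone m z c).
Proof.
move=> z2 mc s s' h; rewrite /lone.
rewrite (@dep_block true m (c - m) s s'); last by move=> i ic; apply: h; lia.
rewrite (@dep_block false z c s s'); last by move=> i ic; apply: h; lia.
by rewrite (@dep_block true m (c + z) s s') // => i ic; apply: h; lia.
Qed.

Lemma dep_perturbed x : dep (J + J).+1 (Lp x J).
Proof.
move=> s s' h; have hs l a : (a + l <= J + J)%N -> start l a s = start l a s'.
  by move=> al; apply: (@dep_start l a) => i il; apply: h; lia.
have hi z : (z <= 2)%N -> lone m z J s = lone m z J s'.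
  by move=> z2; apply: (@dep_lone z J) => //; [lia|move=> i il; apply: h; lia].
have hw a : wt a J s = wt a J s' by apply: dep_weight => i iJ; apply: h; lia.
rewrite /perturbed /lower_shear /upper_shear /res /run_term !hi // !hs ?hw ?h //; lia.
Qed.

Lemma dep_bad_word : dep (J + J).+1 (bad J).
Proof.
move=> s s' h; have hs l a : (a + l <= J + J)%N -> start l a s = start l a s'.
  by move=> al; apply: (@dep_start l a) => i il; apply: h; lia.
have hi z : (z <= 2)%N -> lone m z J s = lone m z J s'.
  by move=> z2; apply: (@dep_lone z J) => //; [lia|move=> i il; apply: h; lia].
have hw a : wt a J s = wt a J s' by apply: dep_weight => i iJ; apply: h; lia.
rewrite /bad_word !hi // !hs ?hw //; try lia.
congr [|| _, _ && _, _ | _]; apply: eq_in_has => a; rewrite mem_index_iota => ha.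
by apply: hs; lia.
Qed.

Lemma dep_run c : dep c (run T c).
Proof.
elim: c => [//|c IH] s s' h /=; rewrite h //.
by rewrite (IH s s') // => i ic; apply: h; exact: ltnW.
Qed.

Fixpoint mono (N : nat) (s : nat -> bool) : 'M[R]_2 :=
  if N is N'.+1 then diag_letter g (s (J + N')%N) *m
    (if start T (J + N' - T) s then swap_mx g e0 T else 1%:M) *m mono N' s
  else 1%:M.

Lemma coc_frame N s : (forall i, (i < N)%N -> ~~ bad (J + i) s) ->
  coc (Lp 1 J) N s *m low_mx (frame J s) = low_mx (frame (J + N) s) *m mono N s.
Proof.
elim: N => [|N IH] h /=; first by rewrite mul1mx mulmx1 addn0.
rewrite -mulmxA IH; last by move=> i iN; apply: h; exact: ltnW.
rewrite mulmxA perturbed_shift //; last by lia.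
rewrite (addnC N) perturbed_frame //; first by rewrite -!mulmxA addnS.
- by lia.
- exact: h.
Qed.

Definition mrel (M : 'M[R]_2) (st : chain R) :=
  exists2 a : R, a != 0 /\ ln `|a| = Yof st &
   (eof st = 1 /\ M = mx2 a 0 0 a^-1) \/ (eof st = -1 /\ M = mx2 0 (- a^-1) a 0).

Notation path N s := (steps T (ln g) (ln tau) N (0, 1, run T J s) (shiftn J s)).

Lemma rof_path N s : rof (path N s) = run T (J + N) s.
Proof.
elim: N => [|N IH]; first by rewrite addn0.
rewrite stepsS addnS /= -IH; case: (path N s) => [[Y e] r] /=.
by rewrite /rof /= /shiftn; case: ifP.
Qed.

Lemma mono_path N s : mrel (mono N s) (path N s).
Proof.
have gp : 0 < g by exact: g_gt0.
have tp : 0 < tau by exact: swap_ratio_gt0.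
have lnVg : ln g^-1 = - ln g by rewrite lnV ?posrE.
elim: N => [|N [a [a0 hY] hM]].
  exists 1; first by rewrite oner_neq0 normr1 ln1.
  by left; split => //=; apply: mx2P; rewrite mx2E !mxE ?invr1.
rewrite stepsS /=; have := rof_path N s; have := runP (J + N) s (leqnn T).
rewrite /shiftn; set st := path N s in hY hM *; case: st hY hM => [[Y e] r].
rewrite /Yof /eof /rof /= => hY hM hrun ->; rewrite hrun.
have -> /= : (T < J + N)%N by lia.
set b := s (J + N)%N; have d0 : 0 < dg g b by exact: dg_gt0.
have a0' : 0 < `|a| by rewrite normr_gt0.
have lnd : ln (dg g b) = if b then ln g else - ln g by case: (b).
have lnad (c : R) : c != 0 -> ln `|dg g b * c| = (if b then ln g else - ln g) + ln `|c|.
  by move=> c0; rewrite normrM (gtr0_norm d0) lnM ?posrE ?normr_gt0 // lnd.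
have lnadV (c : R) : c != 0 -> ln `|(dg g b)^-1 * c| = - (if b then ln g else - ln g) + ln `|c|.
  move=> c0; rewrite normrM gtr0_norm ?invr_gt0 // lnM ?posrE ?normr_gt0 ?invr_gt0 //.
  by rewrite lnV ?posrE // lnd.
have d0' : dg g b != 0 by rewrite gt_eqF.
have t0 : tau != 0 by rewrite gt_eqF.
have ta0 : tau * a != 0 by rewrite mulf_neq0.
have ta1 : tau^-1 * a != 0 by rewrite mulf_neq0 ?invr_eq0.
case: ifP => _; case: hM => -[-> ->]; rewrite /diag_letter /swap_mx ?mulmx1 !mulmx2 /mrel /Yof /eof /=.
- exists ((dg g b)^-1 * (tau * a)); first split.
  + by rewrite mulf_neq0 ?invr_eq0.
  + rewrite lnadV // normrM (gtr0_norm tp) lnM ?posrE //= hY; ring.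
  + by right; split => //=; congr mx2; field; rewrite ?d0' ?a0 ?t0.
- exists (dg g b * (- (tau^-1 * a))); first split.
  + by rewrite mulf_neq0 // oppr_eq0.
  + rewrite lnad ?oppr_eq0 // normrN normrM gtr0_norm ?invr_gt0 //.
    rewrite lnM ?posrE ?invr_gt0 //= lnV ?posrE // hY; ring.
  + by left; split; rewrite /= ?opprK //; congr mx2; field; rewrite ?d0' ?a0 ?t0.
- exists (dg g b * a); first split.
  + by rewrite mulf_neq0.
  + rewrite lnad //= hY; ring.
  + by left; split => //=; congr mx2; field; rewrite ?d0' ?a0 ?t0.
- exists ((dg g b)^-1 * a); first split.
  + by rewrite mulf_neq0 ?invr_eq0.
  + rewrite lnadV //= hY; ring.
  + by right; split => //=; congr mx2; field; rewrite ?d0' ?a0 ?t0.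
Qed.

Lemma opnorm_mrel M st : mrel M st -> opnorm M <= expR `|Yof st|.
Proof.
move=> [a [a0 <-] hM]; have a0' : 0 < `|a| by rewrite normr_gt0.
set E := expR _; have E0 : 0 < E := expR_gt0 _.
have h1 : `|a| <= E.
  by rewrite -[leLHS](lnK (x := `|a|)) ?posrE // ler_expR ler_norm.
have h2 : `|a^-1| <= E.
  rewrite normfV -[leLHS](lnK (x := `|a|^-1)) ?posrE ?invr_gt0 // ler_expR.
  by rewrite lnV ?posrE //; have := ler_norm (- ln `|a|); rewrite normrN.
have sq (c t : R) : `|c| <= E -> (c * t) ^+ 2 <= E ^+ 2 * t ^+ 2.
  move=> cE; rewrite exprMn ler_wpM2r ?sqr_ge0 // -(real_normK (num_real c)).
  by rewrite ler_pXn2r ?nnegrE // ltW.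
apply: opnorm_le => v; apply: vnorm_le; first by rewrite mulr_ge0 ?vnorm_ge0 // ltW.
rewrite exprMn sqr_vnorm mulrDr.
case: hM => -[_ ->]; rewrite !mul2mxE !mx2E !mul0r ?addr0 ?add0r.
  by apply: lerD; exact: sq.
by rewrite [leRHS]addrC; apply: lerD; apply: sq; rewrite ?normrN.
Qed.

Lemma frame_coef_le c s : `|frame c s| <= n%:R * (e0 * (g ^+ 2) ^+ n).
Proof.
have g2 : 1 <= g ^+ 2 by rewrite exprn_ege1 // ltW.
rewrite /frame_coef; apply: le_trans (ler_norm_sum _ _ _) _.
apply: le_trans (_ : \sum_(c - n <= a < c) e0 * (g ^+ 2) ^+ n <= _).
  rewrite !big_nat; apply: ler_sum => a /andP[ac1 ac2]; rewrite /run_term.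
  have B0 : 0 <= e0 * (g ^+ 2) ^+ n.
    by rewrite mulr_ge0 ?(ltW e00) // exprn_ge0 // (le_trans ler01).
  case: ifP => _; last by rewrite normr0.
  have w0 : 0 < wt a c s by exact: weight_gt0.
  rewrite !normrM (gtr0_norm e00) (gtr0_norm w0).
  have -> : `|if start T a s && (a + T < c)%N then -1 else 1 : R| = 1.
    by case: ifP; rewrite ?normrN normr1.
  rewrite mul1r ler_wpM2l ?(ltW e00) //; have w1 : wt a c s <= (g ^+ 2) ^+ (c - a) by exact: weight_le.
  apply: le_trans w1 _; apply: ler_weXn2l => //.
  by rewrite leq_subLR addnC -leq_subLR.
rewrite sumr_const_nat -[leLHS]mulr_natl; apply: ler_wpM2r; last first.
  by rewrite ler_nat leq_subLR addnC -leq_subLR.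
by rewrite mulr_ge0 ?(ltW e00) // exprn_ge0 // (le_trans ler01).
Qed.

Lemma opnorm_low_mx (t : R) : opnorm (low_mx t) <= 2 + `|t|.
Proof.
apply: le_trans (opnorm_le_mx1norm _) _.
by rewrite /mx1norm /low_mx !mx2E normr1 normr0; lra.
Qed.

Lemma lnop_good N s : (forall i, (i < N)%N -> ~~ bad (J + i) s) ->
  (forall s, \det (Lp 1 J s) = 1) ->
  lnop (Lp 1 J) N s <= `|Yof (path N s)| + 2 * ln (2 + n%:R * (e0 * (g ^+ 2) ^+ n)).
Proof.
move=> hb hdet; set F := n%:R * _.
have F0 : 0 <= F by apply: le_trans (frame_coef_le 0 s); exact: normr_ge0.
have F2 : 0 < 2 + F by rewrite ltr_wpDr.
have hc : coc (Lp 1 J) N s = low_mx (frame (J + N) s) *m mono N s *m low_mx (- frame J s).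
  have hl t : low_mx t *m low_mx (- t) = 1%:M :> 'M[R]_2.
    by rewrite /low_mx mulmx2; apply: mx2P; rewrite mx2E !mxE /=; ring.
  by rewrite -coc_frame // -mulmxA hl mulmx1.
have h1 : opnorm (coc (Lp 1 J) N s) <= (2 + F) * expR `|Yof (path N s)| * (2 + F).
  rewrite hc; apply: le_trans (opnormM _ _) _; apply: ler_pM; rewrite ?opnorm_ge0 //.
    apply: le_trans (opnormM _ _) _; apply: ler_pM; rewrite ?opnorm_ge0 //.
      by apply: le_trans (opnorm_low_mx _) _; rewrite lerD2l frame_coef_le.
    exact: opnorm_mrel (mono_path N s).
  by apply: le_trans (opnorm_low_mx _) _; rewrite normrN lerD2l frame_coef_le.
have o0 : 0 < opnorm (coc (Lp 1 J) N s) by exact: opnorm_coc_gt0.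
apply: le_trans (_ : ln ((2 + F) * expR `|Yof (path N s)| * (2 + F)) <= _).
  by rewrite ler_ln // posrE !mulr_gt0 // expR_gt0.
have E0 := expR_gt0 `|Yof (path N s)|.
rewrite lnM ?posrE ?mulr_gt0 // lnM ?posrE // expRK.
by rewrite mulr2n mulrDl mul1r addrCA addrA.
Qed.

End Monomial.

(** * Probability of bad words *)

Lemma prod_window (R : realType) (F : nat -> R) m a b : (a <= b)%N -> (b <= m)%N ->
  \prod_(j < m) (if (a <= j < b)%N then F j else 1) = \prod_(a <= j < b) F j.
Proof.
move=> ab bm; rewrite -(big_mkord xpredT (fun j => if (a <= j < b)%N then F j else 1)).
rewrite (@big_cat_nat _ _ _ a) //=; last exact: leq_trans bm.
rewrite (@big_cat_nat _ _ _ b a) //= !big_nat big1 ?mul1r; last first.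
  by move=> j /= ja; rewrite leqNgt ja.
rewrite [X in _ * X]big1 ?mulr1; last first.
  by move=> j /= /andP[bj _]; rewrite [(j < b)%N]ltnNge bj andbF.
by apply: eq_bigr => j ->.
Qed.

Lemma prod_interval (R : realType) (q : R) m a l : (a + l <= m)%N ->
  \prod_(j < m) (if (a <= j < a + l)%N then q else 1) = q ^+ l.
Proof.
by move=> alm; rewrite (prod_window (fun=> q)) ?leq_addr // prodr_const_nat addKn.
Qed.

Lemma powR_prod (R : realType) (z : R) (F : nat -> R) a b : (forall j, 0 <= F j) ->
  \prod_(a <= j < b) (F j) `^ z = (\prod_(a <= j < b) F j) `^ z.
Proof.
move=> F0; elim: b => [|b IH]; first by rewrite !big_geq // powR1.
have [ab|ba] := leqP a b; last by rewrite !big_geq // powR1.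
by rewrite !big_nat_recr //= IH powRM // prodr_ge0.
Qed.

Section Probability.
Variables (R : realType) (p : R).
Hypotheses (p0 : 0 <= p) (p1 : p <= 1).

Lemma Ew_indicator_le m (P : (nat -> bool) -> bool) (f : nat -> bool -> R) :
  (forall j b, 0 <= f j b) -> (forall s, P s -> 1 <= \prod_(j < m) f j (s j)) ->
  Ew p m (fun s => (P s)%:R) <= \prod_(j < m) (p * f j true + (1 - p) * f j false).
Proof.
move=> f0 hP; rewrite -Ew_prod; apply: le_Ew => // s.
by case: (boolP (P s)) => [/hP//|_]; apply: prodr_ge0.
Qed.

Lemma Ew_word_le m (P : (nat -> bool) -> bool) b a l : (a + l <= m)%N ->
  (forall s, P s -> forall j, (a <= j < a + l)%N -> s j = b) ->
  Ew p m (fun s => (P s)%:R) <= (if b then p else 1 - p) ^+ l.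
Proof.
move=> alm hP; rewrite -(prod_interval _ alm).
apply: le_trans (Ew_indicator_le (f := fun j c =>
  if (a <= j < a + l)%N then (c == b)%:R else 1) _ _) _.
- by move=> j c; case: ifP.
- move=> s /hP hs; rewrite big1 // => j _; case: ifP => // /hs ->; by rewrite eqxx.
apply: ler_prod => j _; case: ifP => _; last by rewrite !mulr1 addrC subrK lexx ler01.
by case: (b); rewrite /= ?mulr1 ?mulr0 ?addr0 ?add0r lexx ?p0 ?subr_ge0 ?p1.
Qed.

Lemma Ew_words2_le m (P : (nat -> bool) -> bool) a l a' l' : (a + l <= a')%N -> (a' + l' <= m)%N ->
  (forall s, P s -> (forall j, (a <= j < a + l)%N -> s j = false) /\
     forall j, (a' <= j < a' + l')%N -> s j = false) ->
  Ew p m (fun s => (P s)%:R) <= (1 - p) ^+ (l + l').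
Proof.
move=> al alm hP; rewrite exprD -(@prod_interval _ _ m a) -?(@prod_interval _ _ m a' l') //; last by lia.
rewrite -big_split /=; apply: le_trans (Ew_indicator_le (f := fun j c =>
  if (a <= j < a + l)%N || (a' <= j < a' + l')%N then (~~ c)%:R else 1) _ _) _.
- by move=> j c; case: ifP.
- move=> s /hP[h1 h2]; rewrite big1 // => j _; case: ifP => // /orP[/h1|/h2] ->//.
apply: ler_prod => j _; case: ifP => /= [h|/norP[]].
  rewrite mulr0 mulr1 add0r subr_ge0 p1 /=; case: (boolP (a <= j < a + l)%N) h => [h1 _|_ /= ->].
    have -> : (a' <= j < a' + l')%N = false by move: h1 al; clear; lia.
    by rewrite mulr1.
  by rewrite mul1r.
by move=> /negbTE -> /negbTE ->; rewrite !mulr1 addrC subrK lexx ler01.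
Qed.

End Probability.

Section Average.
Variables (R : realType) (p g e0 eta y z : R) (rho T n m J : nat).
Hypotheses (g1 : 1 < g) (e00 : 0 < e0) (rho3 : (3 <= rho)%N) (rhoT : (rho <= T)%N) (Tn : (T < n)%N)
  (nJ : (n < J)%N) (mJ : (m + 2 <= J)%N)
  (p0 : 0 < p) (p1 : p < 1) (p2 : 1 <= 2 * p) (y0 : 0 < y) (z0 : 0 < z).

Let cut := (y ^+ n)^-1.
Notation Lw := (perturbed g e0 eta cut rho T n m 1 J).
Notation badJ := (bad_word g cut rho T n m J).

(* Chernoff bound: an exponential moment of order z for the logarithm of the weight. *)
Definition rate := p * (y * q2 g true) `^ z + (1 - p) * (y * q2 g false) `^ z.

Lemma Ew_atypical : Ew p (J + J).+1 (fun s => (cut < weight g (J - n) J s)%R%:R) <= rate ^+ n.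
Proof.
have hq b : 0 < y * q2 g b by rewrite mulr_gt0 // q2_gt0.
have p0' := ltW p0; have p1' := ltW p1.
have hJ : (J - n + n <= (J + J).+1)%N by rewrite subnK ?(ltnW nJ) // leqW // leq_addr.
have -> : rate ^+ n = \prod_(j < (J + J).+1) (if (J - n <= j < J - n + n)%N then rate else 1).
  by rewrite prod_interval.
have <- : \prod_(j < (J + J).+1)
   (p * (if (J - n <= j < J - n + n)%N then (y * q2 g true) `^ z else 1) +
    (1 - p) * (if (J - n <= j < J - n + n)%N then (y * q2 g false) `^ z else 1)) =
   \prod_(j < (J + J).+1) (if (J - n <= j < J - n + n)%N then rate else 1).
  by apply: eq_bigr => j _; case: ifP => // _; rewrite !mulr1 addrC subrK.
apply: (Ew_indicator_le p0' p1' (f := fun j b =>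
  if (J - n <= j < J - n + n)%N then (y * q2 g b) `^ z else 1)).
  by move=> j b; case: ifP => // _; exact: powR_ge0.
move=> s hs.
rewrite (prod_window (fun j => (y * q2 g (s j)) `^ z)) ?leq_addr // subnK ?(ltnW nJ) //.
rewrite powR_prod; last by move=> j; exact: ltW.
have e1 : 1 `^ z = 1 :> R by rewrite powR1.
rewrite -[leLHS]e1 ge0_ler_powR ?nnegrE ?(ltW z0) //; first by apply: prodr_ge0 => j _; exact: ltW.
rewrite big_split /= prodr_const_nat subKn ?(ltnW nJ) //.
by rewrite -ler_pdivrMl ?exprn_gt0 // mulr1 ltW.
Qed.

Lemma Ew_bad_word : Ew p (J + J).+1 (fun s => (badJ s)%:R) <=
  rate ^+ n + n%:R * (1 - p) ^+ (rho + T) + 2 * p ^+ m.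
Proof.
have p0' := ltW p0; have p1' := ltW p1.
have hl zz : Ew p (J + J).+1 (fun s => (lone m zz J s)%:R) <= p ^+ m.
  apply: (@Ew_word_le _ p p0' p1' _ _ true (J - m)) => [|s]; first by lia.
  by case/and3P => /blockP.
have hf a : (a < J - T)%N ->
   Ew p (J + J).+1 (fun s => (start T (J - T) s && start rho a s)%:R) <= (1 - p) ^+ (rho + T).
  move=> aJ; have [h|h] := leqP (a + rho) (J - T).
    apply: (@Ew_words2_le _ p p0' p1' _ _ a _ (J - T)) => [//||s]; first by lia.
    by case/andP => /startP[_ h1] /startP[_ h2].
  rewrite (@eq_Ew _ _ _ _ (fun=> 0)) ?Ew_cst ?exprn_ge0 ?subr_ge0 // => s.
  case: andP => // -[/startP[h1 _] /startP[_ h2]].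
  have hr : (a <= (J - T).-1 < a + rho)%N by move: aJ h; clear; lia.
  by rewrite (h2 _ hr) in h1.
apply: le_trans (_ : Ew p (J + J).+1 (fun s => (cut < weight g (J - n) J s)%R%:R +
   \sum_(J - n <= a < J - T) (start T (J - T) s && start rho a s)%:R +
   ((lone m 1 J s)%:R + (lone m 2 J s)%:R)) <= _).
  apply: le_Ew => // s; rewrite /bad_word.
  have gen (b0 b1 b2 b3 b4 : bool) (S : R) : 0 <= S -> (b2 -> 1 <= S) ->
      [|| b0 && b1, b2, b3 | b4]%:R <= b1%:R + S + (b3%:R + b4%:R) :> R.
    move=> S0 hS; case: b0 b1 b2 hS b3 b4 => -[] [] hS [] [] /=; try lra;
      by have := hS isT; lra.
  apply: gen; first by rewrite big_nat; apply: sumr_ge0.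
  case/andP => hT /hasP[a ha hs].
  rewrite (bigD1_seq a) ?iota_uniq //= hT hs lerDl; exact: sumr_ge0.
rewrite !EwD Ew_sum; apply: lerD; last by rewrite mulr_natl; exact: lerD.
apply: lerD; first exact: Ew_atypical.
apply: le_trans (_ : \sum_(J - n <= a < J - T) (1 - p) ^+ (rho + T) <= _).
  by rewrite !big_nat; apply: ler_sum => a /andP[_ aJ]; exact: hf.
rewrite sumr_const_nat -[leLHS]mulr_natl ler_wpM2r ?exprn_ge0 ?subr_ge0 // ler_nat; lia.
Qed.

Lemma avg_small k B kappa Lam : 0 < kappa -> (0 < k)%N -> (0 < B)%N ->
  1 <= swap_ratio g e0 T -> 1 <= Lam -> (forall s, \det (Lw s) = 1) -> (forall s, opnorm (Lw s) <= Lam) ->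
  128 * (ln g + ln (swap_ratio g e0 T)) ^+ 2 <= kappa ^+ 2 * k%:R ->
  512 * potmax p T (ln g) (ln (swap_ratio g e0 T)) * (ln g + ln (swap_ratio g e0 T)) <= kappa ^+ 2 * B%:R ->
  avg p (J + J) Lw (k * B) <= (k * B)%:R * kappa / 8
   + 2 * ln (2 + n%:R * (e0 * (g ^+ 2) ^+ n))
   + (k * B)%:R * ln Lam * ((k * B)%:R *
      (rate ^+ n + n%:R * (1 - p) ^+ (rho + T) + 2 * p ^+ m)).
Proof.
move=> kp k0 B0 tau1 Lam1 hdet hLam hk hB; set N := (k * B)%N.
have p0' := ltW p0; have p1' := ltW p1.
pose Yp s := Yof (steps T (ln g) (ln (swap_ratio g e0 T)) N (0, 1, run T J s) (shiftn J s)).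
set CC := 2 * ln _.
have CC0 : 0 <= CC.
  rewrite mulr_ge0 // ln_ge0 //; rewrite -[leLHS]addr0 lerD ?ler1n //.
  by rewrite !mulr_ge0 ?(ltW e00) // !exprn_ge0 // ltW // (lt_trans ltr01).
have lL := ln_ge0 Lam1.
apply: le_trans (_ : Ew p (N + (J + J)) (fun s => `|Yp s| + CC +
   N%:R * ln Lam * \sum_(i < N) (badJ (shiftn i s))%:R) <= _).
  apply: le_Ew => // s.
  case: (boolP [forall i : 'I_N, ~~ bad_word g cut rho T n m (J + i) s]) => [/forallP h|].
    apply: le_trans (lnop_good g1 e00 rho3 rhoT Tn nJ mJ _ hdet) _.
      by move=> i iN; exact: (h (Ordinal iN)).
    by rewrite lerDl mulr_ge0 // ?mulr_ge0 // sumr_ge0.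
  rewrite negb_forall => /existsP[i]; rewrite negbK => hi.
  apply: le_trans (lnop_le hdet Lam1 hLam _ _) _.
  rewrite -[leLHS]add0r lerD ?addr_ge0 // ler_peMr ?mulr_ge0 //.
  have hi' : badJ (shiftn i s) by rewrite bad_word_shift ?(leq_trans (leq_addr 2 m)) // addnC.
  by rewrite (bigD1 i) //= hi' lerDl sumr_ge0.
rewrite !EwD EwZ Ew_sum Ew_cst; apply: lerD; last first.
  rewrite ler_wpM2l ?mulr_ge0 //.
  apply: le_trans (_ : \sum_(i < N) Ew p (J + J).+1 (fun s => (badJ s)%:R) <= _).
    apply: ler_sum => i _.
    have hd : dep (J + J).+1 badJ by exact: dep_bad_word.
    have hd' : dep (i + (J + J).+1) (fun s => (badJ (shiftn i s))%:R : R).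
      by move=> s s' h; rewrite (@dep_shift _ _ i _ hd s s' h).
    rewrite -[leRHS](Ew_shift p (J + J).+1 i) (Ew_dep p hd') //.
    by rewrite addnS -addSn leq_add2r.
  by rewrite sumr_const card_ord -[leLHS]mulr_natl ler_wpM2l // Ew_bad_word.
rewrite lerD2r addnCA Ew_put -(Ew_cst p J (_ / 8)); apply: le_Ew => // w.
have -> : Ew p (N + J) (fun u => `|Yp (put J w u)|) =
   Ew p N (fun u => `|Yof (steps T (ln g) (ln (swap_ratio g e0 T)) N (0, 1, run T J w) u)|).
  rewrite -(@Ew_dep _ p N (N + J)) ?leq_addr //.
    apply: eq_Ew => u; rewrite /Yp shiftn_put (@dep_run T J (put J w u) w) //.
    by move=> i iJ; rewrite /put iJ.
  by move=> s s' h; rewrite (@dep_steps _ T (ln g) (ln (swap_ratio g e0 T)) N _ s s').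
apply: (@Ew_norm_Yof _ p p0 p1 p2 T (ln g) (ln (swap_ratio g e0 T))) => //.
- by rewrite ln_ge0 // ltW.
- exact: ln_ge0.
- by rewrite normr1.
Qed.

End Average.

(** * Bounds, positivity and spreading *)

Definition hole (q z : nat) : nat -> bool := fun t => ~~ (q <= t < q + z)%N.

Lemma start_hole l a q z : (3 <= l)%N -> (z <= 2)%N -> start l a (hole q z) = false.
Proof.
move=> l3 z2; apply/negP => /startP[_ h]; rewrite /hole in h.
have h0 := h a; have h2 := h a.+2; move: h0 h2 => /(_ _)/negbFE h0 /(_ _)/negbFE h2.
have {}h0 : (q <= a < q + z)%N by apply: h0; move: l3; clear; lia.
have {}h2 : (q <= a.+2 < q + z)%N by apply: h2; move: l3; clear; lia.
by move: h0 h2 z2; clear; lia.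
Qed.

Lemma lone_hole m z z' c q : (0 < m)%N -> (0 < z)%N -> (z <= 2)%N -> (0 < z')%N -> (z' <= 2)%N ->
  (m <= c)%N -> lone m z' c (hole q z) = (c == q) && (z' == z).
Proof.
move=> m0 z0 z2 z0' z2' mc; have c0 : (0 < c)%N by exact: leq_trans mc.
apply/and3P/andP => [[/blockP h1 /blockP h2 /blockP h3]|[/eqP <- /eqP <-]].
  have e2 : (q <= c < q + z)%N.
    by apply: negbFE; apply: h2; move: z0'; clear; lia.
  have e1 : (q <= c.-1 < q + z)%N = false.
    by apply: negbTE; apply: h1; move: m0 c0; clear; lia.
  have cq : c = q by move: e2 e1 z2 c0; clear; lia.
  split; rewrite ?cq //; apply/eqP.
  have e3 : (q <= c + z' < q + z)%N = false.
    by apply: negbTE; apply: h3; move: m0; clear; lia.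
  have e4 : (1 < z')%N -> (q <= c + 1 < q + z)%N.
    by move=> z1; apply: negbFE; apply: h2; move: z1; clear; lia.
  by move: e3 e4 cq z0 z2 z0' z2'; clear; lia.
split; apply/blockP => j jq; rewrite /hole; move: jq mc; clear; lia.
Qed.

Section Bounds.
Variables (R : realType) (g e0 eta cut : R) (rho T n m J : nat).
Hypotheses (g1 : 1 < g) (e00 : 0 < e0) (eta0 : 0 < eta) (cut0 : 0 <= cut) (cut1 : cut <= 1)
  (rho3 : (3 <= rho)%N) (rhoT : (rho <= T)%N) (Tn : (T < n)%N) (m0 : (0 < m)%N)
  (nJ : (n < J)%N) (mJ : (m + 2 <= J)%N)
  (small1 : 2 * e0 + eta <= 1) (small2 : (swap_ratio g e0 T)^-1 + eta <= 1).

Notation Lp := (perturbed g e0 eta cut rho T n m).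
Notation lo := (lower_shear g e0 eta cut rho T n m).
Notation up := (upper_shear g e0 eta T m).

Lemma run_term_le a c s : `|run_term g e0 rho T a c s| <= e0 * weight g a c s.
Proof.
have w0 : 0 < weight g a c s by exact: weight_gt0.
rewrite /run_term; case: ifP => _; last by rewrite normr0 mulr_ge0 // ltW.
by rewrite !normrM (gtr0_norm e00) (gtr0_norm w0); case: ifP => _; rewrite ?normrN normr1 mul1r.
Qed.

Lemma res_le c s : `|res g e0 cut rho T n c s| <= e0 * cut.
Proof.
rewrite /res; case: ifP => h; last by rewrite normr0 mulr_ge0 // ltW.
by apply: le_trans (run_term_le _ _ _) _; rewrite ler_pM2l.
Qed.

Let b01 (b : bool) : 0 <= (b%:R : R) <= 1.
Proof. by case: b; rewrite /= ?ler01 ?lexx. Qed.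

Lemma drift_le c s : `|(start rho c s)%:R * e0 - res g e0 cut rho T n c s| <= 2 * e0.
Proof.
have h1 := res_le c s; have h2 : e0 * cut <= e0 by rewrite ler_piMr // ltW.
have /andP[b0 b1] := b01 (start rho c s).
apply: le_trans (ler_normB _ _) _; rewrite normrM (gtr0_norm e00) (ger0_norm b0).
have : (start rho c s)%:R * e0 <= e0 by rewrite ler_piMl // ltW.
lra.
Qed.

Lemma lower_shear_le x c s : 0 <= x <= 1 -> `|lo x c s| <= 1.
Proof.
move=> /andP[x0 x1]; rewrite /lower_shear; apply: le_trans (ler_normD _ _) _.
have /andP[b0 b1] := b01 (lone m 2 c s).
rewrite !normrM (ger0_norm x0) (gtr0_norm eta0) (ger0_norm b0).
have h1 := drift_le c s.
have h2 : x * `|(start rho c s)%:R * e0 - res g e0 cut rho T n c s| <= 2 * e0.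
  by apply: le_trans h1; rewrite ler_piMl.
have h3 : eta * (lone m 2 c s)%:R <= eta by rewrite ler_piMr // ltW.
exact: le_trans (lerD h2 h3) small1.
Qed.

Lemma upper_shear_le x c s : 0 <= x <= 1 -> `|up x c s| <= 1.
Proof.
move=> /andP[x0 x1]; rewrite /upper_shear; apply: le_trans (ler_normD _ _) _.
have /andP[b0 b1] := b01 (lone m 1 c s); have /andP[b0' b1'] := b01 (start T (c - T) s).
have t0 : 0 < (swap_ratio g e0 T)^-1 by rewrite invr_gt0; exact: swap_ratio_gt0.
rewrite !normrM normrN normrM (ger0_norm x0) (gtr0_norm t0) (gtr0_norm eta0) (ger0_norm b0) (ger0_norm b0').
have h2 : x / swap_ratio g e0 T * (start T (c - T) s)%:R <= (swap_ratio g e0 T)^-1.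
  apply: le_trans (_ : x / swap_ratio g e0 T <= _); first by rewrite ler_piMr // mulr_ge0 // ltW.
  by rewrite ler_piMl // ltW.
have h3 : eta * (lone m 1 c s)%:R <= eta by rewrite ler_piMr // ltW.
exact: le_trans (lerD h2 h3) small2.
Qed.

Lemma lower_shear_lip x y c s : `|lo x c s - lo y c s| <= `|x - y|.
Proof.
rewrite /lower_shear opprD addrACA subrr addr0 -mulrBl normrM ler_piMr //.
apply: le_trans (drift_le c s) _; move: small1 eta0; lra.
Qed.

Lemma upper_shear_lip x y c s : `|up x c s - up y c s| <= `|x - y|.
Proof.
have t0 : 0 < (swap_ratio g e0 T)^-1 by rewrite invr_gt0; exact: swap_ratio_gt0.
have /andP[b0 b1] := b01 (start T (c - T) s).
rewrite /upper_shear opprD addrACA subrr addr0 -mulrBl normrM (ger0_norm b0).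
have -> : - (x / swap_ratio g e0 T) - - (y / swap_ratio g e0 T) = - ((x - y) / swap_ratio g e0 T) by ring.
rewrite normrN normrM (gtr0_norm t0); apply: le_trans (_ : `|x - y| / swap_ratio g e0 T <= _).
  by rewrite ler_piMr // mulr_ge0 // ltW.
rewrite ler_piMr //; move: small2 eta0; lra.
Qed.

Lemma det_perturbed x c s : \det (Lp x c s) = 1.
Proof.
have d0 : dg g (s c) != 0 by rewrite gt_eqF //; exact: dg_gt0.
by rewrite det2E /perturbed !mx2E; field.
Qed.

Lemma dg_le b : dg g b <= g /\ (dg g b)^-1 <= g.
Proof.
have gi : g^-1 <= g.
  by apply: (@le_trans _ _ 1); rewrite ?ltW // invf_lt1 // (lt_trans ltr01).
by case: b; rewrite /= ?invrK; split.
Qed.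

Lemma mx1norm_le (a ai l u : R) : 0 < a -> 0 < ai -> a <= g -> ai <= g -> `|l| <= 1 -> `|u| <= 1 ->
  (mx1norm (mx2 a (a * u) (l * ai) ((1 + l * u) * ai)) <= 5 * g) *
  (mx1norm (mx2 ((1 + l * u) * ai) (- (a * u)) (- (l * ai)) a) <= 5 * g).
Proof.
move=> ap aip ag aig l1 u1; rewrite /mx1norm !mx2E !normrN !normrM (gtr0_norm ap) (gtr0_norm aip).
have g0 : 0 < g by exact: g_gt0.
have h1 : a * `|u| <= g by rewrite -[g]mulr1 ler_pM // ltW.
have h2 : `|l| * ai <= g by rewrite -[g]mul1r ler_pM // ltW.
have h3 : `|1 + l * u| * ai <= 2 * g.
  rewrite ler_pM ?(ltW aip) //; apply: le_trans (ler_normD _ _) _.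
  have hlu : `|l| * `|u| <= 1 * 1 by rewrite ler_pM.
  by rewrite normr1 normrM; lra.
split; lra.
Qed.

Lemma opnorm_perturbed x c s : 0 <= x <= 1 -> opnorm (Lp x c s) <= 5 * g.
Proof.
move=> hx; apply: le_trans (opnorm_le_mx1norm _) _.
have [h1 h2] := dg_le (s c); have d0 : 0 < dg g (s c) by exact: dg_gt0.
have d0' : 0 < (dg g (s c))^-1 by rewrite invr_gt0.
by have [] := mx1norm_le d0 d0' h1 h2 (lower_shear_le c s hx) (upper_shear_le c s hx).
Qed.

Lemma vnorm_perturbed x c s v : 0 <= x <= 1 -> vnorm v <= 5 * g * vnorm (Lp x c s *m v).
Proof.
move=> hx; set a := dg g (s c); set l := lo x c s; set u := up x c s.
have d0 : 0 < a by exact: dg_gt0.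
have d0' : 0 < a^-1 by rewrite invr_gt0.
have [h1 h2] := dg_le (s c).
have E : mx2 ((1 + l * u) * a^-1) (- (a * u)) (- (l * a^-1)) a *m Lp x c s = 1%:M.
  rewrite /perturbed -/a -/l -/u mulmx2; apply: mx2P; rewrite mx2E !mxE /=; field; by rewrite gt_eqF.
rewrite -{1}(mul1mx v) -E -mulmxA; apply: le_trans (le_opnorm _ _) _.
rewrite ler_wpM2r ?vnorm_ge0 //; apply: le_trans (opnorm_le_mx1norm _) _.
by have [] := mx1norm_le d0 d0' h1 h2 (lower_shear_le c s hx) (upper_shear_le c s hx).
Qed.

Lemma perturbed_lip x y c s : 0 <= x <= 1 -> 0 <= y <= 1 ->
  opnorm (Lp x c s - Lp y c s) <= 4 * g * `|x - y|.
Proof.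
move=> hx hy; apply: le_trans (opnorm_le_mx1norm _) _.
have hl := lower_shear_lip x y c s; have hu := upper_shear_lip x y c s.
have ly := lower_shear_le c s hy; have ux := upper_shear_le c s hx.
have [ag aig] := dg_le (s c); have d0 : 0 < dg g (s c) by exact: dg_gt0.
rewrite /perturbed; move: (dg g (s c)) ag aig d0 (lo x c s) (lo y c s) (up x c s) (up y c s) hl hu ly ux.
move=> a ag aig a0 l l' u u' hl hu ly ux; set d := `|x - y| in hl hu *.
have d0 : 0 <= d by rewrite normr_ge0.
rewrite /mx1norm !mxE /=.
have -> : a - a = 0 by rewrite subrr.
have -> : a * u - a * u' = a * (u - u') by rewrite mulrBr.
have -> : l / a - l' / a = (l - l') / a by rewrite mulrBl.
have -> : (1 + l * u) / a - (1 + l' * u') / a = ((l - l') * u + l' * (u - u')) / a by ring.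
have ai0 : 0 < a^-1 by rewrite invr_gt0.
rewrite normr0 add0r !normrM (gtr0_norm a0) (gtr0_norm ai0).
have h1 : a * `|u - u'| <= g * d by rewrite ler_pM // ltW.
have h2 : `|l - l'| / a <= d * g by rewrite ler_pM // ltW.
have h3 : `|(l - l') * u + l' * (u - u')| / a <= (2 * d) * g.
  rewrite ler_pM ?(ltW ai0) //; apply: le_trans (ler_normD _ _) _; rewrite !normrM.
  have : `|l - l'| * `|u| <= d * 1 by rewrite ler_pM.
  have : `|l'| * `|u - u'| <= 1 * d by rewrite ler_pM.
  lra.
lra.
Qed.

(* At x = 0 all the entries are nonnegative, so the upper left entry of a product is at
   least the product of the upper left entries. *)
Lemma coc_pos N s : let M := coc (Lp 0 J) N s in
  [/\ \prod_(i < N) dg g (s (J + i)%N) <= M 0 0, 0 <= M 0 1, 0 <= M 1 0 & 0 <= M 1 1].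
Proof.
elim: N => [|N] /=; first by rewrite big_ord0 !mxE /= ler01 lexx.
set M := coc _ N s; set P := \prod_(i < N) _; move=> [h1 h2 h3 h4].
have P0 : 0 < P by apply: prodr_gt0 => i _; exact: dg_gt0.
have h1' : 0 <= M 0 0 by apply: le_trans h1; exact: ltW.
rewrite big_ord_recr /= -/P; set s' := shiftn N s.
have sJ : s' J = s (J + N)%N by rewrite /s' /shiftn addnC.
have a0 : 0 < dg g (s (J + N)%N) by exact: dg_gt0.
have l0 : 0 <= lo 0 J s' by rewrite /lower_shear mul0r add0r mulr_ge0 // ltW.
have u0 : 0 <= up 0 J s' by rewrite /upper_shear mul0r oppr0 mul0r add0r mulr_ge0 // ltW.
rewrite /perturbed sJ; move: (dg g (s (J + N)%N)) (lo 0 J s') (up 0 J s') a0 l0 u0 => a l u a0 l0 u0.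
have ai : 0 <= a^-1 by rewrite invr_ge0 ltW.
have au : 0 <= a * u by rewrite mulr_ge0 // ltW.
have la : 0 <= l / a by rewrite mulr_ge0.
have lua : 0 <= (1 + l * u) / a by rewrite mulr_ge0 // addr_ge0 // mulr_ge0.
rewrite !mul2E !mx2E; split.
- rewrite mulrC; apply: le_trans (_ : a * M 0 0 <= _); first by rewrite ler_pM2l.
  by rewrite lerDl mulr_ge0.
- by rewrite addr_ge0 // mulr_ge0 // ltW.
- by rewrite addr_ge0 // mulr_ge0.
- by rewrite addr_ge0 // mulr_ge0.
Qed.

Lemma lam_unperturbed_ge p : 0 <= p <= 1 -> (2 * p - 1) * ln g <= lam p (J + J) (Lp 0 J).
Proof.
move=> /andP[p0 p1]; apply: lam_geP => N; rewrite /avg.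
have -> : N.+1%:R * ((2 * p - 1) * ln g) =
   Ew p (N.+1 + (J + J)) (fun s => \sum_(i < N.+1) ln (dg g (s (J + i)%N))).
  rewrite Ew_sum (eq_bigr (fun=> (2 * p - 1) * ln g)) ?sumr_const ?card_ord ?mulr_natl // => i _.
  have d1 : dep 1 (fun s => ln (dg g (s 0%N))) by move=> s s' h; rewrite h.
  have d2 : dep (J + i + 1) (fun s => ln (dg g (s (J + i)%N))) by move=> s s' h; rewrite h // addn1.
  rewrite (Ew_dep p d2); last by have := ltn_ord i; lia.
  rewrite (eq_Ew p _ (G := fun s => ln (dg g (shiftn (J + i) s 0%N)))); last first.
    by move=> s; rewrite /shiftn addn0.
  rewrite (Ew_shift p 1 (J + i) (fun s => ln (dg g (s 0%N)))) /=.
  by rewrite lnV ?posrE ?(lt_trans ltr01) //; ring.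
apply: le_Ew => // s; have [h _ _ _] := coc_pos N.+1 s.
have -> : \sum_(i < N.+1) ln (dg g (s (J + i)%N)) = ln (\prod_(i < N.+1) dg g (s (J + i)%N)).
  elim: (N.+1) => [|N' IH]; first by rewrite !big_ord0 ln1.
  rewrite !big_ord_recr /= IH lnM ?posrE //; last exact: dg_gt0.
  by apply: prodr_gt0 => i _; exact: dg_gt0.
have P0 : 0 < \prod_(i < N.+1) dg g (s (J + i)%N) by apply: prodr_gt0 => i _; exact: dg_gt0.
have hM : \prod_(i < N.+1) dg g (s (J + i)%N) <= opnorm (coc (Lp 0 J) N.+1 s).
  by apply: le_trans h _; apply: le_trans (ler_norm _) (opnorm_ge00 _).
by rewrite /lnop ler_ln // posrE // (lt_le_trans P0).
Qed.

End Bounds.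

Lemma Ew_agree_hole (R : realType) (p : R) k q z : p != 0 -> (q + z <= k)%N ->
  Ew p k (fun u => (agree k (hole q z) u)%:R) = p ^+ k * ((1 - p) / p) ^+ z.
Proof.
move=> p0 qk; rewrite (eq_Ew p k (G := fun u => \prod_(t < k) (u t == hole q z t)%:R)); last first.
  move=> u; case: (boolP (agree k (hole q z) u)) => [/agreeP h|].
    by rewrite big1 // => t _; rewrite h ?eqxx.
  by rewrite negb_forall => /existsP[t /negbTE ht]; rewrite (bigD1 t) //= ht mul0r.
rewrite (Ew_prod p k (fun t b => (b == hole q z t)%:R)).
rewrite -(@prod_interval _ _ k q z qk).
have -> : p ^+ k = \prod_(t < k) p by rewrite prodr_const card_ord.
rewrite -big_split /=; apply: eq_bigr => t _; rewrite /hole.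
by case: (q <= t < q + z)%N => /=; field.
Qed.

Lemma hole_disagree k q q' z : (0 < z)%N -> q != q' -> (q + z <= k)%N -> (q' + z <= k)%N ->
  ~ agree k (hole q z) (hole q' z).
Proof.
move=> z0 qq' qk qk' /agreeP h; have [lt|lt] := ltnP q q'.
  have qk0 : (q < k)%N by move: z0 qk; clear; lia.
  by have := h q qk0; rewrite /hole; move: lt z0; clear; lia.
have qk0 : (q' < k)%N by move: z0 qk'; clear; lia.
by have := h q' qk0; rewrite /hole; move: lt z0 qq'; clear; lia.
Qed.

Lemma pow_gap (R : realType) (h : R) a b : 1 < h -> a != b -> h - 1 <= `|h ^+ a - h ^+ b|.
Proof.
move=> h1; have key c d : (c < d)%N -> h - 1 <= h ^+ d - h ^+ c.
  move=> cd; rewrite -(subnKC (ltnW cd)) exprD -{2}[h ^+ c]mulr1 -mulrBr.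
  have hc : 1 <= h ^+ c by rewrite exprn_ege1 // ltW.
  have hd : h <= h ^+ (d - c) by rewrite ler_eXnr ?subn_gt0 // ltW.
  apply: le_trans (_ : h ^+ (d - c) - 1 <= _); first by rewrite lerD2r.
  by rewrite ler_peMl // subr_ge0; apply: le_trans hd; exact: ltW.
case: (ltngtP a b) => // ab _.
  by rewrite distrC; apply: le_trans (key _ _ ab) (ler_norm _).
by apply: le_trans (key _ _ ab) (ler_norm _).
Qed.

Section Spread.
Variables (R : realType) (g e0 eta cut : R) (rho T n m J : nat).
Hypotheses (g1 : 1 < g) (e00 : 0 < e0) (eta0 : 0 < eta) (cut0 : 0 <= cut) (cut1 : cut <= 1)
  (rho3 : (3 <= rho)%N) (rhoT : (rho <= T)%N) (Tn : (T < n)%N) (m0 : (0 < m)%N)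
  (nJ : (n < J)%N) (mJ : (m + 2 <= J)%N)
  (small1 : 2 * e0 + eta <= 1) (small2 : (swap_ratio g e0 T)^-1 + eta <= 1).

Notation Lp := (perturbed g e0 eta cut rho T n m).

Lemma perturbed_hole x q z j : (0 < z)%N -> (z <= 2)%N ->
  Lp x J (shiftn j (hole q z)) =
  let a := dg g (hole q z (j + J)%N) in
  let l := eta * ((j + J == q)%N && (2 == z)%N)%:R in
  let u := eta * ((j + J == q)%N && (1 == z)%N)%:R in
  mx2 a (a * u) (l / a) ((1 + l * u) / a).
Proof.
move=> z0 z2; have mJ' : (m <= J)%N by apply: leq_trans mJ; exact: leq_addr.
rewrite (@perturbed_shift _ g e0 eta cut rho T n m J) // /perturbed.
have T3 : (3 <= T)%N by exact: leq_trans rhoT.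
have hl z' : (0 < z')%N -> (z' <= 2)%N -> lone m z' (j + J) (hole q z) = (j + J == q)%N && (z' == z)%N.
  by move=> h1 h2; apply: lone_hole => //; apply: leq_trans mJ' _; exact: leq_addl.
have -> : lower_shear g e0 eta cut rho T n m x (j + J) (hole q z) = eta * ((j + J == q)%N && (2 == z)%N)%:R.
  rewrite /lower_shear /res /run_term !start_hole // hl //= if_same; ring.
have -> : upper_shear g e0 eta T m x (j + J) (hole q z) = eta * ((j + J == q)%N && (1 == z)%N)%:R.
  rewrite /upper_shear !start_hole // hl //=; ring.
by [].
Qed.

Let dpow j : 'M[R]_2 := mx2 (g ^+ j) 0 0 (g ^+ j)^-1.

Lemma dpowD j l : dpow (j + l) = dpow j *m dpow l.
Proof. by rewrite /dpow mulmx2 !exprD !(mul0r, mulr0) !(addr0, add0r) invfM. Qed.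

Lemma coc_ones x s N : (forall j, (j < N)%N -> Lp x J (shiftn j s) = dpow 1) ->
  coc (Lp x J) N s = dpow N.
Proof.
elim: N => [|N IH] h /=.
  by apply: mx2P; rewrite !mxE /= ?invr1.
by rewrite h // IH ?add1n -?dpowD // => j jN; apply: h; exact: ltnW.
Qed.

Lemma coc_before x q z j : (0 < z)%N -> (z <= 2)%N -> (j + J <= q)%N ->
  coc (Lp x J) j (hole q z) = dpow j.
Proof.
move=> z0 z2 jq; apply: coc_ones => i ij; rewrite perturbed_hole //.
have iq : (i + J < q)%N by apply: leq_trans jq; rewrite ltn_add2r.
have -> : (i + J == q)%N = false by rewrite ltn_eqF.
rewrite /hole leqNgt iq /= mulr0 !(mulr0, mul0r) addr0 mul1r /dpow expr1 //.
Qed.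

Lemma coc_after x q z j a : (0 < z)%N -> (z <= 2)%N -> a + J = (q + z)%N ->
  coc (Lp x J) j (shiftn a (hole q z)) = dpow j.
Proof.
move=> z0 z2 jq; apply: coc_ones => i ij; rewrite shiftnD perturbed_hole //.
have iq : (q + z <= a + i + J)%N by rewrite -jq addnAC leq_addr.
have -> : (a + i + J == q)%N = false by apply/gtn_eqF; apply: leq_trans iq; rewrite -addn1 leq_add2l.
rewrite /hole [(_ < q + z)%N]ltnNge iq andbF /= mulr0 !(mulr0, mul0r) addr0 mul1r /dpow expr1 //.
Qed.

Lemma coc_hole1 x a j :
  coc (Lp x J) (j + a.+1) (hole (a + J) 1) =
  mx2 (g ^+ (j + a) / g) (eta * g ^+ j / (g * g ^+ a)) 0 (g / g ^+ (j + a)).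
Proof.
have g0 : g != 0 by rewrite gt_eqF // (lt_trans ltr01).
have gn i : g ^+ i != 0 by rewrite expf_neq0.
rewrite cocD /= coc_before ?coc_after //; last by rewrite addn1.
rewrite perturbed_hole // eqxx /hole leqnn addn1 ltnSn /=.
rewrite /dpow !mulmx2 exprD; congr mx2; field; rewrite ?g0 ?gn //.
Qed.

Lemma coc_hole2 x a j :
  coc (Lp x J) (j + a.+2) (hole (a + J) 2) =
  mx2 (g ^+ (j + a) / g ^+ 2) 0 (eta * g ^+ 2 * g ^+ a / g ^+ j) (g ^+ 2 / g ^+ (j + a)).
Proof.
have g0 : g != 0 by rewrite gt_eqF // (lt_trans ltr01).
have gn i : g ^+ i != 0 by rewrite expf_neq0.
rewrite cocD /= coc_before ?coc_after //; last by rewrite addn2.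
rewrite !perturbed_hole // eqxx /hole leqnn addSn leqnSn addn2 !ltnS leqnn leqnSn /=.
rewrite gtn_eqF // eqxx /=.
rewrite /dpow !mulmx2 exprD; congr mx2; field; rewrite ?g0 ?gn //.
Qed.

(* A shear at time a, in a long run of ones, acts as a shear of
   size comparable to g^(-2a) or g^(2a): moving it along the run gives arbitrarily
   many words of equal probability with transversal actions. *)
Lemma cross_hole x M z (i k : 'I_M) (v : 'cV[R]_2) : (0 < z)%N -> (z <= 2)%N -> i != k ->
  eta * (g ^+ 2 - 1) / (g ^+ 2) ^+ (J + M) ^+ 2 * (if z == 1%N then v 1 0 else v 0 0) ^+ 2 <=
  `|cross (coc (Lp x J) (J + J + M + 2) (hole (J + J + i) z) *m v)
          (coc (Lp x J) (J + J + M + 2) (hole (J + J + k) z) *m v)|.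
Proof.
move=> z0 z2 ik; set N := (J + J + M + 2)%N.
pose b (i : 'I_M) := coc (Lp x J) N (hole (J + J + i) z) *m v.
rewrite -/(b i) -/(b k); have g0' : 0 < g by exact: lt_trans g1.
have g0 : g != 0 by rewrite gt_eqF.
have gn j : g ^+ j != 0 by rewrite expf_neq0.
have g2 : 1 < g ^+ 2 by rewrite exprn_egt1.
have G0 : 0 < (g ^+ 2) ^+ (J + M) ^+ 2 by rewrite !exprn_gt0.
have G1 : 1 <= (g ^+ 2) ^+ (J + M) ^+ 2 by rewrite !exprn_ege1 // ltW.
set G := (g ^+ 2) ^+ (J + M) ^+ 2 in G0 G1 *.
have gap : g ^+ 2 - 1 <= `|(g ^+ 2) ^+ (J + i) - (g ^+ 2) ^+ (J + k)|.
  by apply: pow_gap => //; rewrite eqn_add2l.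
have sqE j : (g ^+ 2) ^+ j = g ^+ j * g ^+ j by rewrite -exprM mulnC exprM expr2.
have hq (l : 'I_M) : (J + J + l = J + l + J)%N by rewrite addnAC.
case: z z0 z2 @b => [//|[|[|//]]] _ _ b /=.
- have bE (l : 'I_M) : b l = mx2 (g ^+ (N - 1) / g) (eta * g ^+ (N - 1) / (g * (g ^+ 2) ^+ (J + l))) 0
      (g / g ^+ (N - 1)) *m v.
    have lM := ltn_ord l.
    have NE : N = (N - (J + l).+1 + (J + l).+1)%N.
      by rewrite subnK // /N; move: lM; clear; lia.
    have NE1 : (N - 1 = N - (J + l).+1 + (J + l))%N by rewrite {1}NE addnS subn1.
    rewrite /b hq {1}NE coc_hole1 NE1; congr (mx2 _ _ _ _ *m _).
    by rewrite ?sqE ?exprD; field; rewrite ?g0 ?gn.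
  have -> : cross (b i) (b k) = eta * v 1 0 ^+ 2 *
      (((g ^+ 2) ^+ (J + k) - (g ^+ 2) ^+ (J + i)) / ((g ^+ 2) ^+ (J + i) * (g ^+ 2) ^+ (J + k))).
    by rewrite !bE /cross !mul2mxE !mx2E; field; rewrite ?g0 ?gn ?(expf_neq0 _ (gn 2)).
  have v0 := sqr_ge0 (v 1 0).
  have ev0 := mulr_ge0 (ltW eta0) v0; rewrite normrM (ger0_norm ev0).
  have -> : eta * (g ^+ 2 - 1) / G * v 1 0 ^+ 2 = eta * v 1 0 ^+ 2 * ((g ^+ 2 - 1) / G) by ring.
  rewrite ler_wpM2l //.
  have p0 l : 0 < (g ^+ 2) ^+ l by rewrite !exprn_gt0.
  rewrite normrM normfV (gtr0_norm (mulr_gt0 (p0 _) (p0 _))) distrC.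
  have g20 : 0 <= g ^+ 2 - 1 by rewrite subr_ge0 ltW.
  apply: ler_pM; rewrite ?invr_ge0 ?(ltW G0) //.
  rewrite lef_pV2 ?posrE ?mulr_gt0 // /G expr2.
  have le l : (l <= J + M)%N -> (g ^+ 2) ^+ l <= (g ^+ 2) ^+ (J + M).
    by move=> lJ; rewrite ler_weXn2l // ltW.
  by apply: ler_pM; rewrite ?(ltW (p0 _)) // le // leq_add2l ltnW.
- have bE (l : 'I_M) : b l = mx2 (g ^+ (N - 2) / g ^+ 2) 0
     (eta * g ^+ 2 * (g ^+ 2) ^+ (J + l) / g ^+ (N - 2)) (g ^+ 2 / g ^+ (N - 2)) *m v.
    have lM := ltn_ord l.
    have NE : N = (N - (J + l).+2 + (J + l).+2)%N.
      by rewrite subnK // /N; move: lM; clear; lia.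
    have NE1 : (N - 2 = N - (J + l).+2 + (J + l))%N by rewrite {1}NE !addnS !subSS subn0.
    rewrite /b hq {1}NE coc_hole2 NE1; congr (mx2 _ _ _ _ *m _).
    by rewrite ?sqE ?exprD; field; rewrite ?g0 ?gn.
  have -> : cross (b i) (b k) = eta * v 0 0 ^+ 2 *
      ((g ^+ 2) ^+ (J + k) - (g ^+ 2) ^+ (J + i)).
    by rewrite !bE /cross !mul2mxE !mx2E; field; rewrite ?g0 !gn.
  have v0 := sqr_ge0 (v 0 0).
  have ev0 := mulr_ge0 (ltW eta0) v0; rewrite normrM (ger0_norm ev0).
  have -> : eta * (g ^+ 2 - 1) / G * v 0 0 ^+ 2 = eta * v 0 0 ^+ 2 * ((g ^+ 2 - 1) / G) by ring.
  rewrite ler_wpM2l // distrC; apply: le_trans gap.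
  by rewrite ler_pdivrMr // ler_peMr // subr_ge0 ltW.
Qed.

Lemma spread_perturbed p x M : 0 < p -> p < 1 -> 1 <= 2 * p -> 0 <= x <= 1 -> (0 < M)%N ->
  spread p (J + J) (Lp x J) M.
Proof.
move=> p0 p1 p2 hx M0; set W := (J + J)%N; set N := (J + J + M + 2)%N; set Lam := 5 * g.
have g0' : 0 < g by exact: lt_trans g1.
have Lam1 : 1 <= Lam by rewrite /Lam; move: g1; lra.
have L0 : 0 < Lam by exact: lt_le_trans Lam1.
have g2 : 0 < g ^+ 2 - 1 by rewrite subr_gt0 exprn_egt1.
set c1 := eta * (g ^+ 2 - 1) / (g ^+ 2) ^+ (J + M) ^+ 2.
have c10 : 0 < c1 by rewrite divr_gt0 ?mulr_gt0 // !exprn_gt0.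
set c2 := c1 / 2 / (Lam ^+ W) ^+ 2.
have c20 : 0 < c2 by apply: divr_gt0; [exact: divr_gt0|rewrite !exprn_gt0].
have pr0 : 0 < (1 - p) / p by rewrite divr_gt0 // subr_gt0.
have pr1 : (1 - p) / p <= 1 by rewrite ler_pdivrMr // mul1r lerBlDr -mulr2n -mulr_natl.
have MR : 1 <= M%:R :> R by rewrite ler1n.
exists (N + W)%N, (Num.min c2 1), (p ^+ (N + W) * ((1 - p) / p) ^+ 2); split.
- by rewrite lt_min c20 ltr01.
- by rewrite ge_min lexx orbT.
- by rewrite mulr_gt0 // exprn_gt0.
move=> s v v0; pose v1 := coc (Lp x J) W (put W s (fun=> true)) *m v.
pose z := if `|v1 0 0| <= `|v1 1 0| then 1%N else 2%N.
have z0 : (0 < z)%N by rewrite /z; case: ifP.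
have z2 : (z <= 2)%N by rewrite /z; case: ifP.
have cocE (i : 'I_M) : coc (Lp x J) (N + W) (put W s (hole (W + i) z)) =
    coc (Lp x J) N (hole (W + i) z) *m coc (Lp x J) W (put W s (fun=> true)).
  rewrite cocD shiftn_put; congr (_ *m _).
  have hd : dep (J + J).+1 (Lp x J) by exact: dep_perturbed.
  have hc : dep (W + (J + J)) (coc (Lp x J) W) by exact: dep_coc.
  apply: hc => t tW; rewrite /put; case: ltnP => // Wt.
  rewrite /hole leqNgt; have -> // : (t - W < W + i)%N.
  by move: tW; rewrite /W; clear; lia.
have qN (i : 'I_M) : (W + i + z <= N + W)%N.
  have := ltn_ord i; rewrite /N; move: z2; clear; lia.
exists (fun i => hole (W + i) z), (p ^+ (N + W) * ((1 - p) / p) ^+ z); split.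
- apply: le_trans (_ : p ^+ (N + W) * ((1 - p) / p) ^+ z <= _).
    rewrite ler_wpM2l ?exprn_ge0 ?(ltW p0) //.
    by apply: ler_wiXn2l => //; exact: ltW.
  by rewrite ler_peMl // mulr_ge0 ?exprn_ge0 // ltW.
- by move=> i; apply: Ew_agree_hole; rewrite ?qN // gt_eqF.
- by move=> i j ij; apply: hole_disagree; rewrite ?qN // eqn_add2l.
- move=> i t tW; rewrite /shiftn /put; case: ltnP => [h|_].
    by move: h; rewrite ltnNge -addnA addnC -addnA leq_addr.
  rewrite /hole; have -> : (N + W + t - W < W + i + z)%N = false; last by rewrite andbF.
  by have := ltn_ord i; rewrite /N /W; move: z2; clear; lia.
move=> i j ij; rewrite !cocE -!mulmxA -/v1.
apply: le_trans (cross_hole x v1 z0 z2 ij); rewrite -/c1.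
apply: le_trans (_ : c2 * vnorm v ^+ 2 <= _).
  by rewrite ler_wpM2r ?exprn_ge0 ?vnorm_ge0 // ge_min lexx.
have hv : vnorm v <= Lam ^+ W * vnorm v1.
  by apply: vnorm_coc => // t w; apply: vnorm_perturbed.
have c1h : 0 < c1 / 2 by exact: divr_gt0.
have h1 : c2 * vnorm v ^+ 2 <= c1 / 2 * vnorm v1 ^+ 2.
  rewrite /c2 mulrAC ler_pdivrMr ?exprn_gt0 // -[leRHS]mulrA (ler_pM2l c1h).
  by rewrite mulrC -exprMn ler_pXn2r ?nnegrE ?vnorm_ge0 // mulr_ge0 ?vnorm_ge0 // exprn_ge0 // ltW.
apply: le_trans h1 _; rewrite -[leLHS]mulrA ler_pM2l // ler_pdivrMl // sqr_vnorm.
have sqle (a b : R) : `|a| <= `|b| -> a ^+ 2 <= b ^+ 2.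
  move=> ab; rewrite -(real_normK (num_real a)) -(real_normK (num_real b)).
  by rewrite ler_pXn2r ?nnegrE.
rewrite /z; case: (leP `|v1 0 0|) => h /=; rewrite mulr_natl mulr2n ?lerD2r ?lerD2l; apply: sqle => //.
exact: ltW.
Qed.

End Spread.

(** * Hölder norms *)

Lemma dist_ge (R : realType) (x y : Sigma) (n : int) r : x n <> y n -> (absz n <= r)%N ->
  (2^-1 : R) ^+ r <= Defs.dist R x y.
Proof.
move=> xy nr; apply: lb_le_inf; first by exists (2^-1 ^+ 0), 0%N.
move=> _ [N /= hN <-]; apply: ler_wiXn2l; rewrite ?invr_ge0 // ?invf_le1 ?ler1n //.
by rewrite (leq_trans _ nr) // leqNgt; apply/negP => /hN.
Qed.

Lemma neq_letter (x y : Sigma) : x <> y -> exists n, x n <> y n.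
Proof.
move=> xy; apply: contrapT => h; apply: xy; apply/funext => n.
by apply: contrapT => hn; apply: h; exists n.
Qed.

Section Holder.
Variables (R : realType) (alpha : R).
Hypothesis alpha0 : 0 < alpha.

Notation d := (fun x y => Defs.dist R x y `^ alpha).
Let y2 : R := 2 `^ alpha.

Lemma y2_ge1 : 1 <= y2.
Proof.
have h : (2 : R) `^ 0 <= 2 `^ alpha by apply: ler_powR; [rewrite ler1n|exact: ltW].
by rewrite powRr0 in h.
Qed.

Lemma d_ge0 x y : 0 <= d x y. Proof. exact: powR_ge0. Qed.

Lemma d_ge x y n r : x n <> y n -> (absz n <= r)%N -> (y2 ^+ r)^-1 <= d x y.
Proof.
move=> xy nr; have h := dist_ge R xy nr.
have h2 : 0 <= (2^-1 : R) ^+ r by rewrite exprn_ge0 // invr_ge0.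
apply: le_trans (_ : ((2^-1 : R) ^+ r) `^ alpha <= _).
  have -> : ((2^-1 : R) ^+ r) `^ alpha = ((2^-1 : R) `^ alpha) ^+ r.
    elim: r {nr h h2} => [|r IH]; first by rewrite !expr0 powR1.
    by rewrite !exprS powRM ?exprn_ge0 ?invr_ge0 // IH.
  have -> : (2^-1 : R) `^ alpha = y2^-1.
    by apply: (mulfI (x := y2)); rewrite ?mulfV ?gt_eqF ?powR_gt0 // -powRM ?invr_ge0 // mulfV ?powR1.
  by rewrite exprVn.
by apply: (ge0_ler_powR (ltW alpha0)) => //; rewrite nnegrE // (le_trans h2).
Qed.

Lemma d_gt0 x y : x <> y -> 0 < d x y.
Proof.
move=> /neq_letter[n xy]; apply: lt_le_trans (d_ge xy (leqnn _)).
by rewrite invr_gt0 exprn_gt0 // (lt_le_trans ltr01) // y2_ge1.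
Qed.

Definition hol (c : R) (F : Sigma -> R) :=
  (forall x, `|F x| <= c) /\ (forall x y, `|F x - F y| <= c * d x y).

Lemma hol_ge0 c F : hol c F -> 0 <= c.
Proof. by move=> [h _]; apply: le_trans (normr_ge0 _) (h (fun=> true)). Qed.

Lemma hol_window b r c (F : Sigma -> R) :
  (forall x y : Sigma, (forall n, (absz n <= r)%N -> x n = y n) -> F x = F y) ->
  (forall x, `|F x| <= b) -> 2 * b * y2 ^+ r <= c -> hol c F.
Proof.
move=> hF hb hc; have b0 : 0 <= b by apply: le_trans (hb (fun=> true)).
have y1 : 1 <= y2 ^+ r by rewrite exprn_ege1 // y2_ge1.
have y0 : 0 < y2 ^+ r by exact: lt_le_trans y1.
have hbc : 2 * b <= c by apply: le_trans hc; rewrite ler_peMr // mulr_ge0.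
split=> [x|x y]; first by apply: le_trans (hb x) (le_trans _ hbc); rewrite ler_peMl // ler1n.
case: (pselect (forall n, (absz n <= r)%N -> x n = y n)) => [h|].
  by rewrite (hF _ _ h) subrr normr0 mulr_ge0 ?d_ge0 // (le_trans _ hbc) // mulr_ge0.
move=> /existsNP[n /not_implyP[nr xy]].
have h := d_ge xy nr.
apply: le_trans (ler_normB _ _) _; apply: le_trans (lerD (hb x) (hb y)) _.
apply: le_trans (_ : c * (y2 ^+ r)^-1 <= _).
  by rewrite ler_pdivlMr // -mulr2n -mulr_natl.
by rewrite ler_wpM2l // (le_trans _ hbc) // mulr_ge0.
Qed.

Lemma holW c c' F : c <= c' -> hol c F -> hol c' F.
Proof.
move=> cc [h1 h2]; split=> [x|x y]; first exact: le_trans (h1 x) cc.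
by apply: le_trans (h2 x y) _; rewrite ler_wpM2r ?d_ge0.
Qed.

Lemma holD c1 c2 F G : hol c1 F -> hol c2 G -> hol (c1 + c2) (fun x => F x + G x).
Proof.
move=> [f1 f2] [g1 g2]; split=> [x|x y].
  by apply: le_trans (ler_normD _ _) _; exact: lerD.
by rewrite opprD addrACA mulrDl; apply: le_trans (ler_normD _ _) _; exact: lerD.
Qed.

Lemma holZ c k F : `|k| <= 1 -> hol c F -> hol c (fun x => k * F x).
Proof.
move=> k1 [f1 f2]; split=> [x|x y]; rewrite -?mulrBr normrM.
  by rewrite -[c]mul1r ler_pM.
by rewrite -[c * _]mul1r ler_pM.
Qed.

Lemma holN c F : hol c F -> hol c (fun x => - F x).
Proof.
move=> h; rewrite (_ : (fun x => _) = (fun x => -1 * F x)).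
  by apply: holZ => //; rewrite normrN normr1.
by apply/funext => x; rewrite mulN1r.
Qed.

Lemma holM c1 c2 F G : hol c1 F -> hol c2 G -> hol (2 * (c1 * c2)) (fun x => F x * G x).
Proof.
move=> hF hG; have c10 := hol_ge0 hF; have c20 := hol_ge0 hG.
case: hF hG => [f1 f2] [g1 g2]; have c12 : 0 <= c1 * c2 by rewrite mulr_ge0.
split=> [x|x y].
  rewrite normrM; apply: le_trans (_ : c1 * c2 <= _); first by rewrite ler_pM.
  by rewrite ler_peMl // ler1n.
have -> : F x * G x - F y * G y = (F x - F y) * G x + F y * (G x - G y) by ring.
apply: le_trans (ler_normD _ _) _; rewrite !normrM.
have h1 : `|F x - F y| * `|G x| <= c1 * d x y * c2 by rewrite ler_pM.
have h2 : `|F y| * `|G x - G y| <= c1 * (c2 * d x y) by rewrite ler_pM.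
apply: le_trans (lerD h1 h2) _.
by rewrite le_eqVlt; apply/orP; left; apply/eqP; ring.
Qed.

Lemma opnorm_hol c (D : Sigma -> 'M[R]_2) : (forall i j, hol c (fun x => D x i j)) ->
  (forall x, opnorm (D x) <= 4 * c) /\ (forall x y, opnorm (D x - D y) <= 4 * c * d x y).
Proof.
have e4 (a : R) : 4 * a = a + a + a + a by ring.
move=> h; split=> [x|x y]; apply: le_trans (opnorm_le_mx1norm _) _; rewrite /mx1norm.
  by rewrite e4; rewrite !lerD //; case: (h 0 0) (h 0 1) (h 1 0) (h 1 1) => + _ [+ _] [+ _] [+ _].
rewrite -mulrA e4 !mxE; rewrite !lerD //.
- by case: (h 0 0).
- by case: (h 0 1).
- by case: (h 1 0).
- by case: (h 1 1).
Qed.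

Lemma holder_norm_le c (D : Sigma -> 'M[R]_2) : (forall i j, hol c (fun x => D x i j)) ->
  holder_norm alpha D <= 8 * c.
Proof.
move=> /opnorm_hol[h1 h2]; rewrite /holder_norm.
have -> : 8 * c = 4 * c + 4 * c by ring.
apply: lerD; apply: ge_sup.
- by exists (opnorm (D (fun=> true))), (fun=> true).
- by move=> _ [x _ <-].
- exists (opnorm (D (fun=> true) - D (fun=> false)) / d (fun=> true) (fun=> false)).
  by exists (fun=> true, fun=> false) => //= /(congr1 (fun f => f 0)).
- move=> _ [[x y] /= xy <-]; rewrite ler_pdivrMr; first exact: h2.
  exact: d_gt0.
Qed.

End Holder.

Section Perturbation.
Variables (R : realType) (alpha s g e0 eta dl : R) (rho T n m J : nat).
Let y2 : R := 2 `^ alpha.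
Let cut := (y2 ^+ n)^-1.
Hypotheses (alpha0 : 0 < alpha) (s1 : 1 < s) (g1 : 1 < g) (e00 : 0 < e0) (eta0 : 0 < eta)
  (rho3 : (3 <= rho)%N) (rhoT : (rho <= T)%N) (Tn : (T < n)%N) (m0 : (0 < m)%N)
  (nJ : (n < J)%N) (mJ : (m + 2 <= J)%N)
  (dl1 : dl <= 1) (hrho : 2 * e0 * y2 ^+ rho <= dl) (hn : 2 * e0 * y2 <= dl)
  (hT : 2 * (swap_ratio g e0 T)^-1 * y2 ^+ T.+1 <= dl) (hm : 2 * eta * y2 ^+ (m + 2) <= dl).

Notation hol := (hol alpha).
Notation H x := (hat (- J%:Z) x).
Definition pert (x : R) : Sigma -> 'M[R]_2 := fun w => perturbed g e0 eta cut rho T n m x J (H w).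

Lemma hatE (x : Sigma) i : H x i = x (i%:Z - J%:Z).
Proof. by []. Qed.

Lemma hat_eq (x y : Sigma) r : (forall k, (absz k <= r)%N -> x k = y k) ->
  forall i, (i <= J + r)%N -> (J - r <= i)%N -> H x i = H y i.
Proof. by move=> h i h1 h2; rewrite !hatE; apply: h; move: h1 h2; clear; lia. Qed.

Let dlp : 0 <= dl.
Proof.
apply: le_trans hn; rewrite !mulr_ge0 //; first exact: ltW.
exact: powR_ge0.
Qed.

Let natb (b : bool) : `|b%:R : R| <= 1.
Proof. by case: b; rewrite ?normr1 ?normr0 ?ler01. Qed.

Lemma block_hat_eq (x y : Sigma) b l a r : (forall k, (absz k <= r)%N -> x k = y k) ->
  (a + l <= (J + r).+1)%N -> (J - r <= a)%N -> block b l a (H x) = block b l a (H y).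
Proof.
move=> h al aJ; apply: eq_forallb => j; rewrite (hat_eq h) //.
  by have := ltn_ord j; move: al; clear; lia.
by apply: leq_trans aJ _; exact: leq_addr.
Qed.

Lemma start_hat_eq (x y : Sigma) l a r : (forall k, (absz k <= r)%N -> x k = y k) ->
  (0 < l)%N -> (a + l <= (J + r).+1)%N -> (J - r <= a.-1)%N -> start l a (H x) = start l a (H y).
Proof.
move=> h l0 al aJ; rewrite /start (block_hat_eq _ h) //; last by move: aJ; clear; lia.
by rewrite (hat_eq h) //; move: al l0; clear; lia.
Qed.

Lemma hol_start : hol dl (fun x => (start rho J (H x))%:R * e0).
Proof.
apply: (@hol_window _ _ alpha0 e0 rho) => [x y h|x|] //.
  rewrite (start_hat_eq h) //; [exact: leq_trans rho3 | move: nJ Tn rhoT rho3; clear; lia].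
by rewrite normrM (gtr0_norm e00) ler_piMl // ltW.
Qed.

Lemma hol_res : hol dl (fun x => res g e0 cut rho T n J (H x)).
Proof.
have y0 : 0 < y2 by exact: lt_le_trans (y2_ge1 alpha0).
have cut0 : 0 < cut by rewrite invr_gt0 exprn_gt0.
apply: (@hol_window _ _ alpha0 (e0 * cut) n.+1) => [x y h|x|].
- have hw : weight g (J - n) J (H x) = weight g (J - n) J (H y).
    rewrite /weight !big_nat; apply: eq_bigr => j hj; rewrite (hat_eq h) //; move: hj; clear; lia.
  have hs l : (0 < l)%N -> (l <= n)%N -> start l (J - n) (H x) = start l (J - n) (H y).
    by move=> l0 ln; apply: (start_hat_eq h) => //; move: ln nJ; clear; lia.
  rewrite /res /run_term hw !hs //; move: rho3 rhoT Tn; clear; lia.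
- by apply: res_le => //; exact: ltW.
- have -> : 2 * (e0 * cut) * y2 ^+ n.+1 = 2 * e0 * y2 by rewrite /cut exprS; field; rewrite expf_neq0 // gt_eqF.
  exact: hn.
Qed.

Lemma hol_swap : hol dl (fun x => (swap_ratio g e0 T)^-1 * (start T (J - T) (H x))%:R).
Proof.
have t0 : 0 < (swap_ratio g e0 T)^-1 by rewrite invr_gt0; exact: swap_ratio_gt0.
apply: (@hol_window _ _ alpha0 ((swap_ratio g e0 T)^-1) T.+1) => [x y h|x|] //.
  by rewrite (start_hat_eq h) //; move: nJ Tn rhoT rho3; clear; lia.
by rewrite normrM (gtr0_norm t0) ler_piMr // ltW.
Qed.

Lemma hol_lone z : (0 < z)%N -> (z <= 2)%N -> hol dl (fun x => eta * (lone m z J (H x))%:R).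
Proof.
move=> z0 z2; apply: (@hol_window _ _ alpha0 eta (m + 2)) => [x y h|x|] //.
  rewrite /lone; congr (_ * (_ : bool)%:R); congr [&& _, _ & _];
    by apply: (block_hat_eq _ h); move: z0 z2 mJ; clear; lia.
by rewrite normrM (gtr0_norm eta0) ler_piMr // ltW.
Qed.

Lemma hol_lower_shear x : 0 <= x <= 1 -> hol (3 * dl) (fun w => lower_shear g e0 eta cut rho T n m x J (H w)).
Proof.
move=> /andP[x0 x1]; have -> : 3 * dl = dl + dl + dl by ring.
rewrite /lower_shear; apply: holD; last exact: hol_lone.
apply: holZ; first by rewrite ger0_norm.
by apply: holD; [exact: hol_start|apply: holN; exact: hol_res].
Qed.

Lemma hol_upper_shear x : 0 <= x <= 1 -> hol (2 * dl) (fun w => upper_shear g e0 eta T m x J (H w)).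
Proof.
move=> /andP[x0 x1]; have -> : 2 * dl = dl + dl by ring.
rewrite /upper_shear; apply: holD; last exact: hol_lone.
rewrite (_ : (fun w => _) = (fun w => - x * ((swap_ratio g e0 T)^-1 * (start T (J - T) (H w))%:R))).
  by apply: holZ; [rewrite normrN ger0_norm|exact: hol_swap].
by apply/funext => w; rewrite mulrA !mulNr.
Qed.

Lemma hol_letter b (F : bool -> R) : (forall c, `|F c| <= b) -> hol (2 * b) (fun w => F (w 0)).
Proof.
move=> hb; apply: (@hol_window _ _ alpha0 b 0) => [x y h|x|]; rewrite ?h //.
by rewrite expr0 mulr1.
Qed.

Let c0 := 48 * g * dl.

Let dg_bound b : `|dg g b| <= g /\ `|(dg g b)^-1| <= g.
Proof.
have d0 : 0 < dg g b by exact: dg_gt0.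
have [h1 h2] : dg g b <= g /\ (dg g b)^-1 <= g by exact: dg_le.
by rewrite normfV (gtr0_norm d0).
Qed.

Let hol_dg : hol (2 * g) (fun w => dg g (w 0)).
Proof. by apply: (hol_letter (F := dg g)) => b; case: (dg_bound b). Qed.

Let hol_dgV : hol (2 * g) (fun w => (dg g (w 0))^-1).
Proof. by apply: (hol_letter (F := fun b => (dg g b)^-1)) => b; case: (dg_bound b). Qed.

Let hat0 w : H w J = w 0.
Proof. by rewrite hatE subrr. Qed.

Let gd0 : 0 <= g * dl.
Proof. by rewrite mulr_ge0 // ltW // (lt_trans ltr01). Qed.

Lemma hol_01 x : 0 <= x <= 1 -> hol c0 (fun w => pert x w 0 1).
Proof.
move=> hx; rewrite (_ : (fun w => _) = fun w => dg g (w 0) * upper_shear g e0 eta T m x J (H w)).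
  apply: holW (holM hol_dg (hol_upper_shear hx)); rewrite /c0; move: gd0; lra.
by apply/funext => w; rewrite /pert /perturbed mx2E hat0.
Qed.

Lemma hol_10 x : 0 <= x <= 1 -> hol c0 (fun w => pert x w 1 0).
Proof.
move=> hx; rewrite (_ : (fun w => _) = fun w => lower_shear g e0 eta cut rho T n m x J (H w) * (dg g (w 0))^-1).
  apply: holW (holM (hol_lower_shear hx) hol_dgV); rewrite /c0; move: gd0; lra.
by apply/funext => w; rewrite /pert /perturbed mx2E hat0.
Qed.

Lemma hol_11 x : 0 <= x <= 1 -> hol c0 (fun w => pert x w 1 1 - (dg g (w 0))^-1).
Proof.
move=> hx; rewrite (_ : (fun w => _) = fun w =>
   lower_shear g e0 eta cut rho T n m x J (H w) * upper_shear g e0 eta T m x J (H w) * (dg g (w 0))^-1).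
  apply: holW (holM (holM (hol_lower_shear hx) (hol_upper_shear hx)) hol_dgV).
  have -> : 2 * (2 * (3 * dl * (2 * dl)) * (2 * g)) = 48 * (g * dl) * dl by ring.
  by rewrite /c0 -(mulrA 48 g dl) ler_piMr // mulr_ge0.
by apply/funext => w; rewrite /pert /perturbed mx2E hat0; ring.
Qed.

Lemma A_sigmaE w : A_sigma s w = mx2 (dg s (w 0)) 0 0 (dg s (w 0))^-1.
Proof.
rewrite /A_sigma /diag2; case: (w 0); apply: mx2P; rewrite !mxE ?eqxx //=; by rewrite invrK.
Qed.

Let gap b : `|dg g b - dg s b| <= `|g - s| /\ `|(dg g b)^-1 - (dg s b)^-1| <= `|g - s|.
Proof.
have g0 : 0 < g by exact: lt_trans g1.
have s0 : 0 < s by exact: lt_trans s1.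
have h : `|g^-1 - s^-1| <= `|g - s|.
  have -> : g^-1 - s^-1 = (s - g) / (g * s) by field; rewrite !gt_eqF.
  rewrite normrM normfV distrC (gtr0_norm (mulr_gt0 g0 s0)) ler_piMr //.
  by rewrite invf_le1 ?mulr_gt0 // mulr_ege1 // ltW.
by case: b; rewrite /= ?invrK; split.
Qed.

Lemma hol_diff x : 0 <= x <= 1 -> forall i j,
  hol (c0 + 2 * `|g - s|) (fun w => (pert x w - A_sigma s w) i j).
Proof.
move=> hx i j; have gs0 : 0 <= 2 * `|g - s| by rewrite mulr_ge0.
have c00 : 0 <= c0 by rewrite /c0 -mulrA mulr_ge0.
have subE (A B : 'M[R]_2) k l : (A - B) k l = A k l - B k l by rewrite !mxE.
case: (ord2E i) => ->; case: (ord2E j) => ->.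
- rewrite (_ : (fun w => _) = fun w => dg g (w 0) - dg s (w 0)).
    apply: (@holW _ _ (2 * `|g - s|)); first by rewrite lerDr.
    by apply: (hol_letter (F := fun b => dg g b - dg s b)) => b; case: (gap b).
  by apply/funext => w; rewrite subE A_sigmaE mx2E /pert /perturbed !mx2E hat0.
- rewrite (_ : (fun w => _) = fun w => pert x w 0 1).
    by apply: (@holW _ _ c0); [rewrite lerDl|exact: hol_01].
  by apply/funext => w; rewrite subE A_sigmaE mx2E subr0.
- rewrite (_ : (fun w => _) = fun w => pert x w 1 0).
    by apply: (@holW _ _ c0); [rewrite lerDl|exact: hol_10].
  by apply/funext => w; rewrite subE A_sigmaE mx2E subr0.
- rewrite (_ : (fun w => _) = fun w => (pert x w 1 1 - (dg g (w 0))^-1) +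
      ((dg g (w 0))^-1 - (dg s (w 0))^-1)).
    apply: holD; first exact: hol_11.
    by apply: (hol_letter (F := fun b => (dg g b)^-1 - (dg s b)^-1)) => b; case: (gap b).
  by apply/funext => w; rewrite addrA subrK subE A_sigmaE mx2E.
Qed.

Lemma holder_norm_diff x : 0 <= x <= 1 ->
  holder_norm alpha (fun w => pert x w - A_sigma s w) <= 8 * (c0 + 2 * `|g - s|).
Proof. by move=> hx; apply: holder_norm_le => // i j; exact: hol_diff. Qed.

Lemma CaSL_pert x : 0 <= x <= 1 -> CaSL alpha (pert x).
Proof.
move=> hx; split; last by move=> w; apply: det_perturbed.
have hD i j : hol (c0 + 2 * `|g - s| + 2 * s) (fun w => pert x w i j).
  rewrite (_ : (fun w => _) = fun w => (pert x w - A_sigma s w) i j + A_sigma s w i j); last first.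
    by apply/funext => w; rewrite !mxE subrK.
  apply: holD; first exact: hol_diff.
  have dsb b : `|dg s b| <= s /\ `|(dg s b)^-1| <= s.
    have d0 : 0 < dg s b by exact: dg_gt0.
    have [h1 h2] : dg s b <= s /\ (dg s b)^-1 <= s by exact: dg_le.
    by rewrite normfV (gtr0_norm d0).
  have s0 : 0 <= s by rewrite ltW // (lt_trans ltr01).
  apply: (@hol_window _ _ alpha0 s 0) => [u v h|u|].
  - by rewrite !A_sigmaE h.
  - rewrite A_sigmaE; case: (ord2E i) => ->; case: (ord2E j) => ->; rewrite !mxE /= ?normr0 //;
      by case: (dsb (u 0)).
  - by rewrite expr0 mulr1.
have [_ h2] := opnorm_hol hD.
by exists (4 * (c0 + 2 * `|g - s| + 2 * s)) => u v _; exact: h2.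
Qed.

Lemma locally_constant_pert x : locally_constant (pert x).
Proof.
exists J => u v h; have hd : dep (J + J).+1 (perturbed g e0 eta cut rho T n m x J) by exact: dep_perturbed.
by apply: hd => i iJ; apply: (hat_eq h) => //; rewrite subnn.
Qed.

Lemma cocycle_pert x k w : cocycle (pert x) k w = coc (perturbed g e0 eta cut rho T n m x J) k (H w).
Proof.
elim: k => [//|k IH] /=.
by rewrite IH /pert hat_shift.
Qed.

Lemma lyap_pert x (p : R) (mu : probability Sigma R) : 0 <= p -> p <= 1 -> is_bernoulli p mu ->
  lyap mu (pert x) = lam p (J + J) (perturbed g e0 eta cut rho T n m x J).
Proof.
move=> p0 p1 hmu; rewrite /lyap /lam; congr inf; apply: eq_imagel => k _.
have hd : dep (J + J).+1 (perturbed g e0 eta cut rho T n m x J) by exact: dep_perturbed.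
have hl : dep (k.+1 + (J + J)) (lnop (perturbed g e0 eta cut rho T n m x J) k.+1).
  exact: (dep_lnop p0 p1 hd (lexx 1)).
have -> : (\int[mu]_w (ln (opnorm (cocycle (pert x) k.+1 w)))%:E)%E =
    (avg p (J + J) (perturbed g e0 eta cut rho T n m x J) k.+1)%:E.
  rewrite -(integral_window hmu (- J%:Z) hl); apply: eq_integral => w _.
  by rewrite cocycle_pert.
by [].
Qed.

End Perturbation.

(** * Choice of the parameters *)

Section Scales.
Variable R : realType.
Implicit Types (a b c eps : R).

Lemma nat_above c : exists k : nat, (0 < k)%N /\ c <= k%:R.
Proof.
by exists (Num.truncn c).+1; split=> //; exact/ltW/truncnS_gt.
Qed.

Lemma pow_small a c eps : 0 <= a < 1 -> 0 < eps -> exists k : nat, (0 < k)%N /\ c * a ^+ k <= eps.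
Proof.
move=> /andP[a0 a1] eps0; case: (eqVneq a 0) => [->|an].
  by exists 1%N; rewrite expr1 mulr0 ltW.
have ap : 0 < a by rewrite lt_def an.
have h0 : 0 < a^-1 - 1 by rewrite subr_gt0 invf_gt1.
have [k [k0 hk]] := nat_above (c / eps / (a^-1 - 1)).
exists k; split=> //; rewrite -[a]invrK exprVn ler_pdivrMr ?exprn_gt0 ?invr_gt0 //.
have hb : k%:R * (a^-1 - 1) <= a^-1 ^+ k.
  elim: (k) => [|j IH]; first by rewrite mul0r expr0.
  have h1 : 1 <= a^-1 ^+ j by rewrite exprn_ege1 // invf_ge1 // ltW.
  rewrite -natr1 mulrDl mul1r exprS.
  have -> : a^-1 * a^-1 ^+ j = a^-1 ^+ j + (a^-1 - 1) * a^-1 ^+ j by ring.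
  by rewrite lerD // ler_peMr // ltW.
move: hk; rewrite ler_pdivrMr // => hk.
by rewrite mulrC -ler_pdivrMr // (le_trans hk).
Qed.

Lemma poly_pow_small eps : 0 < eps -> exists k : nat, (3 <= k)%N /\ k%:R ^+ 5 * 2^-1 ^+ k <= eps.
Proof.
move=> eps0; have [j [j0 hj]] := nat_above (6 ^+ 5 / eps).
have h2 i : (i%:R : R) <= 2 ^+ i by rewrite -natrX ler_nat ltnW // ltn_expl.
exists (6 * j)%N; split; first by rewrite (leq_trans (_ : 3 <= 6 * 1)%N) // leq_mul2l j0.
have jp : 0 < (j%:R : R) by rewrite ltr0n.
have e1 : ((6 * j)%:R : R) ^+ 5 * 2^-1 ^+ (6 * j) = 6 ^+ 5 * (j%:R ^+ 5 / (2 ^+ j) ^+ 5) / 2 ^+ j.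
  rewrite natrM exprMn exprVn mulnC exprM; field.
  by rewrite expf_neq0 // pnatr_eq0.
rewrite e1; have h2j : 0 < (2 : R) ^+ j by rewrite exprn_gt0.
have h1 : j%:R ^+ 5 / (2 ^+ j) ^+ 5 <= (1 : R).
  by rewrite ler_pdivrMr ?exprn_gt0 // mul1r lerXn2r ?nnegrE // ltW.
rewrite ler_pdivrMr //; apply: le_trans (_ : 6 ^+ 5 <= _).
  by rewrite ler_piMr // exprn_ge0.
move: hj; rewrite ler_pdivrMr // => hj; apply: le_trans hj _.
by rewrite mulrC ler_wpM2l // ltW.
Qed.

Lemma expR_le_quad a : `|a| <= 2^-1 -> expR a <= 1 + a + 2 * a ^+ 2.
Proof.
rewrite ler_norml => /andP[a1 a2].
have h : 1 - a <= expR (- a) by exact: expR_ge1Dx.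
have h1 : 0 < 1 - a by move: a2; lra.
have h2 : expR a * (1 - a) <= 1.
  apply: le_trans (_ : expR a * expR (- a) <= _); first by rewrite ler_wpM2l // expR_ge0.
  by rewrite -expRD subrr expR0.
rewrite -(ler_pM2r h1); apply: le_trans h2 _.
rewrite (_ : (1 + a + 2 * a ^+ 2) * (1 - a) = 1 + a ^+ 2 * (1 - 2 * a)); last by ring.
by rewrite lerDl mulr_ge0 ?sqr_ge0 //; move: a2; lra.
Qed.

Lemma rate_lt1 (p g y : R) : 0 < p -> p < 1 -> 1 < g -> 1 <= y -> ln y < (4 * p - 2) * ln g ->
  exists z, 0 < z /\ 0 <= rate p g y z < 1.
Proof.
move=> p0 p1 g1 y1 hy; have y0 : 0 < y by exact: lt_le_trans y1.
have g0 : 0 < g by exact: lt_trans g1.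
have lg0 : 0 < ln g by rewrite ln_gt0.
have ly0 : 0 <= ln y by rewrite ln_ge0.
set ly := ln y in hy ly0 *; set lg := ln g in hy lg0 *.
pose M := ly + 2 * lg; pose c := (4 * p - 2) * lg - ly.
have M0 : 0 < M by rewrite /M; move: lg0 ly0; lra.
have c0 : 0 < c by rewrite subr_gt0.
have cM : c <= M.
  rewrite /c /M; have : 0 <= (1 - p) * lg by apply: mulr_ge0; rewrite ?subr_ge0; exact: ltW.
  move: ly0 lg0; lra.
pose z := c / (4 * M ^+ 2).
have z0 : 0 < z by rewrite /z divr_gt0 // mulr_gt0 // exprn_gt0.
have zM : z * M <= 4^-1.
  rewrite /z (_ : _ * M = c / M / 4); last by field; rewrite gt_eqF.
  by rewrite ler_pdivrMr // mulVf // ler_pdivrMr // mul1r.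
have q2E (b : bool) : (y * q2 g b) `^ z = expR (z * (if b then ly - 2 * lg else M)).
  have h : 0 < y * q2 g b by rewrite mulr_gt0 // q2_gt0.
  rewrite /powR gt_eqF // lnM ?posrE ?q2_gt0 //; congr (expR (_ * _)).
  case: b {h}; rewrite /= lnXn ?invr_gt0 // ?lnV ?posrE // -/ly -/lg /M; ring.
have hz (x : R) : `|x| <= M -> expR (z * x) <= 1 + z * x + 2 * (z * M) ^+ 2.
  move=> hx; have h : `|z * x| <= z * M by rewrite normrM (gtr0_norm z0) ler_wpM2l // ltW.
  apply: le_trans (expR_le_quad _) _; first by apply: le_trans h (le_trans zM _); lra.
  rewrite lerD2l ler_wpM2l // -[(z * x) ^+ 2]real_normK ?num_real // lerXn2r ?nnegrE //.
  by rewrite mulr_ge0 // ltW.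
exists z; split=> //; rewrite /rate !q2E; apply/andP; split.
  by apply: addr_ge0; apply: mulr_ge0; rewrite ?expR_ge0 ?subr_ge0 //; exact: ltW.
have h1 : `|ly - 2 * lg| <= M by rewrite ler_norml /M; apply/andP; split; move: ly0 lg0; lra.
have h2 : `|M| <= M by rewrite ger0_norm // ltW.
have {}h1 := hz _ h1; have {}h2 := hz _ h2.
have q0 : 0 <= 1 - p by rewrite subr_ge0 ltW.
apply: le_lt_trans (lerD (ler_wpM2l (ltW p0) h1) (ler_wpM2l q0 h2)) _.
have -> : p * (1 + z * (ly - 2 * lg) + 2 * (z * M) ^+ 2) + (1 - p) * (1 + z * M + 2 * (z * M) ^+ 2)
   = 1 - z * c + 2 * (z * M) ^+ 2 by rewrite /c /M; ring.
have -> : 2 * (z * M) ^+ 2 = z * c / 2.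
  by rewrite {2}/z /z; field; rewrite gt_eqF.
have : 0 < z * c by rewrite mulr_gt0.
lra.
Qed.

Lemma swap_size (y g : R) : 1 <= y -> y < g ^+ 2 -> 1 < g -> exists K : nat, (0 < K)%N /\
  forall d rho, 0 < d -> y * 2^-1 ^+ rho <= d ^+ 2 ->
  y ^+ (K * rho).+1 <= d * swap_ratio g (d / y ^+ rho) (K * rho).
Proof.
move=> y1 yg g1; have y0 : 0 < y by exact: lt_le_trans y1.
have G0 : 0 < g ^+ 2 by exact: lt_trans yg.
have a1 : 0 <= y / g ^+ 2 < 1 by rewrite divr_ge0 ?ltW //= ltr_pdivrMr // mul1r.
have h0 : 0 < (2^-1 : R) by rewrite invr_gt0.
have [K [K0 hK]] := pow_small y a1 h0; exists K; split=> // d rho d0 hd.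
have Gr : 0 < (g ^+ 2) ^+ (K * rho) by rewrite exprn_gt0.
have yr : 0 < y ^+ rho by rewrite exprn_gt0.
have {hK}h : y ^+ (K * rho) * y ^+ rho <= 2^-1 ^+ rho * (g ^+ 2) ^+ (K * rho).
  rewrite -ler_pdivrMr //.
  rewrite (_ : _ / _ = (y * (y / g ^+ 2) ^+ K) ^+ rho).
    apply: lerXn2r hK; rewrite nnegrE ?invr_ge0 //.
    by apply: mulr_ge0; rewrite ?(ltW y0) // exprn_ge0 //; case/andP: a1.
  rewrite [RHS]exprMn; set u := y / _.
  have -> : (u ^+ K) ^+ rho = y ^+ (K * rho) / (g ^+ 2) ^+ (K * rho).
    by rewrite -exprM /u; apply: expr_div_n.
  by rewrite mulrCA mulrA.
rewrite /swap_ratio exprS -(ler_pM2r yr).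
have -> : d * (d / y ^+ rho * (g ^+ 2) ^+ (K * rho)) * y ^+ rho = d ^+ 2 * (g ^+ 2) ^+ (K * rho).
  by field; rewrite gt_eqF.
rewrite -mulrA; apply: le_trans (ler_wpM2l (ltW y0) h) _.
by rewrite mulrA ler_wpM2r // ltW.
Qed.

Lemma ln_le_sub1 a : 0 < a -> ln a <= a - 1.
Proof.
move=> a0; have := @expR_ge1Dx R (ln a); rewrite lnK ?posrE //; lra.
Qed.

Lemma ln_tail (g e0 : R) n : 1 < g -> 0 < e0 -> e0 <= 1 -> (0 < n)%N ->
  2 * ln (2 + n%:R * (e0 * (g ^+ 2) ^+ n)) <= n%:R * (6 + 4 * ln g).
Proof.
move=> g1 e00 e1 n0; have g0 : 0 < g by exact: lt_trans g1.
have np : 1 <= (n%:R : R) by rewrite ler1n.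
have n0' : 0 < (n%:R : R) by exact: lt_le_trans np.
have Gn : 1 <= (g ^+ 2) ^+ n by rewrite !exprn_ege1 // ltW.
have Gn0 : 0 < (g ^+ 2) ^+ n by exact: lt_le_trans Gn.
have nG : 1 <= n%:R * (g ^+ 2) ^+ n by rewrite mulr_ege1.
have h : 2 + n%:R * (e0 * (g ^+ 2) ^+ n) <= 3 * (n%:R * (g ^+ 2) ^+ n).
  have : n%:R * (e0 * (g ^+ 2) ^+ n) <= n%:R * (g ^+ 2) ^+ n.
    by rewrite ler_wpM2l ?(ltW n0') // ler_piMl // ltW.
  move: nG; lra.
have hpos : 0 < 2 + n%:R * (e0 * (g ^+ 2) ^+ n).
  by rewrite ltr_wpDr // !mulr_ge0 // ltW.
have {}h : ln (2 + n%:R * (e0 * (g ^+ 2) ^+ n)) <= ln 3 + (ln n%:R + n%:R * (2 * ln g)).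
  have -> : n%:R * (2 * ln g) = ln ((g ^+ 2) ^+ n).
    by rewrite !mulr_natl lnXn ?exprn_gt0 // lnXn.
  have lnM3 (a b c : R) : 0 < a -> 0 < b -> 0 < c -> ln (a * (b * c)) = ln a + (ln b + ln c).
    by move=> a0 b0 c0; rewrite !lnM ?posrE // mulr_gt0.
  rewrite -lnM3 //; move: h hpos; move: (2 + _) (3 * _) => a b h a0.
  by rewrite ler_ln ?posrE // (lt_le_trans a0).
have h3 : ln (3 : R) <= 3 - 1 by apply: ln_le_sub1.
have hn := ln_le_sub1 n0'.
move: h h3 hn np; set a := ln (_ + _); set b := ln (3 : R); set c := ln _; set e := ln g; nra.
Qed.

Lemma potmax_le (p g lt : R) T : 1 <= 2 * p -> p < 1 -> 1 < g -> (0 < T)%N -> lt <= T%:R * (2 * ln g) ->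
  potmax p T (ln g) lt <= 3 * T%:R * ln g / (1 - p) ^+ T.
Proof.
move=> p2 p1 g1 T0 hlt; have lg0 : 0 < ln g by rewrite ln_gt0.
have p0 : 0 < p by move: p2; lra.
have q0 : 0 < 1 - p by rewrite subr_gt0.
have T1 : 1 <= (T%:R : R) by rewrite ler1n.
have qT : 0 < (1 - p) ^+ T by rewrite exprn_gt0.
have X1 : 1 <= ((1 - p) ^+ T)^-1.
  by rewrite invf_ge1 // exprn_ile1 // ?(ltW q0) //; move: p0; lra.
have hp : (2 * p - 1) * ln g / p <= ln g.
  by rewrite ler_pdivrMr // mulrC ler_wpM2l ?(ltW lg0) //; move: p1; lra.
rewrite /potmax; set X := ((1 - p) ^+ T)^-1 in X1 *.
have h1 : (2 * p - 1) * ln g / p * X <= T%:R * ln g * X.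
  rewrite ler_wpM2r //; first by rewrite (le_trans _ X1).
  by apply: le_trans hp _; rewrite ler_peMl // ltW.
have h2 : T%:R * (2 * ln g) <= T%:R * (2 * ln g) * X.
  by rewrite ler_peMr // !mulr_ge0 // ltW.
apply: le_trans (lerD (le_trans hlt h2) h1) _.
by rewrite le_eqVlt; apply/orP; left; apply/eqP; ring.
Qed.

End Scales.

Section Tuning.
Variable R : realType.

Lemma nat_above_mul (a b u v : R) : 0 < u -> 0 < v -> 0 <= a -> 0 <= b ->
  exists k : nat, [/\ (0 < k)%N, a <= k%:R * u & b <= k%:R * v].
Proof.
move=> u0 v0 a0 b0; have [k [k0 hk]] := nat_above (a / u + b / v).
exists k; split=> //; rewrite -ler_pdivrMr // (le_trans _ hk) //.
  by rewrite lerDl divr_ge0 // ltW.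
by rewrite lerDr divr_ge0 // ltW.
Qed.

Lemma drift_size (P S T l X c u : R) : 0 <= S -> 0 <= T -> 0 <= l -> 0 <= X ->
  P <= 3 * T * l * X -> S <= 3 * T * l -> 4608 * l ^+ 2 <= c * u ->
  128 * S ^+ 2 <= 1152 * T ^+ 2 * l ^+ 2 /\ 512 * P * S <= u * (c * T ^+ 2 * X).
Proof.
move=> S0 T0 l0 X0 hP hS hc; have Tl : 0 <= 3 * T * l by rewrite !mulr_ge0.
have h1 : S ^+ 2 <= (3 * T * l) ^+ 2 by rewrite lerXn2r ?nnegrE.
have TX : 0 <= T ^+ 2 * X by rewrite mulr_ge0 ?exprn_ge0.
have h2 := ler_wpM2r TX hc.
have h3 := ler_wpM2r S0 hP; have h4 := ler_wpM2l (mulr_ge0 Tl X0) hS.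
split; [move: h1|move: h2 h3 h4]; clear; lra.
Qed.

(* T and n are proportional to rho, k to rho ^ 2 and B to rho ^ 2 / (1 - p) ^ T. Hence k * B is
   large compared with the time between two swaps, but small compared with the inverse
   of the probability (1 - p) ^ (rho + T) of a bad word. *)
Lemma exists_scales (p g y r kappa Lam d : R) : 1 <= 2 * p -> p < 1 -> 1 < g -> 1 <= y -> y < g ^+ 2 ->
  0 <= r < 1 -> 0 < kappa -> 1 <= Lam -> 0 < d -> d <= 1 ->
  exists rho T n k B : nat,
  [/\ (3 <= rho)%N, (rho <= T)%N, (T < n)%N, (0 < k)%N & (0 < B)%N] /\
  let t := swap_ratio g (d / y ^+ rho) T in
  [/\ y ^+ T.+1 <= d * t,
      128 * (ln g + ln t) ^+ 2 <= kappa ^+ 2 * k%:R,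
      512 * potmax p T (ln g) (ln t) * (ln g + ln t) <= kappa ^+ 2 * B%:R,
      2 * ln (2 + n%:R * (d / y ^+ rho * (g ^+ 2) ^+ n)) <= (k * B)%:R * kappa / 8 &
      (k * B)%:R * ln Lam * (r ^+ n + n%:R * (1 - p) ^+ (rho + T)) <= kappa / 8].
Proof.
have ar (a b : R) : 1 <= a -> b <= a -> b + 1 <= 2 * a by lra.
have ar2 (a b c : R) : a <= b -> b <= c * b -> a + c * b <= 2 * c * b by lra.
have ar3 (a b c : R) : a <= c * a -> b <= c * (2 * a) -> a + b <= 3 * c * a by lra.
move=> p2 p1 g1 y1 yg r1 kp Lam1 d0 d1; set q := 1 - p.
have q0 : 0 < q by rewrite subr_gt0.
have q1 : q <= 2^-1 by rewrite /q; move: p2; lra.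
have q1' : q <= 1 by move: q1; lra.
have y0 : 0 < y by exact: lt_le_trans y1.
have lg0 : 0 < ln g by rewrite ln_gt0.
have lL : 0 <= ln Lam by rewrite ln_ge0.
have k20 : 0 < kappa ^+ 2 by rewrite exprn_gt0.
have [r0 r1'] := andP r1.
have [K [K0 hK]] := swap_size y1 yg g1.
have q20 : 0 < q ^+ 2 by rewrite exprn_gt0.
have [K1 [K10 hK1]] := pow_small 1 r1 q20; rewrite mul1r in hK1.
have lgs (a : R) : 0 <= a -> 0 <= a * ln g ^+ 2 by move=> a0; rewrite mulr_ge0 // exprn_ge0 // ltW.
have tail0 : 0 <= K1.+1%:R * (6 + 4 * ln g) * 8 by rewrite !mulr_ge0 // addr_ge0 // mulr_ge0 // ltW.
have [c1 [c10 hc1 _]] := nat_above_mul k20 k20 (lgs 1152 (ler0n R _)) (lexx 0).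
have [c2 [c20 hc2 hc3]] := nat_above_mul k20 kp (lgs 4608 (ler0n R _)) tail0.
pose C : R := 4 * c1%:R * c2%:R * K1.+1%:R * ln Lam * K%:R ^+ 5.
have C0 : 0 <= C by rewrite /C !mulr_ge0 // exprn_ge0.
have eps0 : 0 < Num.min (d ^+ 2 / y) (kappa / 8 / (C + 1)).
  by rewrite lt_min !divr_gt0 ?exprn_gt0 // ltr_wpDl.
have [rho [rho3 hrho]] := poly_pow_small eps0.
have rho0 : (0 < rho)%N by exact: leq_trans rho3.
pose T := (K * rho)%N; pose n := (K1.+1 * T)%N.
have rhoT : (rho <= T)%N by rewrite leq_pmull.
have T0 : (0 < T)%N by rewrite muln_gt0 K0.
have Tn : (T < n)%N by rewrite ltn_Pmull.
have [X [hX1 hX2]] : exists X : nat, (q ^+ T)^-1 <= X%:R /\ X%:R <= 2 * (q ^+ T)^-1.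
  have h1 : 1 <= (q ^+ T)^-1 by rewrite invf_ge1 ?exprn_gt0 // exprn_ile1 // ltW.
  have := truncn_itv (le_trans ler01 h1); set X := Num.truncn _ => /andP[h2 h3].
  exists X.+1; split; first exact: ltW.
  by rewrite -natr1; exact: ar.
have q2 : q ^+ rho <= 2^-1 ^+ rho by rewrite lerXn2r ?nnegrE ?(ltW q0) ?invr_ge0.
have rho5 : 1 <= (rho%:R : R) ^+ 5 by rewrite exprn_ege1 // ler1n.
move: hrho; rewrite le_min => /andP[hrho1 hrho2].
have hd : y * 2^-1 ^+ rho <= d ^+ 2.
  rewrite mulrC -ler_pdivlMr //; apply: le_trans hrho1.
  by rewrite ler_peMl // exprn_ge0 // invr_ge0.
have yr1 : 1 <= y ^+ rho by rewrite exprn_ege1.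
have yr0 : 0 < y ^+ rho by exact: lt_le_trans yr1.
have e00 : 0 < d / y ^+ rho by rewrite divr_gt0.
have e01 : d / y ^+ rho <= 1 by rewrite ler_pdivrMr // mul1r (le_trans d1).
have {hK hd}ht := hK d rho d0 hd; rewrite -/T in ht.
have GT : 0 < (g ^+ 2) ^+ T by rewrite !exprn_gt0 // (lt_trans ltr01).
have t0 : 0 < swap_ratio g (d / y ^+ rho) T by rewrite /swap_ratio mulr_gt0.
have t1 : 1 <= swap_ratio g (d / y ^+ rho) T.
  apply: le_trans (_ : d * swap_ratio g (d / y ^+ rho) T <= _); last by rewrite ler_piMl // ltW.
  by apply: le_trans ht; rewrite exprn_ege1.
have lt0 := ln_ge0 t1.
have lt1 : ln (swap_ratio g (d / y ^+ rho) T) <= T%:R * (2 * ln g).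
  have -> : T%:R * (2 * ln g) = ln ((g ^+ 2) ^+ T).
    by rewrite !mulr_natl lnXn ?exprn_gt0 ?(lt_trans ltr01) // lnXn // (lt_trans ltr01).
  by rewrite ler_ln ?posrE // /swap_ratio ler_piMl // ltW.
have hpot := potmax_le p2 p1 g1 T0 lt1; rewrite -/q in hpot.
have tail := ln_tail g1 e00 e01 (ltn_trans T0 Tn).
exists rho, T, n, (c1 * T ^ 2)%N, (c2 * T ^ 2 * X)%N.
move: ht hpot lt0 lt1 tail; rewrite /=.
set e := d / _; set t := swap_ratio _ _ _; set lt := ln t; set lg := ln g in lg0 hc1 hc2 *.
move=> ht hpot lt0 lt1 tail.
have T1 : 1 <= (T%:R : R) by rewrite ler1n.
have X1 : (0 < X)%N.
  by rewrite -(ltr0n R) (lt_le_trans _ hX1) // invr_gt0 exprn_gt0.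
have T20 : (0 < T ^ 2)%N by rewrite expn_gt0 T0.
have k0 : (0 < c1 * T ^ 2)%N by rewrite muln_gt0 c10 T20.
have B0 : (0 < c2 * T ^ 2 * X)%N by rewrite muln_gt0 X1 andbT muln_gt0 c20 T20.
split; first by split.
have sum3 : lg + lt <= 3 * T%:R * lg.
  have h : lg <= T%:R * lg by apply: ler_peMl => //; exact: ltW.
  exact: ar3 h lt1.
have sum0 : 0 <= lg + lt by rewrite addr_ge0 // ltW.
have lg0' := ltW lg0.
have X0 : 0 <= (X%:R : R) by [].
have T0' : 0 <= (T%:R : R) by [].
have hX3 : 1 <= (X%:R : R) by rewrite ler1n.
have hP : potmax p T lg lt <= 3 * T%:R * lg * X%:R.
  by apply: le_trans hpot _; rewrite ler_wpM2l // !mulr_ge0.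
have [sum2 sumP] := drift_size sum0 T0' lg0' X0 hP sum3 hc2.
split=> //.
- apply: le_trans sum2 _; have {}hc1 := ler_wpM2r (exprn_ge0 2 T0') hc1.
  by rewrite natrM natrX mulrAC (le_trans hc1) // mulrAC mulrC.
- by apply: le_trans sumP _; rewrite natrM natrM natrX.
- apply: le_trans tail _.
  have hN : (c2 * T <= c1 * T ^ 2 * (c2 * T ^ 2 * X))%N.
    have -> : (c1 * T ^ 2 * (c2 * T ^ 2 * X) = c2 * T * (c1 * T * T ^ 2 * X))%N.
      by move: (T) => a; clear; rewrite !expnS expn0; ring.
    by rewrite leq_pmulr // muln_gt0 X1 andbT muln_gt0 T20 andbT muln_gt0 c10 T0.
  have {}hN : c2%:R * T%:R * kappa <= (c1 * T ^ 2 * (c2 * T ^ 2 * X))%:R * kappa.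
    by rewrite ler_wpM2r ?(ltW kp) // -natrM ler_nat.
  have {}h := ler_wpM2r T0' hc3; rewrite -/lg in h.
  rewrite /n natrM; move: h hN; move: (c1 * T ^ 2 * _)%N => N; move: (T%:R : R) (K1.+1%:R : R) => a b; clear; lra.
- have hr : r ^+ n <= q ^+ (rho + T).
    rewrite /n exprM; apply: le_trans (_ : (q ^+ 2) ^+ T <= _).
      have h : r ^+ K1.+1 <= q ^+ 2.
        by apply: le_trans hK1; rewrite ler_wiXn2l // ltW.
      by apply: lerXn2r h; rewrite nnegrE exprn_ge0 // ltW.
    rewrite -exprM ler_wiXn2l ?(ltW q0) //; move: rhoT; move: (T) => a; clear; lia.
  have n1 : 1 <= (n%:R : R) by rewrite ler1n (leq_trans _ Tn).
  have hs : r ^+ n + n%:R * q ^+ (rho + T) <= 2 * n%:R * q ^+ (rho + T).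
    have qq : 0 <= q ^+ (rho + T) by rewrite exprn_ge0 // ltW.
    by apply: ar2 hr _; rewrite ler_peMl.
  have NL : 0 <= (c1 * T ^ 2 * (c2 * T ^ 2 * X))%:R * ln Lam by rewrite mulr_ge0.
  apply: le_trans (ler_wpM2l NL hs) _.
  have qT : 0 < q ^+ T by rewrite exprn_gt0.
  have hXq : X%:R * q ^+ T <= 2 by rewrite -ler_pdivlMr.
  have hC : (c1 * T ^ 2 * (c2 * T ^ 2 * X))%:R * ln Lam * (2 * n%:R * q ^+ (rho + T)) =
     C / 2 * rho%:R ^+ 5 * q ^+ rho * (X%:R * q ^+ T).
    rewrite /C /n exprD /T !natrM ?natrX; by field.
  have Cq : 0 <= C / 2 * rho%:R ^+ 5 * q ^+ rho.
    by rewrite !mulr_ge0 ?exprn_ge0 ?invr_ge0 // ltW.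
  rewrite hC; apply: le_trans (ler_wpM2l Cq hXq) _.
  have h5 : C * (rho%:R ^+ 5 * q ^+ rho) <= C * (rho%:R ^+ 5 * 2^-1 ^+ rho).
    by rewrite ler_wpM2l // ler_wpM2l // exprn_ge0.
  have h6 : (rho%:R ^+ 5 * 2^-1 ^+ rho) * (C + 1) <= kappa / 8.
    by rewrite -ler_pdivlMr // ltr_wpDl.
  have h7 : 0 <= rho%:R ^+ 5 * (2^-1 : R) ^+ rho by rewrite mulr_ge0 ?exprn_ge0 ?invr_ge0.
  have -> : C / 2 * rho%:R ^+ 5 * q ^+ rho * 2 = C * (rho%:R ^+ 5 * q ^+ rho) by field.
  apply: (le_trans h5); move: h6 h7; move: (_ * _ ^+ rho) (C) => a b; clear; lra.
Qed.

End Tuning.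

Section Density.
Variable R : realType.

Lemma budget (N L C a b l A kappa : R) : 0 < N -> 0 < kappa -> C <= N * kappa / 8 ->
  N * L * a <= kappa / 8 -> N * L * 2 * b <= kappa / 8 -> N * l <= A ->
  A <= N * kappa / 8 + C + N * L * (N * (a + 2 * b)) -> l < kappa.
Proof.
move=> N0 kp hC ha hb hl hA; rewrite -(ltr_pM2l N0); apply: le_lt_trans hl _.
have h := ler_wpM2l (ltW N0) (lerD ha hb); have h0 := mulr_gt0 N0 kp.
move: hC hA h h0; clear; lra.
Qed.

Lemma exists_parameters (p g y kappa dl : R) : 1 <= 2 * p -> p < 1 -> 1 < g -> 1 <= y ->
  ln y < (4 * p - 2) * ln g -> 0 < kappa -> 0 < dl -> dl <= 2^-1 ->
  exists e0 eta rho T n m J,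
  [/\ 0 < e0, 0 < eta, 2 * e0 + eta <= 1 & (swap_ratio g e0 T)^-1 + eta <= 1] /\
  [/\ (3 <= rho)%N, (rho <= T)%N & (T < n)%N] /\ [/\ (0 < m)%N, (n < J)%N & (m + 2 <= J)%N] /\
  [/\ 2 * e0 * y ^+ rho <= dl, 2 * e0 * y <= dl, 2 * (swap_ratio g e0 T)^-1 * y ^+ T.+1 <= dl &
      2 * eta * y ^+ (m + 2) <= dl] /\
  lam p (J + J) (perturbed g e0 eta (y ^+ n)^-1 rho T n m 1 J) < kappa.
Proof.
move=> p2 p1 g1 y1 hy kp dl0 dl2; have p0 : 0 < p by move: p2; clear; lra.
have y0 : 0 < y by exact: lt_le_trans y1.
have g0 : 0 < g by exact: lt_trans g1.
have lg0 : 0 < ln g by rewrite ln_gt0.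
have yg : y < g ^+ 2.
  rewrite -ltr_ln ?posrE ?exprn_gt0 // lnXn // -mulr_natl; apply: (lt_trans hy).
  by rewrite ltr_pM2r //; move: p1; clear; lra.
have [z [z0 hr]] := rate_lt1 p0 p1 g1 y1 hy.
have Lam1 : 1 <= 5 * g by move: g1; clear; lra.
pose d := dl / 2; have d0 : 0 < d by rewrite divr_gt0.
have d1 : d <= 4^-1 by rewrite /d; move: dl2; clear; lra.
have d1' : d <= 1 by move: d1; clear; lra.
have [rho [T [n [k [B [[rho3 rhoT Tn k0 B0] hN]]]]]] := exists_scales p2 p1 g1 y1 yg hr kp Lam1 d0 d1'.
move: hN; set e0 := d / y ^+ rho => -[ht hk hB htail hbad].
have yr1 : 1 <= y ^+ rho by rewrite exprn_ege1.
have yr0 : 0 < y ^+ rho by exact: lt_le_trans yr1.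
have e00 : 0 < e0 by rewrite divr_gt0.
have ey : e0 * y ^+ rho = d by rewrite /e0 divfK ?gt_eqF.
have y2 : y <= y ^+ rho by rewrite ler_eXnr // (leq_trans _ rho3).
have t0 : 0 < swap_ratio g e0 T by apply: swap_ratio_gt0.
have tV : (swap_ratio g e0 T)^-1 * y ^+ T.+1 <= d by rewrite mulrC ler_pdivrMr.
have yT : 1 <= y ^+ T.+1 by rewrite exprn_ege1.
have tV1 : (swap_ratio g e0 T)^-1 <= d.
  by apply: le_trans tV; rewrite ler_peMr // invr_ge0 ltW.
have t1 : 1 <= swap_ratio g e0 T.
  by rewrite -invf_le1 // (le_trans tV1).
have e0y : e0 * y <= d by rewrite -ey ler_wpM2l // ltW.
have e0d : e0 <= d by apply: le_trans e0y; rewrite ler_peMr // ltW.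
set N := (k * B)%N in htail hbad.
have pp : 0 <= p < 1 by rewrite ltW.
have kp8 : 0 < kappa / 8 by rewrite divr_gt0.
have [m [m0 hm]] := pow_small (N%:R * ln (5 * g) * 2) pp kp8.
have ym1 : 1 <= y ^+ (m + 2) by rewrite exprn_ege1.
have ym0 : 0 < y ^+ (m + 2) by exact: lt_le_trans ym1.
pose eta := d / y ^+ (m + 2).
have eta0 : 0 < eta by rewrite divr_gt0.
have etay : eta * y ^+ (m + 2) = d by rewrite /eta divfK ?gt_eqF.
have etad : eta <= d by rewrite -etay ler_peMr // ltW.
pose J := (n + m + 3)%N.
have nJ : (n < J)%N by rewrite /J -addnA -addn1 leq_add2l; clear; lia.
have mJ : (m + 2 <= J)%N by rewrite /J; clear; lia.
have small1 : 2 * e0 + eta <= 1 by move: e0d etad d1; clear; lra.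
have small2 : (swap_ratio g e0 T)^-1 + eta <= 1 by move: tV1 etad d1; clear; lra.
have dd : 2 * d = dl by rewrite /d; field.
exists e0, eta, rho, T, n, m, J; do 4 (split; first by split=> //; rewrite -mulrA -dd ?ey ?etay ?ler_pM2l //).
have N0 : 0 < (N%:R : R) by rewrite ltr0n muln_gt0 k0.
have cut0 : 0 <= (y ^+ n)^-1 by rewrite invr_ge0 exprn_ge0 // ltW.
have cut1 : (y ^+ n)^-1 <= 1 by rewrite invf_le1 ?exprn_gt0 // exprn_ege1.
have h01 : 0 <= (1 : R) <= 1 by rewrite ler01 lexx.
have hdet s := det_perturbed e0 eta (y ^+ n)^-1 rho T n m g1 1 J s.
have hle s := opnorm_perturbed rho n m g1 e00 eta0 cut0 cut1 small1 small2 J s h01.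
have hs := avg_small (eta := eta) g1 e00 rho3 rhoT Tn nJ mJ p0 p1 p2 y0 z0 kp k0 B0 t1 Lam1 hdet hle hk hB.
have hl := lam_avg (ltW p0) (ltW p1) (J + J) hdet N.
exact: budget N0 kp htail hbad hm hl hs.
Qed.

Lemma exists_perturbation (alpha p s : R) (mu : probability Sigma R) (delta kappa : R) :
  0 < alpha -> 1 / 2 < p -> p < 1 -> 1 < s -> is_bernoulli p mu ->
  2 `^ alpha <= s `^ (4 * p - 2) -> 0 < delta -> 0 < kappa -> kappa <= (2 * p - 1) * ln s ->
  exists L, [/\ CaSL alpha L, holder_norm alpha (fun x => L x - A_sigma s x) < delta,
    locally_constant L & lyap mu L = kappa].
Proof.
move=> a0 ph p1 s1 hmu hs dl0 k0 kle.
have p2 : 1 <= 2 * p by move: ph; clear; lra.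
have p0 : 0 < p by move: ph; clear; lra.
have s0 : 0 < s by exact: lt_trans s1.
pose g := s + delta / 64.
have gs : s < g by rewrite ltrDl divr_gt0.
have g1 : 1 < g by exact: lt_trans gs.
have g0 : 0 < g by exact: lt_trans g1.
have lgs : ln s < ln g by rewrite ltr_ln.
have y1 : 1 <= 2 `^ alpha :> R by exact: y2_ge1.
have y0 : 0 < 2 `^ alpha :> R by exact: lt_le_trans y1.
have hy : ln (2 `^ alpha) < (4 * p - 2) * ln g.
  apply: le_lt_trans (_ : (4 * p - 2) * ln s < _); last by rewrite ltr_pM2l //; move: ph; clear; lra.
  by rewrite -ln_powR ler_ln ?posrE ?powR_gt0.
pose dl := Num.min 2^-1 (delta / (8 * 48 * g * 4)).
have c0 : 0 < 8 * 48 * g * 4 by rewrite !mulr_gt0.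
have dlp : 0 < dl by rewrite lt_min; apply/andP; split; [rewrite invr_gt0|exact: divr_gt0].
have dl2 : dl <= 2^-1 by rewrite ge_min lexx.
have dlg : 8 * (48 * g * dl) <= delta / 4.
  have : dl <= delta / (8 * 48 * g * 4) by rewrite ge_min lexx orbT.
  rewrite ler_pdivlMr // => h; rewrite ler_pdivlMr //; apply: le_trans h.
  by rewrite le_eqVlt; apply/orP; left; apply/eqP; ring.
have [e0 [eta [rho [T [n [m [J [h1 [h2 [h3 [h4 h5]]]]]]]]]]] :=
  exists_parameters p2 p1 g1 y1 hy k0 dlp dl2.
case: h1 h2 h3 h4 => e00 eta0 small1 small2 [rho3 rhoT Tn] [m0 nJ mJ] [hrho hn hT hm].
set cut := ((2 `^ alpha) ^+ n)^-1 in h5.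
have cut0 : 0 <= cut by rewrite invr_ge0 exprn_ge0 // ltW.
have cut1 : cut <= 1 by rewrite invf_le1 ?exprn_gt0 // exprn_ege1.
have dl1 : dl <= 1 by move: dl2; clear; lra.
have Lam1 : 1 <= 5 * g by move: g1; clear; lra.
have g4 : 0 <= 4 * g by rewrite mulr_ge0 // ltW.
have p01 : 0 <= p <= 1 by rewrite !ltW.
pose L x := perturbed g e0 eta cut rho T n m x J.
have hlt : kappa < lam p (J + J) (L 0).
  apply: lt_le_trans (lam_unperturbed_ge g1 e00 eta0 cut0 cut1 rho3 rhoT Tn m0 nJ mJ small1 small2 p01).
  by apply: le_lt_trans kle _; rewrite ltr_pM2l // subr_gt0; move: ph; clear; lra.
have [x hx lx] : exists2 x, 0 <= x <= 1 & lam p (J + J) (L x) = kappa.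
  apply: (lam_ivt (Lam := 5 * g) (C := 4 * g) (ltW p0) (ltW p1)) => //.
  - by move=> x; exact: dep_perturbed.
  - by move=> x u; exact: det_perturbed.
  - by move=> x u hx; exact: opnorm_perturbed.
  - by move=> x u v hx; exact: vnorm_perturbed.
  - by move=> x z u hx hz; exact: perturbed_lip.
  - by move=> x M hx M0; exact: spread_perturbed.
exists (pert alpha g e0 eta rho T n m J x); split.
- exact: (CaSL_pert a0 s1 g1 e00 eta0 rho3 rhoT Tn nJ mJ dl1 hrho hn hT hm hx).
- apply: le_lt_trans (holder_norm_diff a0 s1 g1 e00 eta0 rho3 rhoT Tn nJ mJ dl1 hrho hn hT hm hx) _.
  have -> : `|g - s| = delta / 64 by rewrite /g addrAC subrr add0r gtr0_norm // divr_gt0.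
  move: dlg dl0; clear; lra.
- exact: locally_constant_pert.
- by rewrite (lyap_pert alpha eta g1 e00 rho3 rhoT Tn nJ mJ x (ltW p0) (ltW p1) hmu).
Qed.

End Density.

Theorem theorem1 (R : realType) (alpha p s : R) (mu : probability Sigma R) :
  0 < alpha -> 1 / 2 < p -> p < 1 -> 1 < s ->
  is_bernoulli p mu ->
  2 `^ alpha <= s `^ (4 * p - 2) ->
  (forall U : set (Sigma -> 'M[R]_2),
     open_CaSL alpha U -> U (A_sigma s) ->
     forall kappa : R, 0 < kappa -> kappa <= (2 * p - 1) * ln s ->
     exists L, U L /\ locally_constant L /\ lyap mu L = kappa) /\
  (exists2 eps : R, 0 < eps &
     forall delta : R, 0 < delta ->
     exists B, CaSL alpha B /\
       holder_norm alpha (fun x => B x - A_sigma s x) < delta /\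
       eps <= `|lyap mu B - lyap mu (A_sigma s)|).
Proof.
move=> a0 ph p1 s1 hmu hs.
have h0 : 0 < (2 * p - 1) * ln s by rewrite mulr_gt0 ?ln_gt0 // subr_gt0; move: ph; clear; lra.
split=> [U [_ hU] UA kappa k0 kle|].
  have [e e0 he] := hU _ UA.
  have [L [hL dL lcL lyL]] := exists_perturbation a0 ph p1 s1 hmu hs e0 k0 kle.
  by exists L; split; first exact: he.
set h := (2 * p - 1) * ln s in h0; exists (h / 4); first by rewrite divr_gt0.
move=> delta dl0; have h2 : 0 < h / 2 by rewrite divr_gt0.
have h2h : h / 2 <= h by move: h0; clear; lra.
have [L1 [C1 d1 _ l1]] := exists_perturbation a0 ph p1 s1 hmu hs dl0 h0 (lexx h).
have [L2 [C2 d2 _ l2]] := exists_perturbation a0 ph p1 s1 hmu hs dl0 h2 h2h.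
have ar (a : R) : `|h - a| < h / 4 -> h / 4 <= `|h / 2 - a|.
  rewrite ltr_norml => /andP[hl hr]; rewrite ler_normr; apply/orP; right.
  by move: hl hr; clear; lra.
case: (lerP (h / 4) `|h - lyap mu (A_sigma s)|) => hle.
  by exists L1; rewrite l1.
by exists L2; rewrite l2; split=> //; split=> //; exact: ar.
Qed.
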